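(* Let $p^\lambda$ ($\lambda>0$) be the rescaled family of probability measures defined in the context. Let $R>0$, $0<\varepsilon<T$ and $\sigma>\frac N2+2$ be given. Then there exists $\tilde\lambda>0$ such that the family $\{p^\lambda(t,dx)\}_{\lambda>\tilde\lambda}$ is relatively compact in $C\left([\varepsilon,T];H^{-\sigma-1}(B_R)\right)$.
   Context: $N\ge1$ is an integer, $S=[-1,0]\times\mathbb R^N$, $\mathcal P(\mathbb R^N)$ is the set of Borel probability measures on $\mathbb R^N$ with the narrow topology, $C_b(\mathbb R^N)$ the bounded continuous functions, $Q$ a Borel probability measure on $S$. $B_R\subset\mathbb R^N$ is the ball of radius $R$ centred at the origin and $H^{-s}(B_R)=(H^s_0(B_R))'$ is the dual of the Hilbert space $H^s_0(B_R)$; for $s>\frac N2+1$ a probability measure $m$ on $\mathbb R^N$ is identified with the element $\phi\mapsto\int\phi\,dm$ of $H^{-s}(B_R)$ (functions in $H_0^s(B_R)$ being extended by zero). Standing assumptions: (i) $\alpha:[0,\infty)\times[-1,0]\to(0,\infty)$ is bounded and continuous, and there exist $M>0$, $\beta>0$ and a continuous function $\alpha_\infty:[-1,0]\to(0,\infty)$ with $|\alpha(t,\theta)-\alpha_\infty(\theta)|\le Me^{-\beta t}$ for all $t\ge0$, $\theta\in[-1,0]$; (ii) $\int_S|x|^2Q(d\theta,dx)<\infty$. Fix $u^0\in C([-1,0];\mathcal P(\mathbb R^N))$ and let $\mu\in C([-1,\infty);\mathcal P(\mathbb R^N))$ be the unique solution of the delay equation: $\mu(\theta,\cdot)=u^0(\theta,\cdot)$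 for $\theta\in[-1,0]$ and, for every $f\in C_b(\mathbb R^N)$, $t\mapsto\int f\,d\mu(t,\cdot)$ is $C^1$ on $(0,\infty)$ with, for all $t>0$, $$\frac{d}{dt}\int f(x)\mu(t,dx)=\int_S\alpha(t,\theta)\left[\int_{\mathbb R^N}f(x+z)\mu(t+\theta,dx)\right]Q(d\theta,dz)-\int f(x)\mu(t,dx)\int_S\alpha(t,\theta)Q(d\theta,dz).$$ Set $\Gamma=\int_S(-\theta)\alpha_\infty(\theta)Q(d\theta,dz)$ and $$H(t)=-\frac1{1+\Gamma}\int_0^t\int_S\alpha(s,\theta)\,x\,Q(d\theta,dx)\,ds\in\mathbb R^N,\quad t\ge0.$$ For $\lambda>0$ and $t\ge0$, $p^\lambda(t,dx)\in\mathcal P(\mathbb R^N)$ is defined by $\int\varphi(x)p^\lambda(t,dx)=\int\varphi\left(\frac{x+H(\lambda^2t)}{\lambda}\right)\mu(\lambda^2t,dx)$ for all $\varphi\in C_b(\mathbb R^N)$. *)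

(* Defs.v *)
From HB Require Import structures.
From mathcomp Require Import all_boot all_order all_algebra.
From mathcomp Require Import all_classical all_reals all_analysis ring.

Set Implicit Arguments.
Unset Strict Implicit.
Unset Printing Implicit Defensive.

Import Order.TTheory GRing.Theory Num.Theory.
Import numFieldNormedType.Exports.

Local Open Scope classical_set_scope.
Local Open Scope ring_scope.

(* R^n is 'rV[R]_n, with its Borel sigma-algebra. Since R^n is second countable,
   the product sigma-algebra of R * 'rV[R]_n is the Borel one. *)
HB.instance Definition _ (R : realType) (n : nat) :=
  @isMeasurable.Build (sigma_display (@open 'rV[R]_n)) 'rV[R]_n
    <<s @open 'rV[R]_n >> (@sigma_algebra0 _ setT _)
    (@sigma_algebraC _ (@open 'rV[R]_n)) (@sigma_algebra_bigcup _ setT _).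

Section lebesgue_row.
Context {R : realType}.

Lemma open_measurable_row n (U : set 'rV[R]_n) : open U -> measurable U.
Proof. exact: sub_gen_smallest. Qed.

Lemma measurable_coord n (i : 'I_n) :
  measurable_fun setT (fun v : 'rV[R]_n => v ord0 i).
Proof.
apply: (measurability _ (measurable_realfun.RGenOpens.measurableE R)).
move=> _ [_ [a [b ->] <-]]; rewrite setTI; apply: open_measurable_row.
apply: open_comp; last exact: interval_open.
by move=> v _; exact: coord_continuous.
Qed.

Definition rat_box n (ab : 'rV[rat]_n * 'rV[rat]_n) : set 'rV[R]_n :=
  [set v | forall i, v ord0 i \in `]ratr (ab.1 ord0 i), ratr (ab.2 ord0 i)[].

Lemma open_bigcup_rat_box n (U : set 'rV[R]_n) : open U ->
  U = \bigcup_(ab in [set ab | rat_box ab `<=` U]) rat_box ab.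
Proof.
move=> oU; apply/seteqP; split; last by move=> v [ab abU vab]; exact: abU.
move=> v Uv.
have /nbhs_ballP[e /= e0 veU] : nbhs v U by exact: open_nbhs_nbhs.
have aP i : exists q : rat, ratr q \in `](v ord0 i - e), (v ord0 i)[.
  by apply: rat_in_itvoo; rewrite ltrBlDr ltrDl.
have bP i : exists q : rat, ratr q \in `](v ord0 i), (v ord0 i + e)[.
  by apply: rat_in_itvoo; rewrite ltrDl.
have [a aE] := choice aP; have [b bE] := choice bP.
exists (\row_i a i, \row_i b i).
  move=> w /= wab; apply: veU; split => // i j; rewrite (ord1 i).
  have := wab j; rewrite /= !mxE in_itv/= => /andP[aw wb].
  have := aE j; rewrite in_itv/= => /andP[va _].
  have := bE j; rewrite in_itv/= => /andP[_ bv].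
  rewrite /ball/= ltr_distlC (lt_trans va)//=.
  exact: lt_trans wb bv.
move=> i; rewrite /= !mxE in_itv/=.
have := aE i; rewrite in_itv/= => /andP[_ ->].
by have := bE i; rewrite in_itv/= => /andP[-> _].
Qed.

Lemma measurable_fun_row d (T : measurableType d) n (f : T -> 'rV[R]_n) :
  (forall i, measurable_fun setT (fun x => f x ord0 i)) ->
  measurable_fun setT f.
Proof.
move=> mf; apply: (measurability (@open 'rV[R]_n)) => //.
move=> _ [U oU <-]; rewrite setTI (open_bigcup_rat_box oU) preimage_bigcup.
rewrite bigcup_mkcond; apply: countable_bigcupT_measurable => // ab.
case: ifPn => // _.
rewrite [X in measurable X](_ : _ = \bigcap_(i in [set: 'I_n])
    (setT `&` (fun x => f x ord0 i) @^-1`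
      `]ratr (ab.1 ord0 i), ratr (ab.2 ord0 i)[)); last first.
  by apply/seteqP; split => [x H i _|x H i]; [split => //; exact: H|
    have [] := H i I].
apply: fin_bigcap_measurable => // i _.
by apply: mf => //; exact: measurable_itv.
Qed.

Definition consrow n (p : R * 'rV[R]_n) : 'rV[R]_n.+1 :=
  \row_i (if unlift ord0 i is Some j then p.2 ord0 j else p.1).

Definition unconsrow n (v : 'rV[R]_n.+1) : R * 'rV[R]_n :=
  (v ord0 ord0, \row_j v ord0 (lift ord0 j)).

Lemma consrowK n : cancel (@consrow n) (@unconsrow n).
Proof.
move=> [a v]; rewrite /unconsrow /consrow !mxE unlift_none; congr pair.
by apply/rowP => j; rewrite !mxE liftK.
Qed.

Lemma measurable_consrow n : measurable_fun setT (@consrow n).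
Proof.
apply: measurable_fun_row => i.
under eq_fun do rewrite mxE.
case: (unliftP ord0 i) => [j|] _; last exact: measurable_fst.
exact: (measurableT_comp (measurable_coord j) measurable_snd).
Qed.

Lemma measurable_unconsrow n : measurable_fun setT (@unconsrow n).
Proof.
apply/measurable_fun_pairP; split; first exact: measurable_coord.
apply: measurable_fun_row => i /=.
under eq_fun do rewrite mxE.
exact: measurable_coord.
Qed.

Section step.
Variables (n : nat) (m : {sigma_finite_measure set 'rV[R]_n -> \bar R}).

Definition lebesgue_step : set 'rV[R]_n.+1 -> \bar R :=
  pushforward (@lebesgue_measure R \x m)%E (@consrow n).

Let lebesgue_step0 : lebesgue_step set0 = 0%E.
Proof. by rewrite /lebesgue_step /pushforward preimage_set0 measure0. Qed.

Let lebesgue_step_ge0 A : (0 <= lebesgue_step A)%E.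
Proof. exact: measure_ge0 (@lebesgue_measure R \x m)%E _. Qed.

Let lebesgue_step_sigma_additive : semi_sigma_additive lebesgue_step.
Proof.
move=> F mF tF mUF; rewrite /lebesgue_step /pushforward preimage_bigcup.
apply: measure_semi_sigma_additive.
- by move=> k; rewrite -[X in measurable X]setTI; exact: measurable_consrow.
- apply/trivIsetP => /= i j _ _ ij; rewrite -preimage_setI.
  by move/trivIsetP : tF => /(_ _ _ _ _ ij) ->//; rewrite preimage_set0.
- rewrite -preimage_bigcup -[X in measurable X]setTI.
  exact: measurable_consrow.
Qed.

HB.instance Definition _ := isMeasure.Build _ _ _ lebesgue_step
  lebesgue_step0 lebesgue_step_ge0 lebesgue_step_sigma_additive.

Let lebesgue_step_sigma_finite : sigma_finite setT lebesgue_step.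
Proof.
have /sigma_finiteP[F [TF ndF Foo]] := sigma_finiteT (@lebesgue_measure R).
have /sigma_finiteP[G [TG ndG Goo]] := sigma_finiteT m.
exists (fun k => @unconsrow n @^-1` (F k `*` G k)).
  rewrite -preimage_bigcup [X in _ @^-1` X](_ : _ = setT) ?preimage_setT//.
  rewrite -setXTT TF TG predeqE => -[x y]; split.
    by move=> [k _ []/= ? ?]; split; exists k.
  move=> [/= [j _ Fjx] [k _ Gky]]; exists (maxn j k) => //; split.
  - by move: x Fjx; exact/subsetPset/ndF/leq_maxl.
  - by move: y Gky; exact/subsetPset/ndG/leq_maxr.
move=> k; have [mF Fk] := Foo k; have [mG Gk] := Goo k; split.
  rewrite -[X in measurable X]setTI; apply: measurable_unconsrow => //.
  exact: measurableX.
rewrite /lebesgue_step /pushforward -comp_preimage.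
rewrite (_ : @unconsrow n \o @consrow n = idfun) ?preimage_id; last first.
  by apply/funext => p /=; rewrite consrowK.
by rewrite product_measure1E// lte_mul_pinfty// ge0_fin_numE.
Qed.

HB.instance Definition _ := Measure_isSigmaFinite.Build _ _ _ lebesgue_step
  lebesgue_step_sigma_finite.

End step.

(* Lebesgue measure on R^n, by iterating the product of measures. *)
Fixpoint lebesgue_row n : {sigma_finite_measure set 'rV[R]_n -> \bar R} :=
  if n is k.+1 then lebesgue_step (lebesgue_row k) else \d_(0 : 'rV[R]_0).

End lebesgue_row.

Section euclidean.
Context {R : realType} {N : nat}.
Implicit Types (x y : 'rV[R]_N) (r : R).

Definition dotp x y : R := \sum_i x ord0 i * y ord0 i.

(* `|x| is the sup norm on 'rV[R]_N, hence the explicit Euclidean norm. *)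
Definition enorm x : R := Num.sqrt (dotp x x).

Definition eball r : set 'rV[R]_N := [set x | enorm x < r].

Definition slab : set (R * 'rV[R]_N) := `[-1, 0] `*` setT.

(* C_b(R^N), and then C^k(R^N) by iterated partial derivatives. *)
Definition Cb : set ('rV[R]_N -> R) :=
  [set f | continuous f /\ exists M, forall x, `|f x| <= M].

Fixpoint Ck k (f : 'rV[R]_N -> R) : Prop :=
  continuous f /\
  (if k is j.+1 then forall i : 'I_N,
     (forall x, derivable f x (delta_mx ord0 i)) /\
     Ck j (fun x => 'D_(delta_mx ord0 i) f x)
   else True).

(* C_c^oo(B_r). *)
Definition test_fun r : set ('rV[R]_N -> R) :=
  [set f | (forall k, Ck k f) /\
    compact (closure [set x | f x != 0]) /\
    closure [set x | f x != 0] `<=` eball r].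

End euclidean.

Section narrow.
Context {R : realType} {N : nat}.

(* The narrow topology is the coarsest one on the probability measures making
   m |-> \int f dm continuous for every f in C_b(R^N). *)
Definition narrow_pairing (m : probability 'rV[R]_N R) :
    {ptws set_type (@Cb R N) -> R} :=
  fun f => \int[m]_x (set_val f) x.

Definition narrow : Type := initial_topology narrow_pairing.
HB.instance Definition _ := Topological.on narrow.

End narrow.
Arguments narrow : clear implicits.

Section sobolev.
Context {R : realType} {N : nat}.
Implicit Types (u v phi : 'rV[R]_N -> R) (s r : R).

(* Real and imaginary parts of \int u(x) e^{i x.xi} dx. *)
Definition fourier_cos u (xi : 'rV[R]_N) : R :=
  \int[lebesgue_row N]_x (u x * cos (dotp x xi)).
Definition fourier_sin u (xi : 'rV[R]_N) : R :=
  \int[lebesgue_row N]_x (u x * sin (dotp x xi)).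

(* Squared norm of H^s(R^N), up to the constant factor (2 pi)^-N. *)
Definition sobolev_sqnorm s u : \bar R :=
  (\int[lebesgue_row N]_xi
    ((1 + dotp xi xi) `^ s * (fourier_cos u xi ^+ 2 + fourier_sin u xi ^+ 2))%:E)%E.

Definition sobolev_norm s u : R := Num.sqrt (fine (sobolev_sqnorm s u)).

(* H^s_0(B_r), the closure of C_c^oo(B_r) in H^s(R^N), for s > N/2: each class
   has then exactly one continuous representative, and the elements are these
   representatives, extended by zero outside B_r. *)
Definition sobolev0 s r : set ('rV[R]_N -> R) :=
  [set u | [/\ continuous u, (forall x, ~ eball r x -> u x = 0),
     (sobolev_sqnorm s u < +oo)%E &
     exists phi : nat -> 'rV[R]_N -> R,
       (forall k, test_fun r (phi k)) /\
       sobolev_sqnorm s (fun x => u x - phi k x) @[k --> \oo] --> 0%E]].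

(* H^-s(B_r) = (H^s_0(B_r))'. Functionals are total functions made canonical
   by the value 0 outside H^s_0(B_r), so that Leibniz equality is equality of
   functionals on H^s_0(B_r). *)
Record Hdual s r : Type := MkHdual {
  hfun :> ('rV[R]_N -> R) -> R ;
  hfun_lin : forall (a : R) u v, sobolev0 s r u -> sobolev0 s r v ->
    hfun (fun x => a * u x + v x) = a * hfun u + hfun v ;
  hfun_bnd : exists C : R, forall u, sobolev0 s r u -> `|hfun u| <= C * sobolev_norm s u ;
  hfun_out : forall u, ~ sobolev0 s r u -> hfun u = 0 }.

Section structure.
Variables s r : R.
Local Notation D := (Hdual s r).

Lemma Hdual_eq (f g : D) : (forall u, sobolev0 s r u -> f u = g u) -> f = g.
Proof.
move=> fg; have E : hfun f = hfun g.
  apply/funext => u; have [/fg//|nu] := pselect (sobolev0 s r u).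
  by rewrite !hfun_out.
case: f g E {fg} => [f fl fb fo] [g gl gb go] /= E.
by subst g; congr MkHdual; exact: Prop_irrelevance.
Qed.

HB.instance Definition _ := gen_eqMixin D.
HB.instance Definition _ := gen_choiceMixin D.

Lemma sobolev_norm_ge0 u : 0 <= sobolev_norm s u.
Proof. exact: sqrtr_ge0. Qed.

Lemma hfun_bnd0 (f : D) : exists2 C : R, 0 <= C &
  forall u, sobolev0 s r u -> `|f u| <= C * sobolev_norm s u.
Proof.
have [C Cf] := hfun_bnd f; exists `|C| => // u Hu.
apply: (le_trans (Cf u Hu)).
by rewrite ler_wpM2r ?sobolev_norm_ge0 ?ler_norm.
Qed.

Program Definition Hdual0 : D := @MkHdual s r (fun _ => 0) _ _ _.
Next Obligation. by move=> a u v _ _; rewrite mulr0 addr0. Qed.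
Next Obligation. by exists 0 => u _; rewrite normr0 mul0r. Qed.
Next Obligation. by []. Qed.

Program Definition Hdual_comb (a : R) (f g : D) : D :=
  @MkHdual s r (fun u => a * f u + g u) _ _ _.
Next Obligation.
move=> a f g b u v Hu Hv /=; rewrite !hfun_lin//; ring.
Qed.
Next Obligation.
move=> a f g; have [C C0 Cf] := hfun_bnd0 f; have [C' C'0 Cg] := hfun_bnd0 g.
exists (`|a| * C + C') => u Hu; rewrite (le_trans (ler_normD _ _))// mulrDl.
rewrite lerD ?Cg// normrM -mulrA.
by rewrite ler_wpM2l// Cf.
Qed.
Next Obligation. by move=> a f g u nu /=; rewrite !hfun_out// mulr0 addr0. Qed.

Definition Hdual_add (f g : D) : D := Hdual_comb 1 f g.
Definition Hdual_opp (f : D) : D := Hdual_comb (-1) f Hdual0.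
Definition Hdual_scale a (f : D) : D := Hdual_comb a f Hdual0.

Let addE f g u : Hdual_add f g u = f u + g u.
Proof. by rewrite /= mul1r. Qed.
Let oppE f u : Hdual_opp f u = - f u.
Proof. by rewrite /= addr0 mulN1r. Qed.
Let scaleE a f u : Hdual_scale a f u = a * f u.
Proof. by rewrite /= addr0. Qed.

Let addA : associative Hdual_add.
Proof. by move=> f g h; apply: Hdual_eq => u _; rewrite !addE addrA. Qed.
Let addC : commutative Hdual_add.
Proof. by move=> f g; apply: Hdual_eq => u _; rewrite !addE addrC. Qed.
Let add0 : left_id Hdual0 Hdual_add.
Proof. by move=> f; apply: Hdual_eq => u _; rewrite !addE add0r. Qed.
Let addN : left_inverse Hdual0 Hdual_opp Hdual_add.
Proof. by move=> f; apply: Hdual_eq => u _; rewrite addE oppE addNr. Qed.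

HB.instance Definition _ := GRing.isZmodule.Build D addA addC add0 addN.

Let scaleA (a b : R) (f : D) :
  Hdual_scale a (Hdual_scale b f) = Hdual_scale (a * b) f.
Proof. by apply: Hdual_eq => u _; rewrite !scaleE mulrA. Qed.
Let scale1 : left_id 1 Hdual_scale.
Proof. by move=> f; apply: Hdual_eq => u _; rewrite !scaleE mul1r. Qed.
Let scaleDr : right_distributive Hdual_scale +%R.
Proof.
by move=> a f g; apply: Hdual_eq => u _; rewrite !(scaleE, addE) mulrDr.
Qed.
Let scaleDl (f : D) : {morph Hdual_scale^~ f : a b / a + b}.
Proof.
by move=> a b; apply: Hdual_eq => u _; rewrite !(scaleE, addE) mulrDl.
Qed.

HB.instance Definition _ := GRing.Zmodule_isLmodule.Build R D
  scaleA scale1 scaleDr scaleDl.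

Definition op_bounds (f : D) : set R :=
  [set C | 0 <= C /\ forall u, sobolev0 s r u -> `|f u| <= C * sobolev_norm s u].

Definition op_norm (f : D) : R := inf (op_bounds f).

Let has_inf_op f : has_inf (op_bounds f).
Proof.
split; last by exists 0 => C [].
by have [C C0 Cf] := hfun_bnd0 f; exists C.
Qed.

Lemma op_normP (f : D) u : sobolev0 s r u -> `|f u| <= op_norm f * sobolev_norm s u.
Proof.
move=> Hu; have [n0|] := eqVneq (sobolev_norm s u) 0.
  by have [C C0 Cf] := hfun_bnd0 f; have := Cf u Hu; rewrite n0 !mulr0.
rewrite neq_lt ltNge sobolev_norm_ge0/= => n0.
rewrite -ler_pdivrMr//; apply: lb_le_inf; first by have [] := has_inf_op f.
by move=> C [C0 Cf]; rewrite ler_pdivrMr// Cf.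
Qed.

Lemma op_norm_ge0 (f : D) : 0 <= op_norm f.
Proof. by apply: lb_le_inf; [have [] := has_inf_op f | move=> C []]. Qed.

Lemma op_norm_le (f : D) C : 0 <= C ->
  (forall u, sobolev0 s r u -> `|f u| <= C * sobolev_norm s u) -> op_norm f <= C.
Proof. by move=> C0 Cf; apply: ge_inf; [have [] := has_inf_op f|]. Qed.

Let op_normD f g : op_norm (f + g) <= op_norm f + op_norm g.
Proof.
apply: op_norm_le => [|u Hu]; first by rewrite addr_ge0 ?op_norm_ge0.
rewrite [X in `|X|]addE (le_trans (ler_normD _ _))// mulrDl.
by rewrite lerD ?op_normP.
Qed.

Let op_normZ_le (a : R) f : op_norm (a *: f) <= `|a| * op_norm f.
Proof.
apply: op_norm_le => [|u Hu]; first by rewrite mulr_ge0 ?op_norm_ge0.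
by rewrite [X in `|X|]scaleE normrM -mulrA ler_wpM2l ?op_normP.
Qed.

Let op_normZ (a : R) f : op_norm (a *: f) = `|a| * op_norm f.
Proof.
apply/eqP; rewrite eq_le op_normZ_le/=.
have [->|a0] := eqVneq a 0; first by rewrite normr0 mul0r op_norm_ge0.
rewrite -ler_pdivlMl ?normr_gt0// -normfV.
by rewrite -[X in op_norm X <= _](scalerK a0) op_normZ_le.
Qed.

Let op_norm_eq0 f : op_norm f = 0 -> f = 0.
Proof.
move=> f0; apply: Hdual_eq => u Hu.
by apply/eqP; rewrite -normr_le0 (le_trans (op_normP f Hu))// f0 mul0r.
Qed.

HB.instance Definition _ := Lmodule_isNormed.Build R D
  op_normD op_normZ op_norm_eq0.

End structure.
End sobolev.
Arguments Hdual {R} N s r.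

(* l is the element of H^-s(B_r) with which the measure m is identified; since
   l is bounded, this contains the fact that u |-> \int u dm is bounded. *)
Definition is_measure_elt {R : realType} {N : nat} {s r : R}
    (l : Hdual N s r) (m : probability 'rV[R]_N R) :=
  forall u, sobolev0 s r u -> l u = \int[m]_x u x.

Definition Cunif (K : topologicalType) (E : uniformType) : Type :=
  initial_topology (id : continuousType K E -> {uniform K -> E}).
HB.instance Definition _ (K : topologicalType) (E : uniformType) :=
  Uniform.on (Cunif K E).

Definition Cseg {R : realType} (a b : R) (E : uniformType) : Type :=
  Cunif (set_type `[a, b]) E.
HB.instance Definition _ (R : realType) (a b : R) (E : uniformType) :=
  Uniform.on (Cseg a b E).

Section delay_equation.
Context {R : realType} {N : nat}.
Implicit Types (alpha : R -> R -> R) (alpha_inf : R -> R).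
Implicit Types (Q : probability (R * 'rV[R]_N)%type R).
Implicit Types (mu : R -> probability 'rV[R]_N R).

Definition rate_assumption alpha alpha_inf (M beta : R) :=
  [/\ (forall t theta, 0 <= t -> theta \in `[-1, 0] -> 0 < alpha t theta),
      (exists K, forall t theta, 0 <= t -> theta \in `[-1, 0] ->
         alpha t theta <= K) &
      {within `[0, +oo[ `*` `[-1, 0],
         continuous (fun p : R * R => alpha p.1 p.2)}] /\
  [/\ (forall theta, theta \in `[-1, 0] -> 0 < alpha_inf theta),
      {within `[-1, 0], continuous alpha_inf} &
      (forall t theta, 0 <= t -> theta \in `[-1, 0] ->
         `|alpha t theta - alpha_inf theta| <= M * expR (- (beta * t)))].

Definition delay_rhs alpha Q mu (f : 'rV[R]_N -> R) (t : R) : R :=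
  \int[Q]_(p in slab) (alpha t p.1 * \int[mu (t + p.1)]_x f (x + p.2))
  - (\int[mu t]_x f x) * \int[Q]_(p in slab) alpha t p.1.

Definition delay_solution alpha Q (u0 : R -> probability 'rV[R]_N R) mu :=
  [/\ {within `[-1, +oo[, continuous (mu : R -> narrow R N)},
      (forall theta, theta \in `[-1, 0] ->
         forall A, measurable A -> mu theta A = u0 theta A) &
      forall f : 'rV[R]_N -> R, Cb f ->
        (forall t : R, 0 < t ->
           is_derive t (1 : R) (fun t : R => \int[mu t]_x f x)
             (delay_rhs alpha Q mu f t)) /\
        {in `]0, +oo[, continuous (derive1 (fun t : R => \int[mu t]_x f x))}].

Definition Gamma_const alpha_inf Q : R :=
  \int[Q]_(p in slab) (- p.1 * alpha_inf p.1).

Definition drift alpha alpha_inf Q (t : R) : 'rV[R]_N :=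
  \row_i (- (1 + Gamma_const alpha_inf Q)^-1 *
    \int[lebesgue_measure]_(s in `[0, t])
      \int[Q]_(p in slab) (alpha s p.1 * p.2 ord0 i)).

Definition rescaled_family alpha alpha_inf Q mu
    (p : R -> R -> probability 'rV[R]_N R) :=
  forall lambda t, 0 < lambda -> 0 <= t -> forall phi, Cb phi ->
    \int[p lambda t]_x phi x =
    \int[mu (lambda ^+ 2 * t)]_x
      phi (lambda^-1 *: (x + drift alpha alpha_inf Q (lambda ^+ 2 * t))).

End delay_equation.

(* Main.v *)
(* By the Sobolev embedding, functions of H^(sigma+1)_0 are bounded and Lipschitz
   with constants proportional to their norm, so the unit ball is totally bounded
   for the sup norm, and for that norm probability measures act as contractions.
   Relative compactness then follows in the manner of Arzela-Ascoli from
   equicontinuity in time of \int phi dp^lambda(t) for each test function phi,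
   uniformly in lambda.

   For the latter, the delay equation is dissipative: over one unit of time the
   oscillation of t |-> \int f dmu(t) shrinks by the factor 1 - e^-K, up to a
   multiple of the Lipschitz constant of f. So, for large times, the observables
   g of f(x) = phi((x + h) / lambda) oscillate by O(1 / lambda) over bounded time
   intervals, and the functional
     g(t) + \int alpha_inf(theta) (\int_(t+theta)^t g) dQ
   changes per unit of time only by a first order term in 1 / lambda, up to
   O(lambda^-2). Moving h along H compensates that term: this is where the factor
   1 / (1 + Gamma) in H comes from. Adding up the lambda^2 (t2 - t1) steps leaves
   C (1 / lambda + t2 - t1). *)
Require Import Defs.
From mathcomp Require Import finmap.
From mathcomp Require Import all_boot all_order all_algebra.
From mathcomp Require Import all_classical all_reals all_analysis.
From mathcomp Require Import ring lra.

Set Implicit Arguments.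
Unset Strict Implicit.
Unset Printing Implicit Defensive.

Import Order.TTheory GRing.Theory Num.Theory.
Import numFieldNormedType.Exports measurable_realfun.

Local Open Scope classical_set_scope.
Local Open Scope ring_scope.

(** * Smoothed Fourier inversion and the Sobolev embedding *)

(** The bound C (1 / lambda + t2 - t1) is not a modulus of continuity at a fixed lambda, since 1 /
    lambda does not tend to 0 with t2 - t1. For a given accuracy it serves for large lambda only; on
    the remaining bounded range of lambda the evolution, with rates of order lambda^2, is Lipschitz
    in time by a crude bound. The family lambda > 1 is therefore already suitable.

    There are about lambda^2 unit steps, so each may cost only lambda^-2. The gradient of phi(x /
    lambda) brings one factor 1 / lambda, the oscillation of its observables the other. The memory
    of the initial datum and the distance of alpha to its limit carry no power of lambda: they decay
    with the number k of the step, and k is at least of order epsilon lambda^2. This is where t >=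
    epsilon enters.

    The Sobolev norm only sees a weighted L2 norm of the transform. Neither Plancherel's theorem nor
    an inversion theorem is invoked: point values are limits of inversion integrals damped by a
    product of exponentials, whose kernel is explicit.

    Compactness is tested on ultrafilters, along which bounded values converge, so that no
    subsequence is extracted. *)

Section one_dim.
Context {R : realType}.
Local Notation leb := (@lebesgue_measure R).

(** The fundamental theorem of calculus is applied on half-lines below, so integrals over the line
    are folded first. *)
Lemma ge0_integral_fold (f : R -> R) : (forall x, 0 <= f x) -> continuous f ->
  (\int[leb]_x (f x)%:E =
   \int[leb]_(x in `[0%R, +oo[) (f x + f (- x))%:E)%E.
Proof.
move=> f0 cf.
have mf : measurable_fun [set: R] f by exact: continuous_measurable_fun.
have cfN : continuous (f \o -%R).
  by move=> x; apply: continuous_comp; [exact: opp_continuous|exact: cf].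
have mfN : measurable_fun [set: R] (f \o -%R) by exact: continuous_measurable_fun.
under [RHS]eq_integral do rewrite EFinD.
rewrite ge0_integralD//=; last 4 first.
- by move=> x _; rewrite lee_fin.
- exact/measurable_EFinP/measurable_funTS.
- by move=> x _; rewrite lee_fin.
- exact/measurable_EFinP/measurable_funTS.
have -> : [set: R] = `[0, +oo[ `|` ~` `[0, +oo[ by rewrite setUv.
rewrite ge0_integral_setU//= ; last 4 first.
  exact: measurableC.
  by apply/measurable_EFinP; rewrite setUv.
  by move=> x _; rewrite lee_fin.
  exact/disj_setPCl.
congr (_ + _)%E.
rewrite setCitvr integral_itv_bndo_bndc; last exact/measurable_EFinP/measurable_funTS.
rewrite -{1}oppr0 ge0_integration_by_substitutionNy//.
exact: continuous_subspaceT.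
Qed.

Lemma cvg_expRN_bounded (d C : R) (g : R -> R) : 0 < d -> (forall x, `|g x| <= C) ->
  (expR (- (d * x)) * g x) @[x --> +oo] --> (0 : R).
Proof.
move=> d0 gC.
have C0 : 0 <= C by rewrite (le_trans _ (gC 0)).
have h : (expR (- (d * x)) * C) @[x --> +oo] --> (0 : R).
  rewrite -[X in _ --> X](mul0r C); apply: cvgMr_tmp.
  apply: (@cvg_comp _ _ _ (fun x => d * x) (fun x => expR (- x)) _ +oo).
    exact: gt0_cvgMry.
  exact: cvgr_expR.
apply: norm_cvg0; apply: (squeeze_cvgr _ (cvg_cst 0) h).
by near=> x; rewrite normr_ge0/= normrM ger0_norm ?expR_ge0// ler_wpM2l// expR_ge0.
Unshelve. all: by end_near. Qed.

Definition dampc (d x : R) := expR (- (d * `|x|)).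

Lemma continuous_dampc d : continuous (dampc d).
Proof.
move=> x; rewrite /dampc.
apply: continuous_comp; last exact: continuous_expR.
by apply: cvgN; apply: cvgMl_tmp; exact: norm_continuous.
Qed.

Lemma continuous_scale_cos (a : R) : continuous (fun x : R => cos (a * x)).
Proof.
move=> x; apply: continuous_comp; last exact: continuous_cos.
exact: mulrl_continuous.
Qed.

Lemma continuous_scale_sin (a : R) : continuous (fun x : R => sin (a * x)).
Proof.
move=> x; apply: continuous_comp; last exact: continuous_sin.
exact: mulrl_continuous.
Qed.

Lemma dampc_ge0 d x : 0 <= dampc d x. Proof. exact: expR_ge0. Qed.

(** The Fourier transform of [dampc d]: [pi *+ 2] times the Cauchy density of scale [d], which is
    the Poisson kernel of the half-plane. *)
Definition poisson (d x : R) := d / (d ^+ 2 + x ^+ 2) *+ 2.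

(** The summand 1 keeps the integrand nonnegative, as the improper fundamental theorem of calculus
    requires; [Rintegral_dampc_cos] subtracts it again. *)
Lemma integral_dampc_half (d a : R) : 0 < d ->
  (\int[leb]_(x in `[0%R, +oo[) (expR (- (d * x)) * (1 + cos (a * x)) *+ 2)%:E =
   (d^-1 *+ 2 + poisson d a)%:E)%E.
Proof.
move=> d0.
have da0 : d ^+ 2 + a ^+ 2 != 0.
  by rewrite gt_eqF// ltr_pwDl ?exprn_gt0// sqr_ge0.
pose F x := expR (- (d * x)) *
  ((- d^-1 + (a * sin (a * x) - d * cos (a * x)) / (d ^+ 2 + a ^+ 2)) *+ 2).
have dF (x : R) : is_derive x (1 : R) F (expR (- (d * x)) * (1 + cos (a * x)) *+ 2).
  rewrite /F; apply: is_derive_eq.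
  rewrite /GRing.scale /=; field.
  by rewrite da0 gt_eqF.
have F0 : F x @[x --> +oo] --> (0 : R).
  apply: (@cvg_expRN_bounded _ ((d^-1 + (`|a| + d) / (d ^+ 2 + a ^+ 2)) *+ 2)) => // x.
  rewrite normrMn lerMn2r/=; apply: (le_trans (ler_normD _ _)).
  rewrite normrN ger0_norm ?invr_ge0 ?(ltW d0)// lerD2l normrM
    [X in _ * X <= _]ger0_norm ?invr_ge0; last first.
    by rewrite addr_ge0// sqr_ge0.
  rewrite ler_wpM2r ?invr_ge0 ?addr_ge0 ?sqr_ge0//.
  rewrite (le_trans (ler_normB _ _))// !normrM lerD//.
    by rewrite ler_piMr// ler_norml sin_geN1 sin_le1.
  by rewrite (gtr0_norm d0) ler_piMr ?(ltW d0)// ler_norml cos_geN1 cos_le1.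
rewrite (@ge0_continuous_FTC2y _ _ F _ 0)//.
- rewrite /F !mulr0 oppr0 expR0 sin0 cos0 mul1r -EFinB; congr EFin.
  rewrite /poisson; field.
  by rewrite da0 gt_eqF.
- apply: continuous_subspaceT => x.
  by apply: differentiable_continuous; apply/derivable1_diffP; exact: ex_derive.
- apply: cvg_at_right_filter.
  by apply: differentiable_continuous; apply/derivable1_diffP; exact: ex_derive.
- by move=> x _; rewrite derive1E; exact: derive_val.
Qed.

Lemma integral_dampc_1Dcos (d a : R) : 0 < d ->
  (\int[leb]_x (dampc d x * (1 + cos (a * x)))%:E = (d^-1 *+ 2 + poisson d a)%:E)%E.
Proof.
move=> d0; rewrite ge0_integral_fold.
- rewrite -integral_dampc_half//; apply: eq_integral => x.
  rewrite inE/= in_itv/= andbT => x0; congr EFin.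
  by rewrite /dampc normrN ger0_norm// mulrN cosN -mulr2n.
- move=> x; rewrite mulr_ge0 ?dampc_ge0//.
- move=> x; apply: cvgM; first exact: continuous_dampc.
  by apply: cvgD; [exact: cvg_cst|exact: continuous_scale_cos].
Qed.

Lemma integral_dampc (d : R) : 0 < d ->
  (\int[leb]_x (dampc d x)%:E = (d^-1 *+ 2)%:E)%E.
Proof.
move=> d0; have := @integral_dampc_1Dcos d 0 d0.
under eq_integral do rewrite mul0r cos0 mulrC EFinM.
rewrite ge0_integralZl//; last 2 first.
- by apply/measurable_EFinP; apply: continuous_measurable_fun; exact: continuous_dampc.
- by move=> x _; rewrite lee_fin dampc_ge0.
rewrite /poisson expr0n/= addr0.
have -> : d / d ^+ 2 = d^-1 by field; rewrite gt_eqF.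
(* Twice the integral is known to be [4 / d]; before halving, the infinite values have to be
   excluded. *)
have : (0 <= \int[leb]_x (dampc d x)%:E)%E.
  by apply: integral_ge0 => x _; rewrite lee_fin dampc_ge0.
case: (\int[leb]_x (dampc d x)%:E)%E => [r _|_|//].
- by rewrite -EFinM => -[h]; congr EFin; lra.
- by rewrite mulry gtr0_sg// mul1e.
Qed.

Lemma integrable_dampc (d : R) : 0 < d -> leb.-integrable setT (EFin \o dampc d).
Proof.
move=> d0; apply/integrableP; split.
  by apply/measurable_EFinP; apply: continuous_measurable_fun; exact: continuous_dampc.
under eq_integral do rewrite /= ger0_norm ?dampc_ge0//.
by rewrite integral_dampc// ltry.
Qed.

Lemma integrable_dampcM (d : R) (g : R -> R) : 0 < d -> continuous g ->
  (forall x, `|g x| <= 1) ->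
  leb.-integrable setT (EFin \o (fun x => dampc d x * g x)).
Proof.
move=> d0 cg g1; apply: (le_integrable measurableT _ _ (integrable_dampc d0)) => //.
  apply/measurable_EFinP; apply: continuous_measurable_fun => x.
  by apply: cvgM; [exact: continuous_dampc|exact: cg].
by move=> x _ /=; rewrite lee_fin normrM ler_piMr.
Qed.

Lemma Rintegral_dampc_cos (d a : R) : 0 < d ->
  \int[leb]_x (dampc d x * cos (a * x)) = poisson d a.
Proof.
move=> d0.
have ic : leb.-integrable setT (EFin \o (fun x => dampc d x * cos (a * x))).
  apply: integrable_dampcM => //; first exact: continuous_scale_cos.
  by move=> x; rewrite ler_norml cos_geN1 cos_le1.
have : \int[leb]_x (dampc d x * (1 + cos (a * x))) = d^-1 *+ 2 + poisson d a.
  by rewrite /Rintegral integral_dampc_1Dcos.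
under eq_Rintegral do rewrite mulrDr mulr1.
rewrite RintegralD//; last exact: integrable_dampc.
rewrite [X in X + _]/Rintegral integral_dampc//=.
exact: addrI.
Qed.

(** Folding [dampc d x * (1 + sin (a * x))] cancels the odd sine and leaves the same integrand as
    folding [dampc d]. The summand 1 is again there for nonnegativity. *)
Lemma Rintegral_dampc_sin (d a : R) : 0 < d ->
  \int[leb]_x (dampc d x * sin (a * x)) = 0.
Proof.
move=> d0.
have ic : leb.-integrable setT (EFin \o (fun x => dampc d x * sin (a * x))).
  apply: integrable_dampcM => //; first exact: continuous_scale_sin.
  by move=> x; rewrite ler_norml sin_geN1 sin_le1.
have cs : continuous (fun x => dampc d x * (1 + sin (a * x))).
  move=> x; apply: cvgM; first exact: continuous_dampc.
  by apply: cvgD; [exact: cvg_cst|exact: continuous_scale_sin].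
have : \int[leb]_x (dampc d x * (1 + sin (a * x))) = d^-1 *+ 2.
  rewrite /Rintegral ge0_integral_fold//; last first.
    move=> x; rewrite mulr_ge0 ?dampc_ge0//.
  rewrite -[RHS]/(fine (d^-1 *+ 2)%:E) -integral_dampc//.
  rewrite [in RHS]ge0_integral_fold//; [|by move=> x; exact: dampc_ge0|exact: continuous_dampc].
  congr fine; apply: eq_integral => x _; congr EFin.
  by rewrite /dampc normrN mulrN sinN; ring.
under eq_Rintegral do rewrite mulrDr mulr1.
rewrite RintegralD//; last exact: integrable_dampc.
rewrite [X in X + _]/Rintegral integral_dampc//=.
by move=> /(congr1 (fun z => z - d^-1 *+ 2)); rewrite addrC addKr subrr.
Qed.

Lemma continuous_poisson (d : R) : 0 < d -> continuous (poisson d).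
Proof.
move=> d0 x; rewrite /poisson.
apply: cvgMn; apply: cvgM; first exact: cvg_cst.
apply: cvgV; first by rewrite gt_eqF// ltr_pwDl ?exprn_gt0// sqr_ge0.
by apply: cvgD; [exact: cvg_cst|exact: exprn_continuous].
Qed.

Lemma poisson_ge0 (d x : R) : 0 < d -> 0 <= poisson d x.
Proof.
by move=> d0; rewrite mulrn_wge0// divr_ge0 ?(ltW d0)// addr_ge0 ?sqr_ge0.
Qed.

(** The substitution [(y - x) / d] reduces the claim to the integral of [1 / (1 + y ^ 2)], known on
    a half-line and doubled by symmetry. *)
Lemma integral_poisson (d x : R) : 0 < d ->
  (\int[leb]_y (poisson d (y - x))%:E = (pi *+ 2)%:E)%E.
Proof.
move=> d0.
have -> : (pi *+ 2)%:E = (\int[leb]_y (oneDsqr y)^-1%:E * 2%:E)%E.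
  rewrite ge0_symfun_integralT//.
  - by rewrite -set_itvcy integral0y_oneDsqr -!EFinM; congr EFin; field.
  - exact: continuous_oneDsqrV.
  - by move=> y /=; rewrite /oneDsqr sqrrN.
rewrite -ge0_integralZr//; last first.
  apply/measurable_EFinP; apply: continuous_measurable_fun.
  exact: continuous_oneDsqrV.
under [RHS]eq_integral do rewrite -EFinM.
pose F (y : R) := (y - x) / d.
have dF (y : R) : is_derive y (1 : R) F d^-1.
  by apply: is_derive_eq; rewrite subr0 /GRing.scale/= mulr1 mulr0 add0r.
have dFE : F^`()%classic = cst d^-1.
  by apply/funext => y; rewrite derive1E derive_val.
rewrite [RHS](@increasing_ge0_integration_by_substitutionT _ F (fun y => (oneDsqr y)^-1 * 2)).
- apply: eq_integral => y _; congr EFin.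
  rewrite fctE dFE /= /poisson /oneDsqr /F; field.
  by rewrite !gt_eqF//= ?ltr_pwDl ?exprn_gt0// sqr_ge0.
- by move=> y z yz; rewrite /F ltr_pM2r ?invr_gt0// ltrD2r.
- by rewrite dFE => y; exact: cvg_cst.
- by rewrite dFE; apply/cvg_ex; exists d^-1; exact: cvg_cst.
- by rewrite dFE; apply/cvg_ex; exists d^-1; exact: cvg_cst.
- by move=> y; exact: ex_derive.
- rewrite /F; under eq_fun do rewrite mulrC.
  by apply: gt0_cvgMrNy; rewrite ?invr_gt0//; exact: cvg_addrr_Ny.
- rewrite /F; under eq_fun do rewrite mulrC.
  by apply: gt0_cvgMry; rewrite ?invr_gt0//; exact: cvg_addrr.
- move=> y; apply: cvgMr_tmp; exact: continuous_oneDsqrV.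
- by move=> y; rewrite mulr_ge0// invr_ge0 oneDsqr_ge0.
Qed.

Lemma integrable_poisson (d x : R) : 0 < d ->
  leb.-integrable setT (EFin \o (fun y => poisson d (y - x))).
Proof.
move=> d0; apply/integrableP; split.
  apply/measurable_EFinP; apply: continuous_measurable_fun => y.
  apply: (@continuous_comp _ _ _ (fun y => y - x)); last exact: continuous_poisson.
  by apply: cvgB; [exact: cvg_id|exact: cvg_cst].
under eq_integral do rewrite /= ger0_norm ?poisson_ge0//.
by rewrite integral_poisson// ltry.
Qed.

Lemma Rintegral_poisson (d x : R) : 0 < d ->
  \int[leb]_y (poisson d (y - x)) = pi *+ 2.
Proof. by move=> d0; rewrite /Rintegral integral_poisson. Qed.

Lemma integrable_powRN (q : R) : 1 < 2 * q ->
  leb.-integrable setT (EFin \o (fun x => (1 + x ^+ 2) `^ (- q))).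
Proof.
move=> q2.
have cb : continuous (fun x : R => 1 + x ^+ 2).
  by move=> x; apply: cvgD; [exact: cvg_cst|exact: exprn_continuous].
have b0 (x : R) : 0 < 1 + x ^+ 2 by rewrite ltr_pwDl// sqr_ge0.
have cf : continuous (fun x : R => (1 + x ^+ 2) `^ (- q)).
  move=> x; rewrite /powR; under eq_fun do rewrite gt_eqF//.
  apply: continuous_comp; last exact: continuous_expR.
  apply: cvgMl_tmp; apply: continuous_comp; first exact: cb.
  exact: continuous_ln.
apply/integrableP; split.
  by apply/measurable_EFinP; exact: continuous_measurable_fun.
under eq_integral do rewrite /= ger0_norm ?powR_ge0//.
rewrite ge0_integral_fold//; last by move=> x; exact: powR_ge0.
under eq_integral do rewrite sqrrN.
(* From [(1 + x) ^ 2 <= 2 * (1 + x ^ 2)] the integrand is at most a multiple of [(1 + x) ^ (- 2 q)],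
   which has the primitive [F]. In [C], the factor 2 pays for the fold and the factor [2 ^ q] for
   the comparison. *)
pose C := 2 * 2 `^ q.
pose F (x : R) := C / (1 - 2 * q) * (1 + x) `^ (1 - 2 * q).
have dP (c x : R) : 0 <= x ->
    is_derive x (1 : R) (fun y => (1 + y) `^ c) (c * (1 + x) `^ (c - 1)).
  move=> x0; have x10 : 0 < 1 + x by rewrite ltr_pwDl.
  have d1 : is_derive (1 + x) (1 : R) ((@powR R)^~ c)
      (c * (1 + x) `^ (c - 1)) by exact: is_derive1_powR.
  have d2 : is_derive x (1 : R) (fun y : R => 1 + y) 1.
    rewrite -[X in is_derive _ _ _ X](add0r (1 : R)).
    exact: (@is_deriveD R R R (cst (1 : R)) (@id R) x 1 0 1).
  by have := is_derive1_comp d1 d2; rewrite mulr1.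
have cP (c x : R) : 0 <= x -> {for x, continuous (fun y : R => (1 + y) `^ c)}.
  move=> x0; apply: differentiable_continuous; apply/derivable1_diffP.
  exact: (@ex_derive _ _ _ _ _ _ _ (dP c x x0)).
have dF (x : R) : 0 <= x -> is_derive x (1 : R) F (C * (1 + x) `^ (- (2 * q))).
  move=> x0; rewrite /F; have := dP (1 - 2 * q) x x0 => dPx.
  apply: is_derive_eq; rewrite /GRing.scale/= mulrA divfK//; last by rewrite lt_eqF//; lra.
  by congr (_ * _ `^ _); lra.
have key (x : R) : 0 <= x ->
    (1 + x ^+ 2) `^ (- q) *+ 2 <= C * (1 + x) `^ (- (2 * q)).
  move=> x0; have x10 : 0 < 1 + x by rewrite ltr_pwDl.
  rewrite -[X in X <= _]mulr_natl -mulrA ler_pM2l// !powRN.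
  rewrite ler_pdivlMr ?powR_gt0// mulrC ler_pdivrMr ?powR_gt0//.
  rewrite -powRM ?(ltW (b0 x))// powRrM ge0_ler_powR ?nnegrE ?powR_ge0//.
  - by lra.
  - by rewrite mulr_ge0// ltW.
  - rewrite (@powR_mulrn _ (1 + x) 2 (ltW x10)) -subr_ge0.
    have -> : 2 * (1 + x ^+ 2) - (1 + x) ^+ 2 = (1 - x) ^+ 2 by ring.
    exact: sqr_ge0.
apply: (@le_lt_trans _ _ (\int[leb]_(x in `[0%R, +oo[) (C * (1 + x) `^ (- (2 * q)))%:E)%E).
  apply: ge0_le_integral => //.
  - by move=> x _; rewrite lee_fin addr_ge0// powR_ge0.
  - apply/measurable_EFinP/measurable_funTS; apply: continuous_measurable_fun => x.
    by apply: cvgD; exact: cf.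
  - apply/measurable_EFinP/measurable_funTS.
    apply: measurable_funM => //.
    apply: (measurableT_comp (measurable_powR _)).
    exact: measurable_funD.
  - move=> x /=; rewrite in_itv/= andbT => x0; rewrite lee_fin -mulr2n.
    exact: key.
rewrite (@ge0_continuous_FTC2y _ _ F _ 0)//.
- by rewrite -EFinB ltry.
- by move=> x _; rewrite !mulr_ge0// powR_ge0.
- apply/continuous_within_itvcyP; split.
    move=> x; rewrite in_itv/= andbT => /ltW x0.
    by apply: cvgMl_tmp; exact: cP.
  by apply: cvgMl_tmp; apply: cvg_at_right_filter; exact: cP.
- rewrite /F -[X in _ --> X](mulr0 (C / (1 - 2 * q))); apply: cvgMl_tmp.
  have h : expR (- ((2 * q - 1) * ln (1 + x))) @[x --> +oo] --> (0 : R).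
    apply: (@cvg_comp _ _ _ (fun x => (2 * q - 1) * ln (1 + x)) (fun x => expR (- x)) _ +oo).
      apply: gt0_cvgMry; first by lra.
      apply/cvgryPge => A; near=> x.
      rewrite -[A]expRK ler_ln ?posrE ?expR_gt0//.
      - by rewrite -lerBlDl; near: x; apply: nbhs_pinfty_ge; exact: num_real.
      - by rewrite ltr_wpDr//; near: x; apply: nbhs_pinfty_ge; exact: num_real.
    exact: cvgr_expR.
  apply: cvg_trans h; apply: near_eq_cvg; near=> x.
  rewrite /powR gt_eqF//; last first.
    by rewrite ltr_wpDr//; near: x; apply: nbhs_pinfty_ge; exact: num_real.
  by congr expR; ring.
- by move=> x x0; exact: (@ex_derive _ _ _ _ _ _ _ (dF x (ltW x0))).
- apply: cvg_at_right_filter; apply: differentiable_continuous.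
  by apply/derivable1_diffP; exact: (@ex_derive _ _ _ _ _ _ _ (dF 0 (lexx _))).
- move=> x; rewrite in_itv/= andbT => /ltW x0; rewrite derive1E.
  exact: (@derive_val _ _ _ _ _ _ _ (dF x x0)).
Unshelve. all: by end_near. Qed.

End one_dim.

(** * Fubini's theorem under a product majorant *)

Section dominated_fubini.
Context d1 d2 (T1 : measurableType d1) (T2 : measurableType d2) (R : realType).
Variable m1 : {sigma_finite_measure set T1 -> \bar R}.
Variable m2 : {sigma_finite_measure set T2 -> \bar R}.
Variables (f : T1 * T2 -> R) (F1 : T1 -> R) (F2 : T2 -> R).
Hypothesis mf : measurable_fun setT f.
Hypothesis iF1 : m1.-integrable setT (EFin \o F1).
Hypothesis iF2 : m2.-integrable setT (EFin \o F2).
Hypothesis fF : forall x y, `|f (x, y)| <= F1 x * F2 y.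

Let mfx x : measurable_fun setT (fun y => f (x, y)).
Proof. exact: measurableT_comp. Qed.

Let mfy y : measurable_fun setT (fun x => f (x, y)).
Proof. exact: measurableT_comp. Qed.

Lemma dominated_section1 x : m2.-integrable setT (fun y => (f (x, y))%:E).
Proof.
apply: (@le_integrable _ _ _ _ _ _ _ (fun y => ((F1 x)%:E * (F2 y)%:E)%E)) => //.
- exact/measurable_EFinP/mfx.
- by move=> y _ /=; rewrite lee_fin (le_trans (fF x y))// ler_norm.
- exact: integrableZl.
Qed.

Lemma dominated_section2 y : m1.-integrable setT (fun x => (f (x, y))%:E).
Proof.
apply: (@le_integrable _ _ _ _ _ _ _ (fun x => ((F2 y)%:E * (F1 x)%:E)%E)) => //.
- exact/measurable_EFinP/mfy.
- by move=> x _ /=; rewrite lee_fin (le_trans (fF x y))// mulrC ler_norm.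
- exact: integrableZl.
Qed.

Lemma dominated_integrable : (m1 \x m2)%E.-integrable setT (EFin \o f).
Proof.
apply/integrable12ltyP; first exact/measurable_EFinP.
have := integrable_abse iF2 => aF2.
have := integrable_abse iF1 => aF1.
have F2fin := integrable_fin_num measurableT aF2.
set c := (\int[m2]_y `|(F2 y)%:E|)%E.
have c0 : (0 <= c)%E by exact: integral_ge0.
apply: (@le_lt_trans _ _ (\int[m1]_x (`|(F1 x)%:E| * c))%E).
  apply: ge0_le_integral => //.
  - by move=> x _; apply: integral_ge0.
  - apply: (measurable_fun_fubini_tonelli_F (fun z => `|(EFin \o f) z|)%E) => //.
    by apply: measurableT_comp => //; exact/measurable_EFinP.
  - apply: emeasurable_funM => //; exact: measurable_int aF1.
  - move=> x _; rewrite /c -ge0_integralZl//; last exact: measurable_int aF2.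
    apply: ge0_le_integral => //.
    + by apply: measurableT_comp => //; exact/measurable_EFinP/mfx.
    + by apply: measurable_funeM; exact: measurable_int aF2.
    + by move=> y _; rewrite -abseM lee_fin (le_trans (fF x y))// ler_norm.
rewrite ge0_integralZr//; last exact: measurable_int aF1.
by rewrite lte_mul_pinfty ?integral_ge0// ?integrable_lty// integrable_fin_num.
Qed.

Lemma Rintegral_prod1 :
  \int[(m1 \x m2)%E]_z f z = \int[m1]_x \int[m2]_y f (x, y).
Proof.
rewrite /Rintegral -[in LHS]integral12_prod_meas1//; last exact: dominated_integrable.
congr fine; apply: eq_integral => x _.
by rewrite /fubini_F /= fineK// integrable_fin_num//; exact: dominated_section1.
Qed.

Lemma Rintegral_prod2 :
  \int[(m1 \x m2)%E]_z f z = \int[m2]_y \int[m1]_x f (x, y).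
Proof.
rewrite /Rintegral -[in LHS]integral21_prod_meas1//; last exact: dominated_integrable.
congr fine; apply: eq_integral => y _.
by rewrite /fubini_G /= fineK// integrable_fin_num//; exact: dominated_section2.
Qed.

Lemma dominated_swap :
  \int[m1]_x \int[m2]_y f (x, y) = \int[m2]_y \int[m1]_x f (x, y).
Proof. by rewrite -Rintegral_prod1 Rintegral_prod2. Qed.

(** Applied for the measurability in the parameter that integrability contains, see
    [trig_measurable]. *)
Lemma integrable_partial1 :
  m1.-integrable setT (EFin \o (fun x => \int[m2]_y f (x, y))).
Proof.
have := integrable_fubini_F dominated_integrable.
apply: eq_integrable => // x _.
by rewrite /fubini_F /= fineK// integrable_fin_num//; exact: dominated_section1.
Qed.

End dominated_fubini.

(** * Lebesgue measure on rows and tensor products *)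

Section tensor.
Context {R : realType}.
Local Notation leb := (@lebesgue_measure R).

Lemma integral_lebesgue_row0 (f : 'rV[R]_0 -> R) : measurable_fun setT f ->
  \int[lebesgue_row 0]_x f x = f 0.
Proof.
move=> mf; rewrite /Rintegral /= integral_dirac//; last exact/measurable_EFinP.
by rewrite diracT mul1e.
Qed.

(* [lebesgue_measure] lives on a copy of the measurable type [R] with another
   display, so that [measurable_consrow] does not apply directly. *)
Let measurable_consrow_leb n :
  @measurable_fun _ _ (measurableTypeR R * 'rV[R]_n)%type 'rV[R]_n.+1
    setT (@consrow R n).
Proof.
move=> mD B mB; apply: measurableI => //.
by rewrite -[X in measurable X]setTI; exact: measurable_consrow.
Qed.

Lemma integrable_lebesgue_rowS n (f : 'rV[R]_n.+1 -> R) : measurable_fun setT f ->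
  (leb \x lebesgue_row n)%E.-integrable setT (EFin \o (f \o @consrow R n)) ->
  (lebesgue_row n.+1).-integrable setT (EFin \o f).
Proof.
move=> mf fi; have mf' : measurable_fun setT (EFin \o f) by exact/measurable_EFinP.
pose m : {measure set _ -> \bar R} := (leb \x lebesgue_row n)%E.
exact: (integrable_pushforward (mu := m) (@measurable_consrow_leb n) mf' fi measurableT).
Qed.

Lemma Rintegral_lebesgue_rowS n (f : 'rV[R]_n.+1 -> R) : measurable_fun setT f ->
  (leb \x lebesgue_row n)%E.-integrable setT (EFin \o (f \o @consrow R n)) ->
  \int[lebesgue_row n.+1]_x f x = \int[(leb \x lebesgue_row n)%E]_p f (consrow p).
Proof.
move=> mf fi; have mf' : measurable_fun setT (EFin \o f) by exact/measurable_EFinP.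
pose m : {measure set _ -> \bar R} := (leb \x lebesgue_row n)%E.
congr fine.
exact: (integral_pushforward (mu := m) (@measurable_consrow_leb n) mf' fi measurableT).
Qed.

Lemma consrow0 n (p : R * 'rV[R]_n) : consrow p ord0 ord0 = p.1.
Proof. by rewrite mxE unlift_none. Qed.

Lemma consrow_lift n (p : R * 'rV[R]_n) i : consrow p ord0 (lift ord0 i) = p.2 ord0 i.
Proof. by rewrite mxE liftK. Qed.

Lemma measurable_tensor n (f : 'I_n -> R -> R) : (forall i, measurable_fun setT (f i)) ->
  measurable_fun setT (fun v : 'rV[R]_n => \prod_i f i (v ord0 i)).
Proof.
move=> mf; apply: measurable_prod => i _.
exact: (measurableT_comp (mf i) (measurable_coord i)).
Qed.

Lemma measurable_linear n (a : 'I_n -> R) :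
  measurable_fun setT (fun v : 'rV[R]_n => \sum_i a i * v ord0 i).
Proof.
apply: measurable_sum => i.
by apply: measurable_funM => //; exact: measurable_coord.
Qed.

Lemma measurable_integrable d (T : measurableType d) (m : {measure set T -> \bar R})
  (f : T -> R) : m.-integrable setT (EFin \o f) -> measurable_fun setT f.
Proof. by move=> /measurable_int /measurable_EFinP. Qed.

Lemma integrable_scale d (T : measurableType d) (m : {measure set T -> \bar R})
  (k : R) (f : T -> R) : m.-integrable setT (EFin \o f) ->
  m.-integrable setT (EFin \o (fun x => k * f x)).
Proof. by move=> /(integrableZl measurableT k). Qed.

Lemma integrable_norm d (T : measurableType d) (m : {measure set T -> \bar R})
  (f : T -> R) : m.-integrable setT (EFin \o f) ->
  m.-integrable setT (EFin \o (fun x => `|f x|)).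
Proof. exact: integrable_abse. Qed.

Lemma integrable_tensor n (f : 'I_n -> R -> R) :
  (forall i, leb.-integrable setT (EFin \o f i)) ->
  (lebesgue_row n).-integrable setT
    (EFin \o (fun v : 'rV[R]_n => \prod_i f i (v ord0 i))).
Proof.
have mt k (g : 'I_k -> R -> R) : (forall i, leb.-integrable setT (EFin \o g i)) ->
    measurable_fun setT (fun v : 'rV[R]_k => \prod_i g i (v ord0 i)).
  by move=> gi; apply: measurable_tensor => i; exact: measurable_integrable (gi i).
elim: n f => [|n IH] f fi.
  apply/integrableP; split; first by apply/measurable_EFinP; exact: (mt 0%N f fi).
  rewrite /= integral_dirac//; last first.
    by apply/measurable_EFinP; apply: measurableT_comp => //; exact: (mt 0%N f fi).
  by rewrite diracT mul1e ltry.
have {}mt := mt _ _ fi.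
apply: integrable_lebesgue_rowS => //.
have mt' : @measurable_fun _ _ (measurableTypeR R * 'rV[R]_n)%type R setT
    ((fun v : 'rV[R]_n.+1 => \prod_i f i (v ord0 i)) \o @consrow R n).
  exact: measurableT_comp mt (@measurable_consrow_leb _).
have iP := integrable_norm (IH (fun i => f (lift ord0 i)) (fun i => fi _)).
apply: (dominated_integrable mt' (integrable_norm (fi ord0)) iP) => x v /=.
rewrite big_ord_recl consrow0 normrM.
by under [X in _ * `|X| <= _]eq_bigr do rewrite consrow_lift.
Qed.

(** Induction on the dimension: the cosine of the sum of the first phase and the remaining ones
    expands into a product of cosines minus a product of sines, and the sine integral in the first
    variable vanishes by hypothesis. *)
Lemma Rintegral_tensor_cos n (f : 'I_n -> R -> R) (a : 'I_n -> R) :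
  (forall i, leb.-integrable setT (EFin \o f i)) ->
  (forall i, \int[leb]_x (f i x * sin (a i * x)) = 0) ->
  \int[lebesgue_row n]_v ((\prod_i f i (v ord0 i)) * cos (\sum_i a i * v ord0 i)) =
  \prod_i \int[leb]_x (f i x * cos (a i * x)).
Proof.
have mtc k (g : 'I_k -> R -> R) (b : 'I_k -> R) :
    (forall i, leb.-integrable setT (EFin \o g i)) ->
    measurable_fun setT (fun v : 'rV[R]_k =>
      (\prod_i g i (v ord0 i)) * cos (\sum_i b i * v ord0 i)).
  move=> gi; apply: measurable_funM.
    by apply: measurable_tensor => i; exact: measurable_integrable (gi i).
  have mc : measurable_fun setT (@cos R).
    by apply: continuous_measurable_fun; exact: continuous_cos.
  exact: measurableT_comp mc (measurable_linear b).
elim: n f a => [|n IH] f a fi fs.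
  rewrite integral_lebesgue_row0; last exact: mtc.
  by rewrite !big_ord0 cos0 mulr1.
have mt := mtc _ _ a fi.
have mt' : @measurable_fun _ _ (measurableTypeR R * 'rV[R]_n)%type R setT ((fun v : 'rV[R]_n.+1 =>
    (\prod_i f i (v ord0 i)) * cos (\sum_i a i * v ord0 i)) \o @consrow R n).
  exact: measurableT_comp mt (@measurable_consrow_leb _).
pose P (v : 'rV[R]_n) := \prod_i f (lift ord0 i) (v ord0 i).
pose L (v : 'rV[R]_n) := \sum_i a (lift ord0 i) * v ord0 i.
have iP : (lebesgue_row n).-integrable setT (EFin \o P).
  exact: (@integrable_tensor _ (fun i => f (lift ord0 i))).
have dom x v : `|((fun v : 'rV[R]_n.+1 =>
    (\prod_i f i (v ord0 i)) * cos (\sum_i a i * v ord0 i)) \o @consrow R n) (x, v)| <=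
    `|f ord0 x| * `|P v|.
  rewrite /= big_ord_recl consrow0 normrM.
  under [X in `|_ * X| * _]eq_bigr do rewrite consrow_lift.
  rewrite -[X in _ <= X]normrM; apply: ler_piMr => //.
  by rewrite ler_norml cos_geN1 cos_le1.
rewrite Rintegral_lebesgue_rowS//; last first.
  apply: (dominated_integrable mt' (integrable_norm (fi ord0)) (integrable_norm iP) dom).
rewrite (Rintegral_prod2 mt' (integrable_norm (fi ord0)) (integrable_norm iP) dom).
rewrite [RHS]big_ord_recl -(IH (fun i => f (lift ord0 i)) (fun i => a (lift ord0 i)))//.
have ic : leb.-integrable setT (EFin \o (fun x => f ord0 x * cos (a ord0 * x))).
  apply: (le_integrable measurableT _ _ (fi ord0)) => //.
    apply/measurable_EFinP; apply: measurable_funM.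
      exact: measurable_integrable (fi _).
    by apply: continuous_measurable_fun; exact: continuous_scale_cos.
  move=> x _ /=; rewrite lee_fin normrM ler_piMr//.
  by rewrite ler_norml cos_geN1 cos_le1.
have is_ : leb.-integrable setT (EFin \o (fun x => f ord0 x * sin (a ord0 * x))).
  apply: (le_integrable measurableT _ _ (fi ord0)) => //.
    apply/measurable_EFinP; apply: measurable_funM.
      exact: measurable_integrable (fi _).
    by apply: continuous_measurable_fun; exact: continuous_scale_sin.
  move=> x _ /=; rewrite lee_fin normrM ler_piMr//.
  by rewrite ler_norml sin_geN1 sin_le1.
transitivity (\int[lebesgue_row n]_v ((\int[leb]_x (f ord0 x * cos (a ord0 * x))) * (P v * cos (L v)))).
  apply: eq_Rintegral => v _.
  transitivity (\int[leb]_x (P v * cos (L v) * (f ord0 x * cos (a ord0 * x)) -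
                             P v * sin (L v) * (f ord0 x * sin (a ord0 * x)))).
    apply: eq_Rintegral => x _ /=.
    rewrite big_ord_recl [X in cos X]big_ord_recl !consrow0.
    under eq_bigr do rewrite consrow_lift.
    under [X in cos (_ + X)]eq_bigr do rewrite consrow_lift.
    by rewrite cosD -/(P v) -/(L v); ring.
  rewrite RintegralB//; last 2 first.
  - exact: integrable_scale.
  - exact: integrable_scale.
  by rewrite !RintegralZl// fs mulr0 subr0 mulrC.
rewrite RintegralZl//.
apply: (le_integrable measurableT _ _ iP) => //.
  by apply/measurable_EFinP; exact: (@mtc _ (fun i => f (lift ord0 i)) (fun i => a (lift ord0 i))).
move=> x _ /=; rewrite lee_fin normrM ler_piMr//.
by rewrite ler_norml cos_geN1 cos_le1.
Qed.

Lemma Rintegral_tensor n (f : 'I_n -> R -> R) :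
  (forall i, leb.-integrable setT (EFin \o f i)) ->
  \int[lebesgue_row n]_v (\prod_i f i (v ord0 i)) = \prod_i \int[leb]_x f i x.
Proof.
move=> fi.
transitivity (\int[lebesgue_row n]_v
    ((\prod_i f i (v ord0 i)) * cos (\sum_(i < n) 0 * v ord0 i))).
  apply: eq_Rintegral => v _.
  by rewrite [X in cos X]big1 ?cos0 ?mulr1// => i _; rewrite mul0r.
rewrite (@Rintegral_tensor_cos n f (fun=> 0) fi).
  by apply: eq_bigr => i _; apply: eq_Rintegral => x _; rewrite mul0r cos0 mulr1.
move=> i; transitivity (\int[leb]_(x in setT) (0 : R)).
  by apply: eq_Rintegral => x _; rewrite mul0r sin0 mulr0.
by rewrite /Rintegral integral0.
Qed.

End tensor.

Lemma continuous_scale {R : realType} (T : topologicalType) (c : R) (f : T -> R) :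
  continuous f -> continuous (fun x => c * f x).
Proof. by move=> cf x; apply: cvgMl_tmp; exact: cf. Qed.

(** * Norms of rows and compactly supported functions *)

Section rows.
Context {R : realType} {n : nat}.
Implicit Types (x y v : 'rV[R]_n).

Lemma sqr_coord_le_dotp v i : v ord0 i ^+ 2 <= dotp v v.
Proof.
rewrite /dotp (bigD1 i)//= -expr2 lerDl sumr_ge0// => j _.
by rewrite -expr2 sqr_ge0.
Qed.

Lemma dotp_ge0 v : 0 <= dotp v v.
Proof. by apply: sumr_ge0 => j _; rewrite -expr2 sqr_ge0. Qed.

Lemma coord_le_enorm v i : `|v ord0 i| <= enorm v.
Proof.
rewrite -sqrtr_sqr /enorm ler_wsqrtr//.
exact: sqr_coord_le_dotp.
Qed.

Lemma row_norm_le v (c : R) : 0 <= c -> (forall i, `|v ord0 i| <= c) -> `|v| <= c.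
Proof.
move=> c0 vc; rewrite /Num.Def.normr/= mx_normrE.
by apply/bigmax_leP; split => // -[i j] _ /=; rewrite (ord1 i).
Qed.

Lemma coord_le_norm v i : `|v ord0 i| <= `|v|.
Proof.
rewrite /Num.Def.normr/= mx_normrE.
exact: (le_bigmax _ (fun ij => `|v ij.1 ij.2|) (ord0, i)).
Qed.

Lemma norm_le_enorm v : `|v| <= enorm v.
Proof.
by apply: row_norm_le; [exact: sqrtr_ge0|move=> i; exact: coord_le_enorm].
Qed.

Lemma continuous_measurable_row (f : 'rV[R]_n -> R) :
  continuous f -> measurable_fun setT f.
Proof.
move=> cf; apply: (measurability _ (measurable_realfun.RGenOpens.measurableE R)).
move=> _ [_ [a [b ->] <-]]; rewrite setTI; apply: open_measurable_row.
by apply: open_comp; [move=> v _; exact: cf|exact: interval_open].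
Qed.

Lemma compact_box (c : R) : compact [set v : 'rV[R]_n | forall i, v ord0 i \in `[- c, c]].
Proof.
exact: (@rV_compact R^o n (fun=> `[- c, c]%classic) (fun=> @segment_compact _ _ _)).
Qed.

Lemma compact_support_bounded (f : 'rV[R]_n -> R) r : continuous f ->
  (forall v, ~ eball r v -> f v = 0) -> exists2 B, 0 <= B & forall v, `|f v| <= B.
Proof.
move=> cf f0.
have : compact (f @` [set v : 'rV[R]_n | forall i, v ord0 i \in `[- r, r]]).
  by apply: continuous_compact; [exact: continuous_subspaceT|exact: compact_box].
move/compact_bounded => [M [Mr]] /(_ (`|M| + 1)) MM.
exists (`|M| + 1); first by rewrite addr_ge0.
move=> v; have [vr|/f0->] := pselect (eball r v); last by rewrite normr0 addr_ge0.
apply: MM; first by rewrite (le_lt_trans (ler_norm M))// ltrDl.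
exists v => // i; rewrite in_itv/= -ler_norml.
exact: le_trans (coord_le_enorm v i) (ltW vr).
Qed.

(** The majorant is [B] times the indicator of a cube, a tensor product of integrable indicators. *)
Lemma compact_support_integrable (f : 'rV[R]_n -> R) r : continuous f ->
  (forall v, ~ eball r v -> f v = 0) ->
  (lebesgue_row n).-integrable setT (EFin \o f).
Proof.
move=> cf f0; have [B B0 fB] := compact_support_bounded cf f0.
have ii (i : 'I_n) : (@lebesgue_measure R).-integrable setT
    (EFin \o (\1_(`[- r, r]%classic) : R -> R)).
  exact: integrable_indic_itv.
have := integrable_scale B (integrable_tensor ii).
apply: le_integrable => //; first by apply/measurable_EFinP; exact: continuous_measurable_row.
move=> v _ /=; rewrite lee_fin.
have P0 : 0 <= \prod_(i < n) (\1_(`[- r, r]%classic) (v ord0 i) : R).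
  by apply: prodr_ge0 => i _.
rewrite (ger0_norm (mulr_ge0 B0 P0)).
have [vr|/f0->] := pselect (eball r v); last by rewrite normr0 mulr_ge0.
rewrite big1 ?mulr1// => i _.
rewrite indicE mem_set//= in_itv/= -ler_norml.
exact: le_trans (coord_le_enorm v i) (ltW vr).
Qed.

Lemma continuous_coord (i : 'I_n) : continuous (fun v : 'rV[R]_n => v ord0 i).
Proof. by move=> v; exact: coord_continuous. Qed.

End rows.

(** * Damped Fourier inversion *)

Section inversion.
Context {R : realType} {n : nat}.
Local Notation leb := (@lebesgue_measure R).
Local Notation row := (@lebesgue_row R n).
Implicit Types (x y v xi : 'rV[R]_n) (u : 'rV[R]_n -> R) (d : R).

(* Abel regularisation of the Fourier inversion integral: the transform of
   [damp d] is a product of Poisson kernels, an approximate identity as d --> 0. *)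
Definition damp d xi := \prod_i dampc d (xi ord0 i).
Definition poisson_row d x y := \prod_i poisson d (y ord0 i - x ord0 i).
Definition japanese xi := 1 + dotp xi xi.

Lemma damp_gt0 d xi : 0 < damp d xi.
Proof. by apply: prodr_gt0 => i _; exact: expR_gt0. Qed.

Lemma damp_le1 d xi : 0 <= d -> damp d xi <= 1.
Proof.
move=> d0; rewrite /damp; apply: (@le_trans _ _ (\prod_(i < n) (1 : R))).
  apply: ler_prod => i _.
  by rewrite dampc_ge0/= -expR0 ler_expR oppr_le0 mulr_ge0.
by rewrite big1.
Qed.

Lemma integrable_damp d : 0 < d -> row.-integrable setT (EFin \o damp d).
Proof. by move=> d0; apply: (@integrable_tensor _ _ (fun=> dampc d)) => i; exact: integrable_dampc. Qed.

Lemma poisson_row_ge0 d x y : 0 < d -> 0 <= poisson_row d x y.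
Proof. by move=> d0; apply: prodr_ge0 => i _; exact: poisson_ge0. Qed.

Lemma integrable_poisson_row d x : 0 < d ->
  row.-integrable setT (EFin \o poisson_row d x).
Proof.
move=> d0; apply: (@integrable_tensor _ _ (fun i a => poisson d (a - x ord0 i))) => i.
exact: integrable_poisson.
Qed.

Lemma Rintegral_poisson_row d x : 0 < d ->
  \int[row]_y poisson_row d x y = (pi *+ 2) ^+ n.
Proof.
move=> d0; rewrite (@Rintegral_tensor _ _ (fun i a => poisson d (a - x ord0 i))).
  under eq_bigr do rewrite Rintegral_poisson//.
  by rewrite prodr_const card_ord.
by move=> i; exact: integrable_poisson.
Qed.

Lemma fourier_damp d x y : 0 < d ->
  \int[row]_xi (damp d xi * cos (dotp (y - x) xi)) = poisson_row d x y.
Proof.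
move=> d0.
rewrite (@Rintegral_tensor_cos _ _ (fun=> dampc d) (fun i => (y - x) ord0 i)).
- by apply: eq_bigr => i _; rewrite Rintegral_dampc_cos// !mxE.
- by move=> i; exact: integrable_dampc.
- by move=> i; exact: Rintegral_dampc_sin.
Qed.

Lemma sin_norm_le1 (a : R) : `|sin a| <= 1.
Proof. by rewrite ler_norml sin_geN1 sin_le1. Qed.

Lemma cos_norm_le1 (a : R) : `|cos a| <= 1.
Proof. by rewrite ler_norml cos_geN1 cos_le1. Qed.

Lemma measurable_dotp2 disp (T : measurableType disp) (f g : T -> 'rV[R]_n) :
  measurable_fun setT f -> measurable_fun setT g ->
  measurable_fun setT (fun z => dotp (f z) (g z)).
Proof.
move=> mf mg; apply: measurable_sum => i; apply: measurable_funM.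
  exact: measurableT_comp (measurable_coord i) mf.
exact: measurableT_comp (measurable_coord i) mg.
Qed.

Lemma measurable_cosR : measurable_fun setT (@cos R).
Proof. by apply: continuous_measurable_fun; exact: continuous_cos. Qed.
Lemma measurable_sinR : measurable_fun setT (@sin R).
Proof. by apply: continuous_measurable_fun; exact: continuous_sin. Qed.

Variables (u : 'rV[R]_n -> R).
Hypothesis iu : row.-integrable setT (EFin \o u).

Lemma integrable_bounded_mul (g : 'rV[R]_n -> R) : measurable_fun setT g ->
  (forall y, `|g y| <= 1) -> row.-integrable setT (EFin \o (fun y => u y * g y)).
Proof.
move=> mg g1; apply: (le_integrable measurableT _ _ iu).
  apply/measurable_EFinP; apply: measurable_funM => //.
  exact: measurable_integrable iu.
by move=> y _ /=; rewrite lee_fin normrM ler_piMr.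
Qed.

(** The integrand has no integrable majorant in [xi]. Fubini's theorem is therefore applied after
    multiplication by [damp 1 xi], which is positive and divided out at the end. *)
Let trig_measurable (t : R -> R) : measurable_fun setT t -> (forall a, `|t a| <= 1) ->
  measurable_fun setT (fun xi => \int[row]_y (u y * t (dotp y xi))).
Proof.
move=> mt t1.
pose f (z : 'rV[R]_n * 'rV[R]_n) := damp 1 z.1 * (u z.2 * t (dotp z.2 z.1)).
have mu := measurable_integrable iu.
have md := measurable_integrable (integrable_damp (@ltr01 R)).
have mf : measurable_fun setT f.
  apply: measurable_funM; first exact: measurableT_comp md measurable_fst.
  apply: measurable_funM; first exact: measurableT_comp mu measurable_snd.
  by apply: measurableT_comp mt _; exact: measurable_dotp2.
have fF x y : `|f (x, y)| <= damp 1 x * `|u y|.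
  rewrite /f/= normrM (ger0_norm (ltW (damp_gt0 _ _))).
  apply: ler_wpM2l; first exact/ltW/damp_gt0.
  by rewrite normrM ler_piMr.
have := measurable_integrable (integrable_partial1 mf (integrable_damp (@ltr01 R))
  (integrable_norm iu) fF).
have mi : measurable_fun setT (fun xi => (damp 1 xi)^-1).
  have -> : (fun xi => (damp 1 xi)^-1) = (fun xi => \prod_i expR `|xi ord0 i|).
    apply/funext => xi; rewrite /damp -prodfV; apply: eq_bigr => i _.
    by rewrite /dampc mul1r expRN invrK.
  apply: (@measurable_tensor _ _ (fun=> fun a => expR `|a|)) => i.
  by apply: measurableT_comp => //; exact: measurable_expR.
move=> /(measurable_funM mi); apply: eq_measurable_fun => xi _ /=.
rewrite /f /= RintegralZl//.
  by rewrite mulrA mulVf ?mul1r// gt_eqF// damp_gt0.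
apply: integrable_bounded_mul => //.
apply: measurableT_comp mt _; exact: measurable_dotp2.
Qed.

Lemma measurable_fourier_cos : measurable_fun setT (fourier_cos u).
Proof. exact: trig_measurable measurable_cosR cos_norm_le1. Qed.

Lemma measurable_fourier_sin : measurable_fun setT (fourier_sin u).
Proof. exact: trig_measurable measurable_sinR sin_norm_le1. Qed.

Lemma japanese_ge1 xi : 1 <= japanese xi.
Proof. by rewrite lerDl dotp_ge0. Qed.

Lemma japanese_gt0 xi : 0 < japanese xi.
Proof. by rewrite (lt_le_trans ltr01)// japanese_ge1. Qed.

(** Both sides are iterated integrals of [u y * damp d xi * cos (dotp (y - x) xi)], in the two
    orders: integrating first in [xi] produces the Poisson kernel, first in [y] the transforms of
    [u]. *)
Lemma smoothed_fourier d x : 0 < d ->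
  \int[row]_y (u y * poisson_row d x y) =
  \int[row]_xi (damp d xi * (fourier_cos u xi * cos (dotp x xi) +
                             fourier_sin u xi * sin (dotp x xi))).
Proof.
move=> d0.
pose f (z : 'rV[R]_n * 'rV[R]_n) := u z.1 * (damp d z.2 * cos (dotp (z.1 - x) z.2)).
have mu := measurable_integrable iu.
have md := measurable_integrable (integrable_damp d0).
have mf : measurable_fun setT f.
  apply: measurable_funM; first exact: measurableT_comp mu measurable_fst.
  apply: measurable_funM; first exact: measurableT_comp md measurable_snd.
  apply: measurableT_comp measurable_cosR _.
  have -> : (fun z : 'rV[R]_n * 'rV[R]_n => dotp (z.1 - x) z.2) =
      (fun z => dotp z.1 z.2 - dotp x z.2).
    apply/funext => z; rewrite /dotp -sumrB; apply: eq_bigr => i _.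
    by rewrite !mxE mulrBl.
  by apply: measurable_funB; exact: measurable_dotp2.
have fF y xi : `|f (y, xi)| <= `|u y| * damp d xi.
  rewrite /f/= normrM; apply: ler_wpM2l => //.
  by rewrite normrM (ger0_norm (ltW (damp_gt0 _ _))) ler_piMr ?cos_norm_le1// ltW// damp_gt0.
have := dominated_swap mf (integrable_norm iu) (integrable_damp d0) fF.
rewrite /f /= => sw; transitivity (\int[row]_x0 \int[row]_y
         (u x0 * (damp d y * cos (dotp (x0 - x) y)))).
  apply: eq_Rintegral => y _; rewrite RintegralZl//; first by rewrite fourier_damp.
  apply: (le_integrable measurableT _ _ (integrable_damp d0)).
    apply/measurable_EFinP; apply: measurable_funM => //.
    apply: measurableT_comp measurable_cosR _.
    exact: measurable_dotp2.
  by move=> xi _ /=; rewrite lee_fin normrM ler_piMr// cos_norm_le1.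
rewrite sw; apply: eq_Rintegral => xi _.
transitivity (\int[row]_y (damp d xi * cos (dotp x xi) * (u y * cos (dotp y xi)) +
    damp d xi * sin (dotp x xi) * (u y * sin (dotp y xi)))).
  apply: eq_Rintegral => y _.
  have -> : dotp (y - x) xi = dotp y xi - dotp x xi.
    by rewrite /dotp -sumrB; apply: eq_bigr => i _; rewrite !mxE mulrBl.
  by rewrite cosB; ring.
have mc : measurable_fun setT (fun y => cos (dotp y xi)).
  by apply: measurableT_comp measurable_cosR _; exact: measurable_dotp2.
have ms : measurable_fun setT (fun y => sin (dotp y xi)).
  by apply: measurableT_comp measurable_sinR _; exact: measurable_dotp2.
have ic := integrable_bounded_mul mc (fun y => cos_norm_le1 _).
have is_ := integrable_bounded_mul ms (fun y => sin_norm_le1 _).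
rewrite RintegralD//; [|exact: integrable_scale|exact: integrable_scale].
rewrite !RintegralZl// -/(fourier_cos u xi) -/(fourier_sin u xi).
ring.
Qed.

End inversion.

Lemma Rintegral_dominated d (T : measurableType d) (R : realType)
  (m : {measure set T -> \bar R}) (D : set T) (g h : T -> R) : measurable D ->
  m.-integrable D (EFin \o g) -> m.-integrable D (EFin \o h) ->
  (forall x, D x -> `|g x| <= h x) -> `|\int[m]_(x in D) g x| <= \int[m]_(x in D) h x.
Proof.
move=> mD ig ih gh; apply: (le_trans (le_normr_Rintegral mD ig)).
by apply: le_Rintegral => //; exact: integrable_abse ig.
Qed.

Section integrable_arith.
Context d (T : measurableType d) (R : realType) (m : {measure set T -> \bar R}).
Variables (D : set T) (mD : measurable D).
Implicit Types f g : T -> R.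

Lemma integrable_add f g : m.-integrable D (EFin \o f) -> m.-integrable D (EFin \o g) ->
  m.-integrable D (EFin \o (fun x => f x + g x)).
Proof. by move=> fi gi; have := integrableD mD fi gi. Qed.

Lemma integrable_sub f g : m.-integrable D (EFin \o f) -> m.-integrable D (EFin \o g) ->
  m.-integrable D (EFin \o (fun x => f x - g x)).
Proof. by move=> fi gi; have := integrableB mD fi gi. Qed.

Lemma integrable_sumr (I : Type) (s : seq I) (F : I -> T -> R) :
  (forall i, m.-integrable D (EFin \o F i)) ->
  m.-integrable D (EFin \o (fun x => \sum_(i <- s) F i x)).
Proof.
move=> Fi; elim: s => [|i s IH].
  rewrite (_ : EFin \o _ = cst 0%E); first exact: integrable0.
  by apply/funext => x /=; rewrite big_nil.
rewrite (_ : EFin \o _ = EFin \o (fun x => F i x + \sum_(i <- s) F i x)).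
  exact: integrable_add.
by apply/funext => x /=; rewrite big_cons.
Qed.

Lemma Rintegral_sumr (I : Type) (s : seq I) (F : I -> T -> R) :
  (forall i, m.-integrable D (EFin \o F i)) ->
  \int[m]_(x in D) (\sum_(i <- s) F i x) = \sum_(i <- s) \int[m]_(x in D) F i x.
Proof.
move=> Fi; elim: s => [|i s IH].
  rewrite big_nil (@eq_Rintegral _ _ _ _ _ (cst 0)); last first.
    by move=> x _; rewrite big_nil.
  by rewrite /Rintegral integral0.
rewrite big_cons -IH -RintegralD//; last exact: integrable_sumr.
by apply: eq_Rintegral => x _; rewrite big_cons.
Qed.

End integrable_arith.

(** * The product Poisson kernel as an approximate identity *)

Section approximation.
Context {R : realType} {n : nat}.
Local Notation row := (@lebesgue_row R n).
Local Notation kappa := ((pi *+ 2) ^+ n : R).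
Variables (u : 'rV[R]_n -> R) (B : R).
Hypothesis iu : row.-integrable setT (EFin \o u).
Hypothesis cu : continuous u.
Hypothesis uB : forall y, `|u y| <= B.

(** Up to a small factor, a majorant of [poisson_row d x] where the coordinate [i] is far from that
    of [x]. Replacing the scale of this one factor by 1 keeps the total mass equal to [kappa]. *)
Let tail (x : 'rV[R]_n) (d : R) (i : 'I_n) (y : 'rV[R]_n) :=
  \prod_j poisson (if j == i then 1 else d) (y ord0 j - x ord0 j).

Let integrable_tail x (d : R) i : 0 < d -> row.-integrable setT (EFin \o tail x d i).
Proof.
move=> d0; apply: (@integrable_tensor _ _
  (fun j a => poisson (if j == i then 1 else d) (a - x ord0 j))) => j.
by apply: integrable_poisson; case: ifP.
Qed.

Let Rintegral_tail x (d : R) i : 0 < d -> \int[row]_y tail x d i y = kappa.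
Proof.
move=> d0; rewrite (@Rintegral_tensor _ _
  (fun j a => poisson (if j == i then 1 else d) (a - x ord0 j))).
  rewrite (eq_bigr (fun=> pi *+ 2)) ?prodr_const ?card_ord// => j _.
  by rewrite Rintegral_poisson//; case: ifP.
by move=> j; apply: integrable_poisson; case: ifP.
Qed.

Let kappa_gt0 : 0 < kappa.
Proof. by rewrite exprn_gt0// pmulrn_lgt0// pi_gt0. Qed.

(** The left side is at most [2 * d / a ^ 2], and [1 + a ^ 2 <= (1 + rho ^- 2) * a ^ 2] away from
    the origin. The factor [d] is what makes the far mass vanish. *)
Lemma poisson_tail (d rho a : R) : 0 < d -> 0 < rho -> rho <= `|a| ->
  poisson d a <= d * (1 + rho ^- 2) * poisson 1 a.
Proof.
move=> d0 rho0 ra.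
have a2 : rho ^+ 2 <= a ^+ 2.
  by rewrite -[a ^+ 2]ger0_norm ?sqr_ge0// normrX lerXn2r// nnegrE ltW.
have a0 : 0 < a ^+ 2 by rewrite (lt_le_trans _ a2)// exprn_gt0.
rewrite /poisson mulrnAr lerMn2r/= -mulrA ler_pM2l// expr1n mul1r.
apply: (@le_trans _ _ (a ^+ 2)^-1).
  by rewrite lef_pV2 ?posrE// ?lerDr ?sqr_ge0// ltr_pwDl ?exprn_gt0// ltW.
rewrite ler_pdivlMr; last by rewrite ltr_pwDl// ltW.
rewrite mulrDr mulr1 mulVf ?gt_eqF// addrC lerD2l lef_pV2 ?posrE// exprn_gt0//.
Qed.

Lemma smoothed_cvg x (eta : R) : 0 < eta -> exists2 d0 : R, 0 < d0 &
  forall d, 0 < d -> d <= d0 ->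
    `|\int[row]_y (u y * poisson_row d x y) - kappa * u x| <= eta.
Proof.
move=> eta0.
pose eta' := eta / 2 / kappa.
have eta'0 : 0 < eta' by rewrite !divr_gt0.
have [rho rho0 near_x] : exists2 rho : R, 0 < rho &
    forall y : 'rV[R]_n, (forall i, `|y ord0 i - x ord0 i| < rho) -> `|u y - u x| <= eta'.
  have : u y @[y --> x] --> u x := cu (x := x).
  move=> /cvgrPdist_le/(_ _ eta'0)/nbhs_ballP[rho /= rho0 H].
  exists rho => // y yx; rewrite distrC; apply: H.
  by split => // i j; rewrite (ord1 i) /ball/= distrC.
have B0 : 0 <= B by rewrite (le_trans _ (uB x)).
pose c := 1 + rho ^- 2.
have c0 : 0 < c by rewrite ltr_pwDl// invr_ge0 exprn_ge0// ltW.
(* One [eta / 2] goes to the points near [x], through [eta']. Any other point has a coordinate at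
   distance at least [rho] from that of [x], so one of the [n] tails majorises the kernel there;
   together they contribute [d * E]. *)
pose E := 2 * B * c * n%:R * kappa.
have E0 : 0 <= E by rewrite !mulr_ge0// ltW.
exists (eta / 2 / (E + 1)); first by rewrite !divr_gt0// ltr_wpDl.
move=> d d0 dle.
have iK := integrable_poisson_row x d0.
have K0 y := poisson_row_ge0 x y d0.
have iuK : row.-integrable setT (EFin \o (fun y => u y * poisson_row d x y)).
  apply: (le_integrable measurableT _ _ (integrable_scale B iK)).
    apply/measurable_EFinP; apply: measurable_funM; first exact: measurable_integrable iu.
    exact: measurable_integrable iK.
  move=> y _ /=; rewrite lee_fin !normrM (ger0_norm (K0 y)) (ger0_norm B0).
  by rewrite ler_wpM2r.
have iuxK := integrable_scale (u x) iK.
rewrite -(Rintegral_poisson_row x d0) mulrC -RintegralZl// -RintegralB//.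
pose h y := eta' * poisson_row d x y + \sum_i 2 * B * (d * c) * tail x d i y.
have it i := integrable_scale (2 * B * (d * c)) (integrable_tail x i d0).
have ih : row.-integrable setT (EFin \o h).
  by apply: integrable_add => //; [exact: integrable_scale|exact: integrable_sumr].
apply: (@le_trans _ _ (\int[row]_y h y)).
  apply: Rintegral_dominated => //; first exact: integrable_sub.
  move=> y _; rewrite -mulrBl normrM (ger0_norm (K0 y)) /h.
  have tail0 j : 0 <= tail x d j y.
    by apply: prodr_ge0 => k _; apply: poisson_ge0; case: ifP.
  have [near_y|far_y] := pselect (forall i, `|y ord0 i - x ord0 i| < rho).
    apply: ler_wpDr; last by rewrite ler_wpM2r// near_x.
    by apply: sumr_ge0 => i _; rewrite !mulr_ge0// ltW.
  have /existsNP[i /negP] := far_y; rewrite -leNgt => yi.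
  apply: ler_wpDl; first by rewrite mulr_ge0// ltW.
  rewrite (bigD1 i)//=; apply: ler_wpDr.
    by apply: sumr_ge0 => j _; rewrite !mulr_ge0// ltW.
  rewrite -mulrA; apply: ler_pM => //.
    by rewrite (le_trans (ler_normB _ _))// mulr_natl mulr2n lerD.
  rewrite /poisson_row (bigD1 i)//= /tail [X in _ <= _ * X](bigD1 i)//= eqxx mulrA.
  rewrite [X in _ <= _ * X](eq_bigr (fun j => poisson d (y ord0 j - x ord0 j))); last first.
    by move=> j /negbTE ->.
  apply: ler_wpM2r; last exact: poisson_tail.
  by apply: prodr_ge0 => j _; exact: poisson_ge0.
rewrite RintegralD//; [|exact: integrable_scale|exact: integrable_sumr].
rewrite RintegralZl// Rintegral_poisson_row// Rintegral_sumr//.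
rewrite (eq_bigr (fun=> 2 * B * (d * c) * kappa)); last first.
  by move=> i _; rewrite RintegralZl// ?Rintegral_tail//; exact: integrable_tail.
rewrite sumr_const card_ord.
have -> : eta' * kappa = eta / 2 by rewrite /eta' divfK// gt_eqF.
have -> : 2 * B * (d * c) * kappa *+ n = d * E by rewrite /E -mulr_natr; ring.
rewrite [leRHS]splitr lerD2l (le_trans (ler_wpM2r E0 dle))//.
rewrite mulrAC ler_pdivrMr ?ltr_wpDl// ler_wpM2l ?lerDl//.
by rewrite divr_ge0// ltW.
Qed.

End approximation.

(** * Sobolev embedding into bounded Lipschitz functions *)

Section sobolev_embedding.
Context {R : realType} {n : nat}.
Local Notation row := (@lebesgue_row R n).
Local Notation kappa := ((pi *+ 2) ^+ n : R).
Local Notation japanese := (@japanese R n).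

(** The choice [A = a^-1] balances the two terms. When [a = 0], letting [A] grow shows that [z]
    cannot be positive. *)
Lemma amgm_optimize (z a c J : R) : 0 <= a -> 0 <= c -> 0 <= J ->
  (forall A, 0 < A -> z <= c * (A * a ^+ 2 + J / A)) -> z <= c * ((1 + J) * a).
Proof.
move=> a0 c0 J0 H; have [a1|a1] := ltP 0 a.
  have := H a^-1; rewrite invr_gt0 invrK => /(_ a1).
  have -> // : a^-1 * a ^+ 2 + J * a = (1 + J) * a.
  by field; rewrite gt_eqF.
have {a1}a1 : a = 0 by apply/eqP; rewrite eq_le a0 a1.
rewrite a1 !mulr0 leNgt; apply/negP => z0.
have cJ0 : 0 <= c * J by rewrite mulr_ge0.
have A0 : 0 < (c * J + 1) / z by rewrite divr_gt0// ltr_wpDl.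
have := H _ A0; rewrite a1 expr0n/= mulr0 add0r invf_div !mulrA.
rewrite ler_pdivlMr ?ltr_wpDl// => h; nra.
Qed.

(** The power is split into [n] equal ones, and in the [i]-th of them [japanese xi] is bounded below
    by one plus the square of the [i]-th coordinate: the majorant is a tensor product. *)
Lemma integrable_japanese (q : R) : (0 < n)%N -> 1 < 2 * (q / n%:R) ->
  row.-integrable setT (EFin \o (fun xi => japanese xi `^ (- q))).
Proof.
move=> n0 q2.
have nR : 0 < n%:R :> R by rewrite ltr0n.
have q0 : 0 <= q / n%:R by lra.
have := @integrable_tensor _ _ (fun _ : 'I_n => fun x : R => (1 + x ^+ 2) `^ (- (q / n%:R)))
  (fun=> integrable_powRN q2).
apply: le_integrable => //.
  apply/measurable_EFinP; apply: (measurableT_comp (measurable_powR _)).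
  by apply: measurable_funD => //; apply: measurable_dotp2.
move=> xi _ /=; rewrite lee_fin ger0_norm ?powR_ge0// ger0_norm; last first.
  by apply: prodr_ge0 => i _; exact: powR_ge0.
have -> : japanese xi `^ (- q) = \prod_(i < n) japanese xi `^ (- (q / n%:R)).
  rewrite prodr_const card_ord -powR_mulrn ?powR_ge0// -powRrM.
  by rewrite mulNr divfK// gt_eqF.
apply: ler_prod => i _; rewrite powR_ge0/= !powRN.
rewrite lef_pV2 ?posrE ?powR_gt0 ?japanese_gt0//; last by rewrite ltr_pwDl// sqr_ge0.
apply: ge0_ler_powR => //.
- by rewrite nnegrE addr_ge0// sqr_ge0.
- by rewrite nnegrE ltW// japanese_gt0.
- by rewrite lerD2l sqr_coord_le_dotp.
Qed.

Lemma cos_lipschitz (a b : R) : `|cos a - cos b| <= `|a - b|.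
Proof.
wlog ab : a b / a < b.
  move=> H; have [/H//|ba|->] := ltgtP a b; last by rewrite !subrr.
  by rewrite distrC [leRHS]distrC H.
have cc : {within `[a, b], continuous (@cos R)}.
  by apply: continuous_subspaceT; exact: continuous_cos.
have dc (x : R) : x \in `]a, b[ -> is_derive x (1 : R) (@cos R) (- sin x).
  by move=> _; exact: is_derive_cos.
have [c _] := MVT ab dc cc.
rewrite -[cos a - cos b]opprB => ->.
by rewrite -[a - b]opprB !normrN normrM normrN ler_piMl// sin_norm_le1.
Qed.

Lemma sin_lipschitz (a b : R) : `|sin a - sin b| <= `|a - b|.
Proof.
wlog ab : a b / a < b.
  move=> H; have [/H//|ba|->] := ltgtP a b; last by rewrite !subrr.
  by rewrite distrC [leRHS]distrC H.
have cc : {within `[a, b], continuous (@sin R)}.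
  by apply: continuous_subspaceT; exact: continuous_sin.
have dc (x : R) : x \in `]a, b[ -> is_derive x (1 : R) (@sin R) (cos x).
  by move=> _; exact: is_derive_sin.
have [c _] := MVT ab dc cc.
rewrite -[sin a - sin b]opprB => ->.
by rewrite -[a - b]opprB !normrN normrM ler_piMl// cos_norm_le1.
Qed.

Lemma dotp_sub_le (x y xi : 'rV[R]_n) :
  `|dotp x xi - dotp y xi| <= n%:R * `|x - y| * Num.sqrt (japanese xi).
Proof.
rewrite /dotp -sumrB (le_trans (ler_norm_sum _ _ _))//.
have -> : n%:R * `|x - y| * Num.sqrt (japanese xi) =
    \sum_(i < n) `|x - y| * Num.sqrt (japanese xi).
  by rewrite sumr_const card_ord -mulrA mulr_natl.
apply: ler_sum => i _.
rewrite -mulrBl normrM ler_pM//.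
  by have := coord_le_norm (x - y) i; rewrite !mxE.
rewrite -sqrtr_sqr ler_wsqrtr// (le_trans (sqr_coord_le_dotp xi i))//.
by rewrite lerDr.
Qed.

Definition energy s (u : 'rV[R]_n -> R) xi :=
  japanese xi `^ s * (fourier_cos u xi ^+ 2 + fourier_sin u xi ^+ 2).

Lemma energy_ge0 s (u : 'rV[R]_n -> R) xi : 0 <= energy s u xi.
Proof. by rewrite mulr_ge0 ?powR_ge0// addr_ge0// sqr_ge0. Qed.

Lemma measurable_energy s (u : 'rV[R]_n -> R) : row.-integrable setT (EFin \o u) ->
  measurable_fun setT (energy s u).
Proof.
move=> iu; apply: measurable_funM.
  apply: (measurableT_comp (measurable_powR _)).
  by apply: measurable_funD => //; apply: measurable_dotp2.
apply: measurable_funD; apply: measurable_funX.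
  exact: measurable_fourier_cos.
exact: measurable_fourier_sin.
Qed.

Variables (u : 'rV[R]_n -> R) (s : R).
Hypothesis n_gt0 : (0 < n)%N.
Hypothesis s_large : 1 < 2 * ((s - 1) / n%:R).
Hypothesis iu : row.-integrable setT (EFin \o u).
Hypothesis su : (sobolev_sqnorm s u < +oo)%E.

Let integrable_energy : row.-integrable setT (EFin \o energy s u).
Proof.
apply/integrableP; split; first by apply/measurable_EFinP; exact: measurable_energy.
under eq_integral => xi _ do rewrite /= (ger0_norm (energy_ge0 s u xi)).
exact: su.
Qed.

Let Rintegral_energy : \int[row]_xi energy s u xi = sobolev_norm s u ^+ 2.
Proof.
rewrite /sobolev_norm sqr_sqrtr//; apply: fine_ge0.
apply: integral_ge0 => xi _; rewrite lee_fin; exact: energy_ge0.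
Qed.

Definition japanese_integral := \int[row]_xi (japanese xi `^ (- (s - 1))).

(** The Cauchy-Schwarz inequality in additive form, with a free weight [A] that [amgm_optimize]
    removes. The damping is only bounded by 1, so nothing depends on [d]. The growth allowed for
    [g1] and [g2] is the one of phase differences in the Lipschitz estimate; it accounts for [s - 1]
    in place of [s]. *)
Lemma fourier_l1 (g1 g2 : 'rV[R]_n -> R) (d c A : R) : 0 < d -> 0 < A -> 0 <= c ->
  measurable_fun setT g1 -> measurable_fun setT g2 ->
  (forall xi, `|g1 xi| <= c * Num.sqrt (japanese xi)) ->
  (forall xi, `|g2 xi| <= c * Num.sqrt (japanese xi)) ->
  `|\int[row]_xi (damp d xi * (fourier_cos u xi * g1 xi + fourier_sin u xi * g2 xi))| <=
  c * (A * sobolev_norm s u ^+ 2 + japanese_integral / A).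
Proof.
move=> d0 A0 c0 mg1 mg2 g1c g2c.
have ij := integrable_japanese n_gt0 s_large.
have ih : row.-integrable setT
    (EFin \o (fun xi => c * (A * energy s u xi + japanese xi `^ (- (s - 1)) / A))).
  apply: integrable_scale; apply: integrable_add => //; first exact: integrable_scale.
  by under eq_fun do rewrite mulrC; exact: integrable_scale.
have mF : measurable_fun setT (fun xi =>
   damp d xi * (fourier_cos u xi * g1 xi + fourier_sin u xi * g2 xi)).
  apply: measurable_funM; first exact: measurable_integrable (integrable_damp d0).
  apply: measurable_funD; apply: measurable_funM => //.
    exact: measurable_fourier_cos.
  exact: measurable_fourier_sin.
have bound xi : `|damp d xi * (fourier_cos u xi * g1 xi + fourier_sin u xi * g2 xi)| <=
    c * (A * energy s u xi + japanese xi `^ (- (s - 1)) / A).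
  rewrite normrM (ger0_norm (ltW (damp_gt0 _ _))).
  apply: (@le_trans _ _ (1 * `|fourier_cos u xi * g1 xi + fourier_sin u xi * g2 xi|)).
    by apply: ler_wpM2r => //; apply: damp_le1; exact: ltW.
  rewrite mul1r (le_trans (ler_normD _ _))// !normrM.
  set a := `|fourier_cos u xi|; set b := `|fourier_sin u xi|; set w := japanese xi.
  have w0 : 0 < w := japanese_gt0 xi.
  apply: (@le_trans _ _ (c * ((a + b) * Num.sqrt w))).
    by rewrite mulrCA mulrDl; apply: lerD; apply: ler_wpM2l; rewrite ?normr_ge0.
  apply: ler_wpM2l => //.
  rewrite /energy -/w -[fourier_cos u xi ^+ 2]ger0_norm ?sqr_ge0// normrX -/a.
  rewrite -[fourier_sin u xi ^+ 2]ger0_norm ?sqr_ge0// normrX -/b.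
  have -> : Num.sqrt w = w `^ (s / 2) * w `^ (- ((s - 1) / 2)).
    rewrite -powR12_sqrt ?ltW// -powRD; last by rewrite (gt_eqF w0) implybT.
    by congr powR; field.
  have -> : w `^ s = (w `^ (s / 2)) ^+ 2.
    by rewrite -powR_mulrn ?powR_ge0// -powRrM; congr powR; field.
  have -> : w `^ (- (s - 1)) = (w `^ (- ((s - 1) / 2))) ^+ 2.
    by rewrite -powR_mulrn ?powR_ge0// -powRrM; congr powR; field.
  (* AM-GM: [a * (p * q) <= A * p ^ 2 * a ^ 2 + q ^ 2 / (4 * A)], and the same for [b]. *)
  set p := w `^ (s / 2); set q := w `^ _.
  have h0 : 0 <= (2 * A * p * a - q) ^+ 2 + (2 * A * p * b - q) ^+ 2 + 2 * q ^+ 2.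
    by rewrite !addr_ge0 ?sqr_ge0// mulr_ge0// sqr_ge0.
  rewrite -(@ler_pM2r _ (4 * A)); last by rewrite mulr_gt0.
  have -> : (A * (p ^+ 2 * (a ^+ 2 + b ^+ 2)) + q ^+ 2 / A) * (4 * A) =
     4 * A ^+ 2 * p ^+ 2 * (a ^+ 2 + b ^+ 2) + 4 * q ^+ 2.
    by field; rewrite gt_eqF.
  by nra.
apply: (@le_trans _ _ (\int[row]_xi (c * (A * energy s u xi + japanese xi `^ (- (s - 1)) / A)))).
  apply: Rintegral_dominated => //.
  apply: (le_integrable measurableT _ _ ih); first exact/measurable_EFinP.
  by move=> xi _ /=; rewrite lee_fin (le_trans (bound xi))// ler_norm.
rewrite RintegralZl//; last first.
  apply: integrable_add => //; first exact: integrable_scale.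
  by under eq_fun do rewrite mulrC; exact: integrable_scale.
rewrite RintegralD//; last 2 first.
- exact: integrable_scale.
- by under eq_fun do rewrite mulrC; exact: integrable_scale.
by rewrite RintegralZl// RintegralZr// Rintegral_energy.
Qed.

Lemma japanese_integral_ge0 : 0 <= japanese_integral.
Proof. by apply: Rintegral_ge0 => xi _; exact: powR_ge0. Qed.

Hypothesis cu : continuous u.
Variable B : R.
Hypothesis uB : forall y, `|u y| <= B.

Lemma sqrt_japanese_ge1 xi : 1 <= Num.sqrt (japanese xi).
Proof. by rewrite -sqrtr1 ler_wsqrtr// japanese_ge1. Qed.

Let measurable_cos_dotpr x : measurable_fun setT (fun xi : 'rV[R]_n => cos (dotp x xi)).
Proof. by apply: measurableT_comp measurable_cosR _; exact: measurable_dotp2. Qed.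

Let measurable_sin_dotpr x : measurable_fun setT (fun xi : 'rV[R]_n => sin (dotp x xi)).
Proof. by apply: measurableT_comp measurable_sinR _; exact: measurable_dotp2. Qed.

(** The bound of [fourier_l1] is uniform in the damping, so [smoothed_cvg] lets the damping be
    removed at the cost of an arbitrary [eta]. *)
Lemma sup_le_sobolev x : kappa * `|u x| <= (1 + japanese_integral) * sobolev_norm s u.
Proof.
have k0 : 0 < kappa by rewrite exprn_gt0// pmulrn_lgt0// pi_gt0.
rewrite -[leRHS]mul1r; apply: amgm_optimize => //.
- exact: sqrtr_ge0.
- exact: japanese_integral_ge0.
move=> A A0; apply/ler_addgt0Pr => eta eta0.
have [d d0 /(_ _ d0 (lexx _))] := smoothed_cvg iu cu uB x eta0.
rewrite (smoothed_fourier iu x d0) => h.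
have := @fourier_l1 (fun xi => cos (dotp x xi)) (fun xi => sin (dotp x xi)) d 1 A
  d0 A0 ler01 (measurable_cos_dotpr x) (measurable_sin_dotpr x).
set I := (\int[row]_xi _) in h * => /(_ _ _)/wrap[].
- by move=> xi; rewrite mul1r (le_trans (cos_norm_le1 _))// sqrt_japanese_ge1.
- by move=> xi; rewrite mul1r (le_trans (sin_norm_le1 _))// sqrt_japanese_ge1.
move=> IA; rewrite -[kappa * _]ger0_norm ?mulr_ge0 ?(ltW k0)// normrM normr_id -normrM.
rewrite -[kappa * u x](subrK I) addrC (le_trans (ler_normD _ _))// lerD//.
by rewrite distrC.
Qed.

Lemma lipschitz_le_sobolev x y : kappa * `|u x - u y| <=
  n%:R * `|x - y| * ((1 + japanese_integral) * sobolev_norm s u).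
Proof.
have k0 : 0 < kappa by rewrite exprn_gt0// pmulrn_lgt0// pi_gt0.
have c0 : 0 <= n%:R * `|x - y| by rewrite mulr_ge0.
apply: amgm_optimize => //.
- exact: sqrtr_ge0.
- exact: japanese_integral_ge0.
move=> A A0; apply/ler_addgt0Pr => eta eta0.
have eta20 : 0 < eta / 2 by rewrite divr_gt0.
have [d1 d10 h1] := smoothed_cvg iu cu uB x eta20.
have [d2 d20 h2] := smoothed_cvg iu cu uB y eta20.
(* A common damping at both points turns the difference of the two inversion integrals into one
   integral, against differences of cosines and of sines. *)
pose d := Num.min d1 d2.
have d0 : 0 < d by rewrite lt_min d10.
have {h1} := h1 d d0; rewrite ge_min lexx => /(_ isT).
have {h2} := h2 d d0; rewrite ge_min lexx orbT => /(_ isT).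
rewrite !(smoothed_fourier iu _ d0).
have mx (z : 'rV[R]_n) : row.-integrable setT (EFin \o (fun xi =>
    damp d xi * (fourier_cos u xi * cos (dotp z xi) + fourier_sin u xi * sin (dotp z xi)))).
  have bt (t : R -> R) : measurable_fun setT t -> (forall a, `|t a| <= 1) ->
      forall xi, `|\int[row]_v (u v * t (dotp v xi))| <= \int[row]_v `|u v|.
    move=> mt t1 xi; apply: Rintegral_dominated => //; last by move=> v _; rewrite normrM ler_piMr.
      apply: integrable_bounded_mul => //.
      by apply: measurableT_comp mt _; exact: measurable_dotp2.
    exact: integrable_norm.
  have iS := integrable_scale (2 * \int[row]_v `|u v|) (@integrable_damp _ n _ d0).
  apply: (le_integrable measurableT _ _ iS).
    apply/measurable_EFinP; apply: measurable_funM.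
      exact: measurable_integrable (integrable_damp d0).
    apply: measurable_funD; apply: measurable_funM => //.
      exact: measurable_fourier_cos.
    exact: measurable_fourier_sin.
  move=> xi _ /=; rewrite lee_fin normrM mulrC normrM.
  rewrite [X in _ * X <= _](ger0_norm (ltW (damp_gt0 _ _))).
  rewrite [X in _ <= _ * X](ger0_norm (ltW (damp_gt0 _ _))).
  apply: ler_wpM2r; first exact/ltW/damp_gt0.
  rewrite (le_trans (ler_normD _ _))// (le_trans _ (ler_norm _))// mulrDl mul1r.
  rewrite !normrM lerD// -[leRHS]mulr1 ler_pM// ?cos_norm_le1 ?sin_norm_le1//.
    exact: bt measurable_cosR cos_norm_le1 xi.
  exact: bt measurable_sinR sin_norm_le1 xi.
set Iy := (\int[row]_xi _); set Ix := (\int[row]_xi _) => hy hx.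
have IE : Ix - Iy = \int[row]_xi (damp d xi *
   (fourier_cos u xi * (cos (dotp x xi) - cos (dotp y xi)) +
    fourier_sin u xi * (sin (dotp x xi) - sin (dotp y xi)))).
  rewrite -RintegralB//; apply: eq_Rintegral => xi _; ring.
have := @fourier_l1 (fun xi => cos (dotp x xi) - cos (dotp y xi))
  (fun xi => sin (dotp x xi) - sin (dotp y xi)) d (n%:R * `|x - y|) A
  d0 A0 c0 (measurable_funB (measurable_cos_dotpr x) (measurable_cos_dotpr y))
  (measurable_funB (measurable_sin_dotpr x) (measurable_sin_dotpr y)).
rewrite -IE => H.
have {H}IA : `|Ix - Iy| <= n%:R * `|x - y| * (A * sobolev_norm s u ^+ 2 + japanese_integral / A).
  apply: H => xi; rewrite (le_trans _ (dotp_sub_le x y xi))//.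
    exact: cos_lipschitz.
  exact: sin_lipschitz.
rewrite -[kappa * _]ger0_norm ?mulr_ge0 ?(ltW k0)// normrM normr_id -normrM.
have -> : kappa * (u x - u y) = (Ix - Iy) + ((Iy - kappa * u y) - (Ix - kappa * u x)).
  by ring.
rewrite (le_trans (ler_normD _ _))// lerD// (le_trans (ler_normB _ _))//.
by rewrite [leRHS]splitr lerD.
Qed.

End sobolev_embedding.

Theorem sobolev_lipschitz (R : realType) (n : nat) (r s : R) :
  (0 < n)%N -> 1 < 2 * ((s - 1) / n%:R) ->
  exists2 C : R, 0 <= C & forall u : 'rV[R]_n -> R, continuous u ->
    (forall x, ~ eball r x -> u x = 0) -> (sobolev_sqnorm s u < +oo)%E ->
    (forall x, `|u x| <= C * sobolev_norm s u) /\
    (forall x y, `|u x - u y| <= C * `|x - y| * sobolev_norm s u).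
Proof.
move=> n0 sn; pose kappa : R := (pi *+ 2) ^+ n.
have k0 : 0 < kappa by rewrite exprn_gt0// pmulrn_lgt0// pi_gt0.
pose J := @japanese_integral R n s.
have J0 : 0 <= 1 + J by rewrite addr_ge0// japanese_integral_ge0.
have n1 : 1 <= n%:R :> R by rewrite ler1n.
(* The factor [n] comes from the Lipschitz bound; as [1 <= n] the same constant also covers the sup
   bound. *)
exists (n%:R * (1 + J) / kappa); first by rewrite divr_ge0 ?mulr_ge0// ltW.
move=> u cu u0 su.
have iu := compact_support_integrable cu u0.
have [B _ uB] := compact_support_bounded cu u0.
have nu0 := sobolev_norm_ge0 s u.
split=> [x|x y].
  have h := sup_le_sobolev n0 sn iu su cu uB x.
  rewrite mulrAC ler_pdivlMr// mulrC (le_trans h)// -mulrA ler_peMl//.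
  by rewrite mulr_ge0.
have h := lipschitz_le_sobolev n0 sn iu su cu uB x y.
rewrite -mulrA mulrAC ler_pdivlMr// mulrC (le_trans h)// -/J.
by rewrite le_eqVlt; apply/orP; left; apply/eqP; ring.
Qed.

(** * Taylor bounds for test functions *)

Section directional.
Context {R : realType} {n : nat}.
Implicit Types (f : 'rV[R]_n -> R) (x h : 'rV[R]_n).
Local Notation e_ i := (delta_mx ord0 i : 'rV[R]_n).

Lemma is_derive_line f x (v : 'rV[R]_n) (s : R) : derivable f (x + s *: v) v ->
  is_derive s (1 : R) (fun s => f (x + s *: v)) ('D_v f (x + s *: v)).
Proof.
move=> df.
have E : (fun h : R => h^-1 *: (((fun s => f (x + s *: v)) \o shift s) (h *: (1 : R))
           - f (x + s *: v))) =
         (fun h : R => h^-1 *: ((f \o shift (x + s *: v)) (h *: v) - f (x + s *: v))).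
  apply/funext => h /=; congr (_ *: (f _ - _)).
  by rewrite (_ : h *: (1 : R) = h) ?scalerDl ?addrA 1?[x + _]addrC -?addrA//; exact: mulr1.
split; first by rewrite /derivable E.
by rewrite /derive E.
Qed.

Lemma line_mvt f x i (a : R) : (forall y, derivable f y (e_ i)) ->
  exists2 c : R, `|c| <= `|a| &
    f (x + a *: e_ i) - f x = a * 'D_(e_ i) f (x + c *: e_ i).
Proof.
move=> df.
pose k s := f (x + s *: e_ i).
have dk (s : R) : is_derive s (1 : R) k ('D_(e_ i) f (x + s *: e_ i)) by exact: is_derive_line.
have ck : continuous k.
  move=> s; apply: differentiable_continuous; apply/derivable1_diffP.
  exact: (@ex_derive _ _ _ _ _ _ _ (dk s)).
have k0 : k 0 = f x by rewrite /k scale0r addr0.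
have [a0|a0|->] := ltgtP a 0.
- have [c] := MVT a0 (fun s _ => dk s) (continuous_subspaceT ck).
  rewrite in_itv/= => /andP[ac c0]; rewrite k0 sub0r => E.
  exists c; first by rewrite !ltr0_norm// lerN2 ltW.
  by rewrite -/(k a) -opprB E mulrN opprK mulrC.
- have [c] := MVT a0 (fun s _ => dk s) (continuous_subspaceT ck).
  rewrite in_itv/= => /andP[c0 ac]; rewrite k0 subr0 => E.
  exists c; first by rewrite !gtr0_norm// ltW.
  by rewrite -/(k a) E mulrC.
- by exists 0 => //; rewrite scale0r addr0 subrr mul0r.
Qed.

Lemma norm_delta_row_le1 i : `|e_ i| <= 1.
Proof.
apply: row_norm_le => // j; rewrite mxE eqxx/=.
by case: (_ == _); rewrite /= ?normr1 ?normr0.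
Qed.

Lemma row_sum_le h (s : seq 'I_n) :
  `|\sum_(i <- s) h ord0 i *: e_ i| <= (size s)%:R * `|h|.
Proof.
elim: s => [|i s IH]; first by rewrite big_nil normr0 mul0r.
rewrite big_cons (le_trans (ler_normD _ _))//= -natr1 [_ + 1]addrC mulrDl lerD//.
rewrite normrZ mul1r -[leRHS]mulr1 ler_pM// ?norm_delta_row_le1//.
exact: coord_le_norm.
Qed.

Lemma row_sum_coord h : \sum_i h ord0 i *: e_ i = h.
Proof.
apply/rowP => j; rewrite summxE (bigD1 j)//= !mxE !eqxx mulr1 big1 ?addr0// => i ij.
by rewrite !mxE eqxx/= eq_sym (negbTE ij) mulr0.
Qed.

(** [Ck] provides partial derivatives only, so [h] is built up one coordinate at a time and the mean
    value theorem is used along axes. The induction runs over the list of coordinates already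
    added. *)
Lemma lipschitz_partial f (B : R) : (forall i y, derivable f y (e_ i)) ->
  (forall i y, `|'D_(e_ i) f y| <= B) ->
  forall x h, `|f (x + h) - f x| <= n%:R * (B * `|h|).
Proof.
move=> df fB x h; rewrite -[in leLHS](row_sum_coord h).
have -> : n%:R = (size (index_enum 'I_n))%:R :> R.
  by rewrite -[LHS](congr1 (fun k => k%:R) (card_ord n)) cardT enumT.
elim: (index_enum 'I_n) => [|i s IH].
  by rewrite big_nil addr0 subrr normr0 mul0r.
rewrite big_cons addrCA addrC -addrA.
have [c _ E] := line_mvt (x + \sum_(j <- s) h ord0 j *: e_ j) (h ord0 i) (df i).
have -> : f (x + (\sum_(j <- s) h ord0 j *: e_ j + h ord0 i *: e_ i)) - f x =
   (f (x + \sum_(j <- s) h ord0 j *: e_ j + h ord0 i *: e_ i) -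
    f (x + \sum_(j <- s) h ord0 j *: e_ j)) +
   (f (x + \sum_(j <- s) h ord0 j *: e_ j) - f x) by rewrite addrA; ring.
rewrite (le_trans (ler_normD _ _))//= -natr1 [_ + 1]addrC mulrDl mul1r lerD// E normrM mulrC.
by rewrite ler_pM// coord_le_norm.
Qed.

(** When a coordinate is added to [k] earlier ones, the partial derivative is evaluated within
    [(k + 1) * |h|] of [x]. The errors add up to [n ^ 2] because
    [k ^ 2 + (k + 1) <= (k + 1) ^ 2]. *)
Lemma taylor_partial f (L : R) : 0 <= L -> (forall i y, derivable f y (e_ i)) ->
  (forall i x h, `|'D_(e_ i) f (x + h) - 'D_(e_ i) f x| <= L * `|h|) ->
  forall x h, `|f (x + h) - f x - \sum_i h ord0 i * 'D_(e_ i) f x| <=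
              n%:R ^+ 2 * (L * `|h| ^+ 2).
Proof.
move=> L0 df fL x h; rewrite -[in X in f (x + X)](row_sum_coord h).
have -> : n%:R = (size (index_enum 'I_n))%:R :> R.
  by rewrite -[LHS](congr1 (fun k => k%:R) (card_ord n)) cardT enumT.
elim: (index_enum 'I_n) => [|i s IH].
  by rewrite !big_nil addr0 !subrr normr0 mulr_ge0// ?sqr_ge0// mulr_ge0// sqr_ge0.
set S := \sum_(j <- s) h ord0 j *: e_ j in IH *.
have [c ca E] := line_mvt (x + S) (h ord0 i) (df i).
have -> : f (x + \sum_(j <- i :: s) h ord0 j *: e_ j) - f x -
     \sum_(j <- i :: s) h ord0 j * 'D_(e_ j) f x =
   (f (x + S) - f x - \sum_(j <- s) h ord0 j * 'D_(e_ j) f x) +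
   h ord0 i * ('D_(e_ i) f (x + S + c *: e_ i) - 'D_(e_ i) f x).
  rewrite !big_cons -/S mulrBr -E [_ *: _ + S]addrC addrA.
  ring.
rewrite (le_trans (ler_normD _ _))//.
have hi := coord_le_norm h i.
have Sn : `|S + c *: e_ i| <= (size s).+1%:R * `|h|.
  rewrite (le_trans (ler_normD _ _))// -natr1 mulrDl lerD ?row_sum_le//.
  rewrite normrZ mul1r -[leRHS]mulr1 ler_pM// ?norm_delta_row_le1//.
  exact: le_trans ca hi.
have Dn : `|h ord0 i * ('D_(e_ i) f (x + S + c *: e_ i) - 'D_(e_ i) f x)| <=
    `|h| * (L * ((size s).+1%:R * `|h|)).
  by rewrite -addrA normrM ler_pM// (le_trans (fL _ _ _))// ler_wpM2l.
rewrite (le_trans (lerD IH Dn))//=.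
have -> : (size s).+1%:R = (size s)%:R + 1 :> R by rewrite -natr1.
have k0 : 0 <= (size s)%:R :> R by [].
have Lh : 0 <= L * `|h| ^+ 2 by rewrite mulr_ge0// sqr_ge0.
rewrite -subr_ge0; set k := (size s)%:R in k0 *.
have -> : (k + 1) ^+ 2 * (L * `|h| ^+ 2) -
   (k ^+ 2 * (L * `|h| ^+ 2) + `|h| * (L * ((k + 1) * `|h|))) = k * (L * `|h| ^+ 2).
  by ring.
by rewrite mulr_ge0.
Qed.

End directional.

Section test_function.
Context {R : realType} {n : nat}.
Implicit Types (phi : 'rV[R]_n -> R).
Local Notation e_ i := (delta_mx ord0 i : 'rV[R]_n).

Lemma Ck_continuous k phi : Ck k phi -> continuous phi.
Proof. by case: k => [[]//|k []]. Qed.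

Lemma derive_off_support phi (v : 'rV[R]_n) :
  closure [set x | 'D_v phi x != 0] `<=` closure [set x | phi x != 0].
Proof.
set K := closure [set x | phi x != 0].
rewrite [K](_ : K = closure K); last by apply/closure_id; exact: closed_closure.
apply: closureS => x /=; apply: contra_neqP => nKx.
have : nbhs x (~` K) by apply: open_nbhs_nbhs; split => //; exact/closed_openC/closed_closure.
move=> nx; rewrite (@near_eq_derive _ _ _ phi (cst 0)) ?derive_cst//.
near=> y; apply/eqP/negPn/negP => py.
have : (~` K) y by near: y.
by apply; exact: subset_closure.
Unshelve. all: by end_near. Qed.

Lemma off_eball0 phi r : closure [set x | phi x != 0] `<=` eball r ->
  forall x, ~ eball r x -> phi x = 0.
Proof.
move=> sr x nx; apply/eqP/negPn/negP => px; apply: nx; apply: sr.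
exact: subset_closure.
Qed.

(** The derivatives up to order 2 are continuous and vanish off the ball, hence are bounded; second
    derivatives control both the increments of the first ones and the Taylor remainder. A single [L]
    for all bounds keeps the later constants readable. *)
Lemma test_fun_regular phi r : test_fun r phi -> exists2 L : R, 0 <= L &
  let phi_ i := 'D_(e_ i) phi in
  [/\ continuous phi, forall i, continuous (phi_ i),
      (forall x, `|phi x| <= L) /\ (forall i x, `|phi_ i x| <= L),
      (forall x h, `|phi (x + h) - phi x| <= L * `|h|) /\
      (forall i x h, `|phi_ i (x + h) - phi_ i x| <= L * `|h|) &
      forall x h, `|phi (x + h) - phi x - \sum_i h ord0 i * phi_ i x| <= L * `|h| ^+ 2].
Proof.
move=> [Ckphi [_ sr]].
have [cphi dphi] := Ckphi 2%N.
have cphi_ (i : 'I_n) : continuous ('D_(e_ i) phi) by have [] := (dphi i).2.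
have cphi2 (i j : 'I_n) : continuous ('D_(e_ j) ('D_(e_ i) phi)).
  by have [_ /(_ j)[_ []]] := (dphi i).2.
have dphi2 (i j : 'I_n) x : derivable ('D_(e_ i) phi) x (e_ j).
  by have [_ /(_ j)[]] := (dphi i).2.
have s1 (i : 'I_n) : closure [set x | 'D_(e_ i) phi x != 0] `<=` eball r.
  exact: subset_trans (@derive_off_support _ _) sr.
have s2 (i j : 'I_n) : closure [set x | 'D_(e_ j) ('D_(e_ i) phi) x != 0] `<=` eball r.
  exact: subset_trans (@derive_off_support _ _) (s1 i).
have [B0 B00 hB0] := compact_support_bounded cphi (off_eball0 sr).
have /choice[B1_ hB1] (i : 'I_n) : exists B : R, 0 <= B /\ forall x, `|'D_(e_ i) phi x| <= B.
  by have [B ? ?] := compact_support_bounded (cphi_ i) (off_eball0 (@s1 i)); exists B.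
have /choice[B2_ hB2] (ij : 'I_n * 'I_n) : exists B : R, 0 <= B /\
    forall x, `|'D_(e_ ij.2) ('D_(e_ ij.1) phi) x| <= B.
  have [B ? ?] := compact_support_bounded (cphi2 ij.1 ij.2) (off_eball0 (@s2 ij.1 ij.2)).
  by exists B.
pose B1 := \sum_i B1_ i; pose B2 := \sum_ij B2_ ij.
have B10 : 0 <= B1 by apply: sumr_ge0 => i _; have [] := hB1 i.
have B20 : 0 <= B2 by apply: sumr_ge0 => i _; have [] := hB2 i.
have b1 i x : `|'D_(e_ i) phi x| <= B1.
  have [_ /(_ x)h] := hB1 i; rewrite (le_trans h)// /B1 (bigD1 i)//= lerDl.
  by apply: sumr_ge0 => j _; have [] := hB1 j.
have b2 i j x : `|'D_(e_ j) ('D_(e_ i) phi) x| <= B2.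
  have [_ /(_ x)h] := hB2 (i, j); rewrite (le_trans h)// /B2 (bigD1 (i, j))//= lerDl.
  by apply: sumr_ge0 => k _; have [] := hB2 k.
have L1 := lipschitz_partial (fun i y => (dphi i).1 y) b1.
have L2 i := lipschitz_partial (fun j y => dphi2 i j y) (b2 i).
have nB2 : 0 <= n%:R * B2 by rewrite mulr_ge0.
have T2 : forall x h, `|phi (x + h) - phi x - \sum_i h ord0 i * 'D_(e_ i) phi x| <=
    n%:R ^+ 2 * ((n%:R * B2) * `|h| ^+ 2).
  apply: taylor_partial => // [i y|i x h]; first exact: (dphi i).1.
  by rewrite -mulrA.
have n2 : 0 <= n%:R ^+ 2 :> R by rewrite sqr_ge0.
exists (B0 + B1 + n%:R * B1 + n%:R * B2 + n%:R ^+ 2 * (n%:R * B2)).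
  by rewrite !addr_ge0// mulr_ge0.
have nB1 : 0 <= n%:R * B1 by rewrite mulr_ge0.
have nnB2 : 0 <= n%:R ^+ 2 * (n%:R * B2) by rewrite mulr_ge0.
split=> //.
- split=> [x|i x]; first by rewrite (le_trans (hB0 x))//; lra.
  by rewrite (le_trans (b1 i x))//; lra.
- split=> [x h|i x h].
    by rewrite (le_trans (L1 x h))// mulrA ler_wpM2r//; lra.
  by rewrite (le_trans (L2 i x h))// mulrA ler_wpM2r//; lra.
- by move=> x h; rewrite (le_trans (T2 x h))// mulrA ler_wpM2r ?sqr_ge0//; lra.
Qed.

End test_function.

(** * The delay equation *)

Section derivative_bounds.
Context {R : realType}.
Implicit Types (h dh g : R -> R).

Lemma mvt_seg h dh (a b : R) : a <= b ->
  (forall t, a <= t <= b -> is_derive t (1 : R) h (dh t)) ->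
  exists2 c, a <= c <= b & h b - h a = dh c * (b - a).
Proof.
move=> ab dhP.
have ch : {within `[a, b], continuous h}.
  apply: derivable_within_continuous => t; rewrite in_itv/= => tab.
  exact: (@ex_derive _ _ _ _ _ _ _ (dhP t tab)).
have hd t : t \in `]a, b[ -> is_derive t (1 : R) h (dh t).
  by rewrite in_itv/= => /andP[ta tb]; apply: dhP; rewrite !ltW.
have [c cab E] := MVT_segment ab hd ch.
by exists c => //; move: cab; rewrite in_itv.
Qed.

Lemma derive_ge0_le h dh (a b : R) : a <= b ->
  (forall t, a <= t <= b -> is_derive t (1 : R) h (dh t)) ->
  (forall t, a <= t <= b -> 0 <= dh t) -> h a <= h b.
Proof.
move=> ab dhP dh0; have [c cab E] := mvt_seg ab dhP.
by rewrite -subr_ge0 E mulr_ge0 ?dh0// subr_ge0.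
Qed.

Lemma derive_near_const h dh (a b k e : R) : a <= b ->
  (forall t, a <= t <= b -> is_derive t (1 : R) h (dh t)) ->
  (forall t, a <= t <= b -> `|dh t - k| <= e) -> `|h b - h a - k * (b - a)| <= e * (b - a).
Proof.
move=> ab dhP dhe; have [c cab E] := mvt_seg ab dhP.
rewrite E -mulrBl normrM [X in _ * X]ger0_norm ?subr_ge0//.
by rewrite ler_wpM2r ?subr_ge0// dhe.
Qed.

(* Variation of constants for g' <= K (m - g) + e. *)
Lemma relaxation g dg (K e m t0 : R) : 1 <= K -> 0 <= e ->
  (forall t, t0 <= t <= t0 + 1 -> is_derive t (1 : R) g (dg t)) ->
  (forall t, t0 <= t <= t0 + 1 -> dg t <= K * (m - g t) + e) -> g t0 <= m ->
  forall t, t0 <= t <= t0 + 1 -> g t <= m - expR (- K) * (m - g t0) + e.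
Proof.
move=> K1 e0 dgP dgle gm t /andP[t0t tt0].
pose h s := expR (K * s) * (m + e - g s).
pose dh s := expR (K * s) * (K * (m + e - g s) - dg s).
have dhP s : t0 <= s <= t -> is_derive s (1 : R) h (dh s).
  move=> /andP[t0s st].
  have dgs := dgP s; rewrite t0s (le_trans st tt0) in dgs; have {}dgs := dgs isT.
  rewrite /h; apply: is_derive_eq; rewrite /GRing.scale/= /dh; ring.
have : h t0 <= h t.
  apply: (derive_ge0_le t0t dhP) => s /andP[t0s st].
  rewrite mulr_ge0 ?expR_ge0// subr_ge0 (le_trans (dgle s _))//.
    by rewrite t0s (le_trans st tt0).
  have : e <= K * e by rewrite ler_peMl.
  lra.
rewrite /h -ler_pdivrMl ?expR_gt0// mulrA -expRN -expRD => H.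
have H1 : expR (- K) * (m - g t0) <= expR (- (K * t) + K * t0) * (m + e - g t0).
  apply: ler_pM; rewrite ?expR_ge0 ?subr_ge0//.
    by rewrite ler_expR; nra.
  by lra.
by have := le_trans H1 H; lra.
Qed.

(** The relaxation bounds need an upper and a lower bound on the whole window, including its unknown
    second half. They are first used to show that the second half adds at most [e / q] to either
    extremum, and then, with the extrema of the window, to gain the factor [1 - q]. *)
Lemma oscillation_contraction g (q e w t0 : R) : 0 < q -> q < 1 -> 0 <= e -> 0 <= w ->
  (forall m, (forall s, t0 - 1 <= s <= t0 + 1 -> g s <= m) ->
     forall t, t0 <= t <= t0 + 1 -> g t <= m - q * (m - g t0) + e) ->
  (forall m, (forall s, t0 - 1 <= s <= t0 + 1 -> m <= g s) ->
     forall t, t0 <= t <= t0 + 1 -> m + q * (g t0 - m) - e <= g t) ->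
  (exists B, forall s, `|g s| <= B) ->
  (forall s t, t0 - 1 <= s <= t0 -> t0 - 1 <= t <= t0 -> `|g s - g t| <= w) ->
  forall s t, t0 <= s <= t0 + 1 -> t0 <= t <= t0 + 1 ->
    `|g s - g t| <= (1 - q) * w + 2 * e / q.
Proof.
move=> q0 q1 e0 w0 Hup Hlow [B gB] osc.
pose I := [set s : R | t0 - 1 <= s <= t0 + 1].
have It0 : I t0 by rewrite /I/=; apply/andP; split; lra.
have bI : has_sup (g @` I).
  by split; [exists (g t0), t0|exists B => _ [s _ <-]; rewrite (le_trans (ler_norm _))].
have lI : has_inf (g @` I).
  split; [by exists (g t0), t0|exists (- B) => _ [s _ <-]].
  by have := gB s; rewrite ler_norml => /andP[].
pose M1 := sup (g @` I); pose m1 := inf (g @` I).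
have gM1 s : t0 - 1 <= s <= t0 + 1 -> g s <= M1.
  by move=> Is; apply: ub_le_sup; [exact: bI.2|exists s].
have m1g s : t0 - 1 <= s <= t0 + 1 -> m1 <= g s.
  by move=> Is; apply: ge_inf; [exact: lI.2|exists s].
have eq0 : 0 <= e / q by rewrite divr_ge0// ltW.
(* If the supremum over the window exceeds [c], it is that of the second half, where the relaxation
   towards [M1] itself gives [q * (M1 - g t0) <= e]. *)
have Mle : forall c, (forall s, t0 - 1 <= s <= t0 -> g s <= c) -> M1 <= c + e / q.
  move=> c gc; have [|cM] := leP M1 (c + e / q) => //.
  have c0 : g t0 <= c by apply: gc; apply/andP; split; lra.
  have : M1 <= Num.max c (M1 - q * (M1 - g t0) + e).
    apply: ge_sup; first exact: bI.1.
    move=> _ [s /andP[s1 s2] <-]; rewrite le_max; have [st|/ltW st] := leP s t0.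
      by rewrite gc ?s1.
    by rewrite (Hup M1 gM1) ?orbT// st.
  rewrite le_max => /orP[h|h]; first by lra.
  have : q * (M1 - g t0) <= e by lra.
  rewrite -ler_pdivlMl// mulrC => h2; lra.
have mge : forall c, (forall s, t0 - 1 <= s <= t0 -> c <= g s) -> c - e / q <= m1.
  move=> c gc; have [|cM] := leP (c - e / q) m1 => //.
  have c0 : c <= g t0 by apply: gc; apply/andP; split; lra.
  have : Num.min c (m1 + q * (g t0 - m1) - e) <= m1.
    apply: lb_le_inf; first exact: lI.1.
    move=> _ [s /andP[s1 s2] <-]; rewrite ge_min; have [st|/ltW st] := leP s t0.
      by rewrite gc ?s1.
    by rewrite (Hlow m1 m1g) ?orbT// st.
  rewrite ge_min => /orP[h|h]; first by lra.
  have : q * (g t0 - m1) <= e by lra.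
  rewrite -ler_pdivlMl// mulrC => h2; lra.
have W : M1 - m1 <= w + 2 * e / q.
  have h1 : forall s, t0 - 1 <= s <= t0 -> M1 - w - e / q <= g s.
    move=> s Is; have := Mle (g s + w).
    have H : forall u, t0 - 1 <= u <= t0 -> g u <= g s + w.
      by move=> u Iu; have := osc u s Iu Is; rewrite ler_norml => /andP[_]; lra.
    by move=> /(_ H); lra.
  by have := mge _ h1; rewrite -mulrA; lra.
move=> s t Is It.
have a1 := Hup M1 gM1 _ Is; have a2 := Hlow m1 m1g _ It.
have b1 := Hup M1 gM1 _ It; have b2 := Hlow m1 m1g _ Is.
have K : (1 - q) * (M1 - m1) + 2 * e <= (1 - q) * w + 2 * e / q.
  have : (1 - q) * (M1 - m1) <= (1 - q) * (w + 2 * e / q) by rewrite ler_wpM2l// subr_ge0 ltW.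
  have -> : (1 - q) * (w + 2 * e / q) = (1 - q) * w + 2 * e / q - 2 * e.
    by field; rewrite gt_eqF.
  by lra.
by rewrite ler_norml; apply/andP; split; lra.
Qed.

End derivative_bounds.

(** * Continuity and means of test functions *)

Lemma within_retract_continuous (X Y Z : topologicalType) (A : set Y) (f : Y -> Z)
    (c : X -> Y) : {within A, continuous f} -> continuous c -> (forall x, A (c x)) ->
  continuous (f \o c).
Proof.
move=> cf cc Ac x P nP.
have h : within A (nbhs (c x)) (f @^-1` P).
  by rewrite (nbhs_subspace_in (Ac x)); exact: (cf (c x) P nP).
have hc : nbhs x (c @^-1` [set y | A y -> (f @^-1` P) y]) := cc x _ h.
by apply: filterS hc => y /=; apply; exact: Ac.
Qed.

Lemma continuous_fst (X Y : topologicalType) : continuous (@fst X Y).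
Proof. by move=> z; exact: cvg_fst. Qed.

Lemma continuous_snd (X Y : topologicalType) : continuous (@snd X Y).
Proof. by move=> z; exact: cvg_snd. Qed.

Lemma continuous_fcomp (X Y Z : topologicalType) (f : Y -> Z) (g : X -> Y) :
  continuous f -> continuous g -> continuous (fun x => f (g x)).
Proof. by move=> cf cg x; apply: continuous_comp; [exact: cg|exact: cf]. Qed.

Lemma continuous_pair (X Y Z : topologicalType) (f : X -> Y) (g : X -> Z) :
  continuous f -> continuous g -> continuous (fun x => (f x, g x)).
Proof. by move=> cf cg x; exact: (cvg_pair (cf x) (cg x)). Qed.

Lemma continuous_row_coord {R : realType} (n : nat) (X : topologicalType)
    (f : X -> 'rV[R]_n) :
  (forall j, continuous (fun x => f x ord0 j)) -> continuous f.
Proof.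
move=> cf x; apply/cvg_ballP => e e0.
have h j : \forall y \near x, `|f x ord0 j - f y ord0 j| < e.
  by have /cvgrPdist_lt/(_ _ e0) := cf j x.
have hall := @filter_forall _ _ _ (nbhs x) (nbhs_filter x) h.
apply: (@filterS _ (nbhs x) (nbhs_filter x) _ _ _ hall) => y hy; split => // i j; rewrite (ord1 i).
exact: hy.
Qed.

(** The pair is encoded as a row of length [n + 1], for which continuous functions are already known
    to be measurable. *)
Lemma continuous_measurable_prod {R : realType} (n : nat) (h : R * 'rV[R]_n -> R) :
  continuous h -> measurable_fun setT h.
Proof.
move=> ch; have -> : h = (h \o @unconsrow R n) \o @consrow R n.
  by apply/funext => p /=; rewrite consrowK.
apply: measurableT_comp (@measurable_consrow R n).
apply: continuous_measurable_row => v.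
apply: continuous_comp; last exact: ch.
move: v; apply: continuous_pair; first exact: continuous_coord.
apply: continuous_row_coord => j.
by under eq_fun do rewrite mxE; exact: continuous_coord.
Qed.

Section narrow_evaluation.
Context {R : realType} {N : nat}.

Lemma continuous_narrow_eval (f : 'rV[R]_N -> R) : Cb f ->
  continuous (fun m : narrow R N => \int[(m : probability 'rV[R]_N R)]_x f x).
Proof.
move=> Cf m.
pose F : set_type (@Cb R N) := SigSub (mem_set Cf).
apply: (@continuous_comp _ _ _ (@narrow_pairing R N : narrow R N -> _)
  (fun k : {ptws set_type (@Cb R N) -> R} => k F)).
  exact: initial_continuous.
exact: proj_continuous.
Qed.

End narrow_evaluation.

Section continuous_arith.
Context {R : realType} {T : topologicalType}.
Implicit Types f g : T -> R.

Lemma continuous_add f g : continuous f -> continuous g -> continuous (fun x => f x + g x).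
Proof. by move=> cf cg x; apply: cvgD; [exact: cf|exact: cg]. Qed.

Lemma continuous_sub f g : continuous f -> continuous g -> continuous (fun x => f x - g x).
Proof. by move=> cf cg x; apply: cvgB; [exact: cf|exact: cg]. Qed.

Lemma continuous_mul f g : continuous f -> continuous g -> continuous (fun x => f x * g x).
Proof. by move=> cf cg x; apply: cvgM; [exact: cf|exact: cg]. Qed.

End continuous_arith.

Section probability_mean.
Context {R : realType} {N : nat} (P : probability 'rV[R]_N R).
Implicit Types f g : 'rV[R]_N -> R.

Lemma Cb_integrable f : Cb f -> P.-integrable setT (EFin \o f).
Proof.
move=> [cf [B fB]]; apply: measurable_bounded_integrable => //.
- by rewrite (@le_lt_trans _ _ 1%E) ?ltry//; exact: probability_le1.
- exact: continuous_measurable_row.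
- exists B; split; first exact: num_real.
  by move=> x Bx y _; exact: le_trans (fB y) (ltW Bx).
Qed.

Lemma mean_cst c : \int[P]_x (cst c x) = c.
Proof.
have PT : P [set: _] = 1%E by exact: probability_setT.
by rewrite Rintegral_cst//; have -> : fine (P [set: _]) = 1; rewrite ?PT// mulr1.
Qed.

Lemma mean_bound f B : Cb f -> (forall x, `|f x| <= B) -> `|\int[P]_x f x| <= B.
Proof.
move=> Cf fB; rewrite -[leRHS]mean_cst; apply: Rintegral_dominated => //.
  exact: Cb_integrable.
by apply: Cb_integrable; split; [exact: cst_continuous|exists `|B| => x /=; exact: lexx].
Qed.

Lemma Cb_sub f g : Cb f -> Cb g -> Cb (fun x => f x - g x).
Proof.
move=> [cf [B fB]] [cg [B' gB]]; split; first exact: continuous_sub.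
by exists (B + B') => x; rewrite (le_trans (ler_normB _ _))// lerD.
Qed.

Lemma mean_close f g c : Cb f -> Cb g -> (forall x, `|f x - g x| <= c) ->
  `|\int[P]_x f x - \int[P]_x g x| <= c.
Proof.
move=> Cf Cg fg; rewrite -RintegralB//; [|exact: Cb_integrable|exact: Cb_integrable].
by apply: mean_bound => //; exact: Cb_sub.
Qed.

End probability_mean.

Lemma lip_continuous {R : realType} (V : normedModType R) (f : V -> R) (l : R) :
  (forall x y, `|f x - f y| <= l * `|x - y|) -> continuous f.
Proof.
move=> fl x; apply/cvgrPdist_le => e e0; near=> y.
rewrite (le_trans (fl _ _))//.
apply: (@le_trans _ _ ((`|l| + 1) * `|x - y|)).
  by rewrite ler_wpM2r// (le_trans (ler_norm l))// lerDl.
rewrite -ler_pdivlMl; last by rewrite ltr_wpDl.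
near: y; apply: cvgr_dist_le; first exact: cvg_id.
by rewrite mulr_gt0// invr_gt0 ltr_wpDl.
Unshelve. all: by end_near. Qed.

Section lipschitz.
Context {R : realType} {N : nat}.
Implicit Types f g : 'rV[R]_N -> R.

Definition bounded_lip f (B l : R) :=
  (forall x, `|f x| <= B) /\ (forall x y, `|f x - f y| <= l * `|x - y|).

Lemma bounded_lip_Cb f B l : bounded_lip f B l -> Cb f.
Proof.
move=> [fB fl]; split; last by exists B.
exact: lip_continuous fl.
Qed.

Lemma bounded_lip_shift f B l z : bounded_lip f B l -> bounded_lip (fun x => f (x + z)) B l.
Proof.
move=> [fB fl]; split=> [x|x y]; first exact: fB.
by rewrite (le_trans (fl _ _))// opprD addrACA subrr addr0.
Qed.

Lemma bounded_lip_opp f B l : bounded_lip f B l -> bounded_lip (fun x => - f x) B l.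
Proof.
by move=> [fB fl]; split=> [x|x y]; [rewrite normrN|rewrite -opprD normrN].
Qed.

Lemma bounded_lip_ge0 f B l : bounded_lip f B l -> 0 <= B.
Proof. by move=> [fB _]; rewrite (le_trans _ (fB 0)). Qed.

End lipschitz.

Section clamp.
Context {R : realType}.

Definition clamp (th : R) : R := Num.max (-1) (Num.min th 0).

Lemma clamp_itv th : -1 <= clamp th <= 0.
Proof. by rewrite /clamp le_max lexx/= ge_max lerN10 ge_min lexx orbT. Qed.

Lemma clamp_id th : -1 <= th -> th <= 0 -> clamp th = th.
Proof. by move=> h1 h2; rewrite /clamp (min_idPl _)// (max_idPr _). Qed.

Lemma continuous_clamp : continuous clamp.
Proof.
move=> x; apply: (@continuous_max R R (cst (-1)) (fun th => Num.min th 0)).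
  exact: cst_continuous.
by apply: (@continuous_min R R id (cst 0)); [exact: cvg_id|exact: cst_continuous].
Qed.

Lemma continuous_maxl (c : R) : continuous (fun t : R => Num.max t c).
Proof.
move=> x; apply: (@continuous_max R R id (cst c)); first exact: cvg_id.
exact: cst_continuous.
Qed.

End clamp.

(** * Integrals against the jump measure *)

Section second_moment.
Context {R : realType} {N : nat}.
Variable Q : probability (R * 'rV[R]_N)%type R.
Hypothesis hQ : Q slab = 1%E.
Hypothesis hQ2 : (\int[Q]_(p in slab) (enorm p.2 ^+ 2)%:E < +oo)%E.
Implicit Types h : R * 'rV[R]_N -> R.

(** One integrable majorant for constants, for the length of a jump and for its square, so that all
    error terms can be collected over a single integral. *)
Definition weight (p : R * 'rV[R]_N) := 1 + enorm p.2 ^+ 2.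
Definition moment := \int[Q]_(p in slab) weight p.

Lemma measurable_slab : measurable (slab : set (R * 'rV[R]_N)).
Proof. by apply: measurableX. Qed.

Lemma slab_clamp (p : R * 'rV[R]_N) : slab p -> clamp p.1 = p.1.
Proof. by move=> [/=]; rewrite in_itv/= => /andP[h1 h2] _; exact: clamp_id. Qed.

Lemma weight_ge1 p : 1 <= weight p.
Proof. by rewrite lerDl sqr_ge0. Qed.

Lemma weight_ge_sqr p : `|p.2| ^+ 2 <= weight p.
Proof.
rewrite (@le_trans _ _ (enorm p.2 ^+ 2))// ?lerDr//.
by rewrite lerXn2r ?nnegrE ?norm_le_enorm ?sqrtr_ge0.
Qed.

Lemma weight_ge_norm p : `|p.2| <= weight p.
Proof.
rewrite (le_trans (norm_le_enorm _))// /weight.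
by have := sqr_ge0 (1 - enorm p.2); have := sqr_ge0 (enorm p.2); nra.
Qed.

Lemma measurable_weight : measurable_fun setT weight.
Proof.
apply: measurable_funD => //; apply: measurable_funX.
have -> : (fun p : R * 'rV[R]_N => enorm p.2) = Num.sqrt \o (fun p => dotp p.2 p.2) by [].
apply: measurableT_comp; last exact: measurable_dotp2.
by apply: continuous_measurable_fun; exact: sqrt_continuous.
Qed.

Lemma integrable_weight : Q.-integrable slab (EFin \o weight).
Proof.
apply/integrableP; split.
  by apply/measurable_EFinP; apply: measurable_funTS; exact: measurable_weight.
under eq_integral do rewrite /= ger0_norm ?(le_trans ler01 (weight_ge1 _))// EFinD.
have ms := measurable_slab.
rewrite ge0_integralD//.
- by rewrite integral_cst// mul1e [X in (X + _)%E]hQ lte_add_pinfty// ltry.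
- by move=> p _; rewrite lee_fin sqr_ge0.
- apply/measurable_EFinP; apply: measurable_funTS.
  by have := measurable_funB measurable_weight (measurable_cst (1 : R));
    apply: eq_measurable_fun => p _ /=; rewrite addrC addKr.
Qed.

Lemma slab_integrable h c : measurable_fun setT h ->
  (forall p, slab p -> `|h p| <= c * weight p) -> Q.-integrable slab (EFin \o h).
Proof.
move=> mh hc; have ms := measurable_slab.
have iw : Q.-integrable slab (EFin \o (fun p => c * weight p)).
  exact: (integrableZl ms c integrable_weight).
apply: (le_integrable ms _ _ iw).
  by apply/measurable_EFinP; exact: measurable_funTS.
by move=> p sp /=; rewrite lee_fin (le_trans (hc p sp))// ler_norm.
Qed.

Lemma slab_integral_le h c : measurable_fun setT h ->
  (forall p, slab p -> `|h p| <= c * weight p) ->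
  `|\int[Q]_(p in slab) h p| <= c * moment.
Proof.
move=> mh hc; have ms := measurable_slab.
rewrite /moment -RintegralZl//; last exact: integrable_weight.
apply: Rintegral_dominated => //; first exact: slab_integrable hc.
exact: (integrableZl ms c integrable_weight).
Qed.

Lemma slab_integral_cst c : \int[Q]_(p in slab) (c : R) = c.
Proof.
have ms := measurable_slab; rewrite Rintegral_cst//.
by have -> : fine (Q slab) = 1; rewrite ?hQ// mulr1.
Qed.

Lemma moment_ge1 : 1 <= moment.
Proof.
rewrite -(slab_integral_cst 1); apply: le_Rintegral => //.
- exact: measurable_slab.
- apply: (@slab_integrable (cst 1) 1) => // p _.
  by rewrite normr1 mul1r weight_ge1.
- exact: integrable_weight.
- by move=> p _; exact: weight_ge1.
Qed.

End second_moment.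

Definition primitive {R : realType} (a : R) (g : R -> R) (t : R) :=
  \int[lebesgue_measure]_(x in `[a, t]) g x.

Lemma primitive_derive {R : realType} (a : R) (g : R -> R) (t : R) : continuous g ->
  a < t -> is_derive t (1 : R) (primitive a g) (g t).
Proof.
move=> cg at_.
have ig : lebesgue_measure.-integrable `[a, t + 1] (EFin \o g).
  apply: continuous_compact_integrable; first exact: segment_compact.
  exact: continuous_subspaceT.
have tt1 : t < t + 1 by rewrite ltrDl.
have [d1 d2] := continuous_FTC1_closed tt1 ig at_ (cg t).
split; first exact: d1.
by rewrite -derive1E; exact: d2.
Qed.

(** * Oscillation and averages of the observables *)

Section delay.
Context {R : realType} {N : nat}.
Variable Q : probability (R * 'rV[R]_N)%type R.
Hypothesis hQ : Q slab = 1%E.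
Hypothesis hQ2 : (\int[Q]_(p in slab) (enorm p.2 ^+ 2)%:E < +oo)%E.
Variables (alpha : R -> R -> R) (alpha_inf : R -> R) (K M beta : R).
Hypothesis K_ge1 : 1 <= K.
Hypothesis M_gt0 : 0 < M.
Hypothesis beta_gt0 : 0 < beta.
Hypothesis alpha_bd : forall t th, 0 <= t -> -1 <= th <= 0 -> 0 <= alpha t th <= K.
Hypothesis alpha_inf_bd : forall th, -1 <= th <= 0 -> 0 <= alpha_inf th <= K.
Hypothesis alpha_cont : {within `[0, +oo[ `*` `[-1, 0],
  continuous (fun p : R * R => alpha p.1 p.2)}.
Hypothesis alpha_inf_cont : {within `[-1, 0], continuous alpha_inf}.
Hypothesis alpha_close : forall t th, 0 <= t -> -1 <= th <= 0 ->
  `|alpha t th - alpha_inf th| <= M * expR (- (beta * t)).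
Variable mu : R -> probability 'rV[R]_N R.
Hypothesis mu_cont : {within `[-1, +oo[, continuous (mu : R -> narrow R N)}.
Hypothesis mu_delay : forall f : 'rV[R]_N -> R, Cb f -> forall t : R, 0 < t ->
  is_derive t (1 : R) (fun t : R => \int[mu t]_x f x) (delay_rhs alpha Q mu f t).

Implicit Types (f : 'rV[R]_N -> R) (t th B l : R) (p : R * 'rV[R]_N).

(* The rates and the solution are extended beyond their domain by constants, so
   that they are continuous everywhere. *)
Definition rate t th := alpha (Num.max t 0) (clamp th).
Definition rate_inf th := alpha_inf (clamp th).
Definition obs f t := \int[mu (Num.max t (-1))]_x f x.
Definition delayed f t p := obs (fun x => f (x + p.2)) (t + clamp p.1).

Lemma rate_bd t th : 0 <= rate t th <= K.
Proof. by apply: alpha_bd; [rewrite le_max lexx orbT|exact: clamp_itv]. Qed.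

Lemma rate_norm t th : `|rate t th| <= K.
Proof. by have /andP[h ?] := rate_bd t th; rewrite ger0_norm. Qed.

Lemma rate_inf_bd th : 0 <= rate_inf th <= K.
Proof. by apply: alpha_inf_bd; exact: clamp_itv. Qed.

Lemma rate_inf_norm th : `|rate_inf th| <= K.
Proof. by have /andP[h ?] := rate_inf_bd th; rewrite ger0_norm. Qed.

Lemma rate_close t th : 0 <= t -> `|rate t th - rate_inf th| <= M * expR (- (beta * t)).
Proof. by move=> t0; rewrite /rate (max_idPl _)//; apply: alpha_close => //; exact: clamp_itv. Qed.

Lemma continuous_rate2 : continuous (fun z : R * R => rate z.1 z.2).
Proof.
pose c (z : R * R) : R * R := (Num.max z.1 0, clamp z.2).
apply: (within_retract_continuous (c := c) alpha_cont).
- apply: continuous_pair.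
    exact: continuous_fcomp (@continuous_maxl _ _) (@continuous_fst _ _).
  exact: continuous_fcomp (@continuous_clamp _) (@continuous_snd _ _).
- move=> z; split; rewrite /= in_itv/= ?clamp_itv//.
  by rewrite le_max lexx orbT.
Qed.

Lemma continuous_rate t : continuous (fun p : R * 'rV[R]_N => rate t p.1).
Proof.
apply: (continuous_fcomp (f := fun z : R * R => rate z.1 z.2)
  (g := fun p : R * 'rV[R]_N => (t, p.1)) continuous_rate2).
by apply: continuous_pair; [exact: cst_continuous|exact: continuous_fst].
Qed.

Lemma continuous_ratel th : continuous (rate^~ th).
Proof.
apply: (continuous_fcomp (f := fun z : R * R => rate z.1 z.2)
  (g := fun t : R => (t, th)) continuous_rate2).
by apply: continuous_pair; [move=> t; exact: cvg_id|exact: cst_continuous].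
Qed.

Lemma continuous_clamp1 : continuous (fun p : R * 'rV[R]_N => clamp p.1).
Proof. exact: continuous_fcomp (@continuous_clamp _) (@continuous_fst _ _). Qed.

Lemma continuous_rate_inf : continuous (fun p : R * 'rV[R]_N => rate_inf p.1).
Proof.
apply: (within_retract_continuous (c := fun p : R * 'rV[R]_N => clamp p.1) alpha_inf_cont).
  exact: continuous_clamp1.
by move=> p; rewrite /= in_itv/= clamp_itv.
Qed.

Lemma continuous_obs f : Cb f -> continuous (obs f).
Proof.
move=> Cf.
have cm : continuous ((mu : R -> narrow R N) \o (fun t : R => Num.max t (-1))).
  apply: (within_retract_continuous mu_cont); first exact: continuous_maxl.
  by move=> t; rewrite /= in_itv/= andbT le_max lexx orbT.
exact: continuous_fcomp (continuous_narrow_eval Cf) cm.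
Qed.

Lemma obs_bound f B l t : bounded_lip f B l -> `|obs f t| <= B.
Proof. by move=> bf; apply: mean_bound; [exact: bounded_lip_Cb bf|exact: bf.1]. Qed.

Lemma obs_close f g c t : Cb f -> Cb g -> (forall x, `|f x - g x| <= c) ->
  `|obs f t - obs g t| <= c.
Proof. exact: mean_close. Qed.

Lemma obs_opp f t : Cb f -> obs (fun x => - f x) t = - obs f t.
Proof.
move=> Cf; rewrite -[RHS]mulN1r /obs -RintegralZl//; last exact: Cb_integrable.
by apply: eq_Rintegral => x _; rewrite mulN1r.
Qed.

Lemma delayed_bound f B l t p : bounded_lip f B l -> `|delayed f t p| <= B.
Proof. by move=> bf; apply: obs_bound; apply: bounded_lip_shift bf. Qed.

Lemma delayed_close f B l t p : bounded_lip f B l ->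
  `|delayed f t p - obs f (t + clamp p.1)| <= l * `|p.2|.
Proof.
move=> bf; apply: obs_close => [||x].
- exact: bounded_lip_Cb (bounded_lip_shift _ bf).
- exact: bounded_lip_Cb bf.
- by rewrite (le_trans (bf.2 _ _))// addrAC subrr add0r.
Qed.

(** Narrow continuity gives continuity in time for one test function at a time. With the jump frozen
    at [z0] this settles the delay variable, and the Lipschitz constant of [f] controls the change
    of jump uniformly in time. *)
Lemma continuous_delayed f B l t : bounded_lip f B l -> continuous (delayed f t).
Proof.
move=> bf [th0 z0].
pose k p := obs (fun x => f (x + z0)) (t + clamp p.1).
have ck : continuous k.
  apply: (continuous_fcomp (f := obs (fun x => f (x + z0)))).
    by apply: continuous_obs; exact: bounded_lip_Cb (bounded_lip_shift _ bf).
  by apply: continuous_add; [exact: cst_continuous|exact: continuous_clamp1].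
apply/cvgrPdist_le => e e0.
have e20 : 0 < e / 2 by rewrite divr_gt0.
have l0 : 0 < `|l| + 1 by rewrite ltr_wpDl.
have H1 : \forall p \near (th0, z0), `|k (th0, z0) - k p| <= e / 2.
  by have /cvgrPdist_le/(_ _ e20) := ck (th0, z0).
have H2 : \forall p \near (th0, z0), `|z0 - p.2| <= e / 2 / (`|l| + 1).
  have : (snd p : 'rV[R]_N) @[p --> (th0, z0)] --> z0 by exact: cvg_snd.
  by move=> /cvgrPdist_le; apply; rewrite divr_gt0.
near=> p.
have h1 : `|k (th0, z0) - k p| <= e / 2 by near: p.
have h2 : `|z0 - p.2| <= e / 2 / (`|l| + 1) by near: p.
have h3 : `|k p - delayed f t p| <= e / 2.
  apply: obs_close => [||x].
  - exact: bounded_lip_Cb (bounded_lip_shift _ bf).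
  - exact: bounded_lip_Cb (bounded_lip_shift _ bf).
  - rewrite (le_trans (bf.2 _ _))// opprD addrACA subrr add0r.
    apply: (@le_trans _ _ ((`|l| + 1) * `|z0 - p.2|)).
      by rewrite ler_wpM2r// (le_trans (ler_norm l))// lerDl.
    by rewrite mulrC -ler_pdivlMr.
rewrite -[_ - _](subrKA (k p)) (le_trans (ler_normD _ _))//.
by rewrite [leRHS]splitr lerD.
Unshelve. all: by end_near. Qed.

Lemma ler_weight (c : R) p : 0 <= c -> c <= c * weight p.
Proof. by move=> c0; rewrite ler_peMr// weight_ge1. Qed.

Lemma K_ge0 : 0 <= K. Proof. exact: le_trans K_ge1. Qed.

Let ms := @measurable_slab R N.

(** Gain and loss of the delay equation under one integral, so that differences of observables enter
    the estimates rather than their sizes. *)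
Definition jump_rate f t := \int[Q]_(p in slab) (rate t p.1 * (delayed f t p - obs f t)).

Lemma integrable_rate t : Q.-integrable slab (EFin \o (fun p => rate t p.1)).
Proof.
apply: (slab_integrable hQ hQ2 (c := K)).
  by apply: continuous_measurable_prod; exact: continuous_rate.
by move=> p _; rewrite (le_trans (rate_norm _ _))// ler_weight// K_ge0.
Qed.

Lemma integrable_rate_delayed f B l t : bounded_lip f B l ->
  Q.-integrable slab (EFin \o (fun p => rate t p.1 * delayed f t p)).
Proof.
move=> bf; have B0 := bounded_lip_ge0 bf.
apply: (slab_integrable hQ hQ2 (c := K * B)).
  apply: continuous_measurable_prod; apply: continuous_mul.
    exact: continuous_rate.
  exact: continuous_delayed bf.
move=> p _; rewrite (@le_trans _ _ (K * B))// ?ler_weight ?mulr_ge0 ?K_ge0//.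
by rewrite normrM ler_pM// ?rate_norm// (delayed_bound _ _ bf).
Qed.

Lemma delay_derive f B l t : bounded_lip f B l -> 0 < t ->
  is_derive t (1 : R) (obs f) (jump_rate f t).
Proof.
move=> bf t0; have Cf := bounded_lip_Cb bf.
have := mu_delay Cf t0.
have -> : delay_rhs alpha Q mu f t = jump_rate f t.
  rewrite /delay_rhs /jump_rate; transitivity
    (\int[Q]_(p in slab) (rate t p.1 * delayed f t p) -
     obs f t * \int[Q]_(p in slab) rate t p.1).
    have E1 : \int[Q]_(p in slab) (alpha t p.1 * \int[mu (t + p.1)]_x f (x + p.2)) =
        \int[Q]_(p in slab) (rate t p.1 * delayed f t p).
      apply: eq_Rintegral => p; rewrite inE => sp.
      have pc := slab_clamp sp; have := clamp_itv p.1; rewrite pc => /andP[p1 p2].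
      rewrite /rate (max_idPl _) ?(ltW t0)// pc /delayed /obs pc (max_idPl _)//; lra.
    have tm : Num.max t (-1) = t by apply/max_idPl; lra.
    have E2 : \int[mu t]_x f x = obs f t by rewrite /obs tm.
    have E3 : \int[Q]_(p in slab) alpha t p.1 = \int[Q]_(p in slab) rate t p.1.
      apply: eq_Rintegral => p; rewrite inE => sp.
      by rewrite /rate (max_idPl _) ?(ltW t0)// slab_clamp.
    by rewrite E1 E2 E3.
  rewrite -RintegralZl//; last exact: integrable_rate.
  rewrite -RintegralB//.
  - by apply: eq_Rintegral => p _; rewrite mulrBr [_ * obs f t]mulrC.
  - exact: integrable_rate_delayed bf.
  - exact: (integrableZl ms (obs f t) (integrable_rate t)).
apply: near_eq_is_derive; near=> s.
rewrite /obs (max_idPl _)// ltW//; near: s; apply: lt_nbhsr; lra.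
Unshelve. all: by end_near. Qed.

Local Notation m := (moment Q).
Local Notation q := (expR (- K)).

Let m_ge1 : 1 <= m. Proof. exact: moment_ge1. Qed.
Let m_ge0 : 0 <= m. Proof. exact: le_trans m_ge1. Qed.
Let K0 := K_ge0.

(** Removing the jump from the test function costs [l * |p.2|], after which the delayed observable
    is at most [c]. The rate is replaced by [K] only once the bracket is bounded by a nonnegative
    quantity. *)
Lemma inc_upper f B l t c : bounded_lip f B l -> 0 <= l ->
  obs f t <= c -> (forall p, obs f (t + clamp p.1) <= c) ->
  jump_rate f t <= K * (c - obs f t) + K * l * m.
Proof.
move=> bf l0 tc pc; have iw := integrable_weight hQ hQ2.
have e0 : 0 <= K * l by rewrite mulr_ge0.
have c0 : 0 <= c - obs f t by rewrite subr_ge0.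
have iW : Q.-integrable slab
    (EFin \o (fun p : R * 'rV[R]_N => K * (c - obs f t) + K * l * weight p)).
  apply: integrable_add => //; last exact: (integrableZl ms (K * l) iw).
  apply: (slab_integrable hQ hQ2 (c := K * (c - obs f t))); first exact: measurable_cst.
  by move=> p _; rewrite ger0_norm ?mulr_ge0// ler_weight// mulr_ge0.
apply: (@le_trans _ _ (\int[Q]_(p in slab) (K * (c - obs f t) + K * l * weight p))).
  apply: le_Rintegral => //.
    have := integrable_sub ms (integrable_rate_delayed t bf)
      (integrableZl ms (obs f t) (integrable_rate t)).
    apply: eq_integrable => // p _ /=; congr EFin.
    by rewrite mulrBr [obs f t * _]mulrC.
  move=> p _; have /andP[r0 rK] := rate_bd t p.1.
  have := delayed_close t p bf; rewrite ler_norml => /andP[_ h].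
  have h2 : delayed f t p - obs f t <= (c - obs f t) + l * weight p.
    have := pc p; have : l * `|p.2| <= l * weight p by rewrite ler_wpM2l// weight_ge_norm.
    lra.
  rewrite (le_trans (ler_wpM2l r0 h2))// -mulrA -mulrDr ler_wpM2r//.
  by rewrite addr_ge0// mulr_ge0// (le_trans ler01)// weight_ge1.
rewrite RintegralD//; last 2 first.
- apply: (slab_integrable hQ hQ2 (c := K * (c - obs f t))); first exact: measurable_cst.
  by move=> p _; rewrite ger0_norm ?mulr_ge0// ler_weight// mulr_ge0.
- exact: (integrableZl ms (K * l) iw).
by rewrite slab_integral_cst// RintegralZl.
Qed.

Lemma clamp_window t (s : R) th : t <= s <= t + 1 -> t - 1 <= s + clamp th <= t + 1.
Proof. by move=> /andP[h1 h2]; have /andP[h3 h4] := clamp_itv th; apply/andP; split; lra. Qed.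

Lemma obs_relax_up f B l t0 c : bounded_lip f B l -> 0 <= l -> 0 < t0 ->
  (forall s, t0 - 1 <= s <= t0 + 1 -> obs f s <= c) ->
  forall t, t0 <= t <= t0 + 1 -> obs f t <= c - q * (c - obs f t0) + K * l * m.
Proof.
move=> bf l0 t00 gc t t0t.
have e0 : 0 <= K * l * m by rewrite !mulr_ge0.
have h1 (s : R) : t0 <= s <= t0 + 1 -> is_derive s (1 : R) (obs f) (jump_rate f s).
  by move=> /andP[t0s _]; apply: delay_derive bf _; exact: lt_le_trans t0s.
have h2 s : t0 <= s <= t0 + 1 -> jump_rate f s <= K * (c - obs f s) + K * l * m.
  move=> t0s; apply: (inc_upper bf l0).
    by apply: gc; move: t0s => /andP[? ?]; apply/andP; split; lra.
  by move=> p; apply: gc; exact: clamp_window.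
have h3 : obs f t0 <= c by apply: gc; apply/andP; split; lra.
exact: (relaxation K_ge1 e0 h1 h2 h3 t0t).
Qed.

Lemma obs_relax_low f B l t0 c : bounded_lip f B l -> 0 <= l -> 0 < t0 ->
  (forall s, t0 - 1 <= s <= t0 + 1 -> c <= obs f s) ->
  forall t, t0 <= t <= t0 + 1 -> c + q * (obs f t0 - c) - K * l * m <= obs f t.
Proof.
move=> bf l0 t00 gc t t0t; have Cf := bounded_lip_Cb bf.
have := @obs_relax_up _ B l t0 (- c) (bounded_lip_opp bf) l0 t00.
have h : forall s, t0 - 1 <= s <= t0 + 1 -> obs (fun x => - f x) s <= - c.
  by move=> s ts; rewrite obs_opp// lerN2 gc.
by move=> /(_ h t t0t); rewrite !obs_opp//; lra.
Qed.

Let q0 : 0 < q. Proof. exact: expR_gt0. Qed.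
Let q1 : q < 1.
Proof. by rewrite -expR0 ltr_expR oppr_lt0 (lt_le_trans ltr01). Qed.

(** The fixed point of the recursion in [oscillation_contraction]: per unit of [l], each step adds
    [2 * (K * m) / q], and the powers of [1 - q] sum to [1 / q]. *)
Definition osc_cst := 2 * (K * m) / q / q.

Lemma osc_cst_ge0 : 0 <= osc_cst.
Proof. by rewrite /osc_cst !divr_ge0 ?mulr_ge0// ltW. Qed.

Lemma obs_osc f B l (k : nat) : bounded_lip f B l -> 0 <= l ->
  forall s t, k%:R <= s <= k%:R + 1 -> k%:R <= t <= k%:R + 1 ->
  `|obs f s - obs f t| <= (1 - q) ^+ k * (2 * B) + osc_cst * l.
Proof.
move=> bf l0; have B0 := bounded_lip_ge0 bf.
have ol0 : 0 <= osc_cst * l by rewrite mulr_ge0// osc_cst_ge0.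
elim: k => [|k IH] s t hs ht.
  rewrite expr0 mul1r (le_trans (ler_normB _ _))// mulr_natl mulr2n ler_wpDr//.
  by rewrite lerD// (obs_bound _ bf).
have k1 : k.+1%:R = k%:R + 1 :> R by rewrite -natr1.
have k10 : 0 < k.+1%:R :> R by rewrite ltr0n.
have w0 : 0 <= (1 - q) ^+ k * (2 * B) + osc_cst * l.
  by rewrite addr_ge0// mulr_ge0 ?exprn_ge0 ?subr_ge0 ?(ltW q1)// mulr_ge0.
have e0 : 0 <= K * l * m by rewrite !mulr_ge0.
have := @oscillation_contraction _ (obs f) q (K * l * m) _ k.+1%:R q0 q1 e0 w0.
move=> /(_ (fun c => obs_relax_up bf l0 k10)) /(_ (fun c => obs_relax_low bf l0 k10)).
move=> /(_ (ex_intro _ B (fun u => obs_bound u bf))) H.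
have IH' s' t' : k.+1%:R - 1 <= s' <= k.+1%:R -> k.+1%:R - 1 <= t' <= k.+1%:R ->
    `|obs f s' - obs f t'| <= (1 - q) ^+ k * (2 * B) + osc_cst * l.
  by rewrite k1 addrK; exact: IH.
apply: (le_trans (H IH' s t hs ht)).
rewrite exprS /osc_cst le_eqVlt; apply/orP; left; apply/eqP; field.
by rewrite gt_eqF.
Qed.

(** [k.+1%:R] is the common end of two consecutive windows of [obs_osc], the later of which has the
    smaller bound. *)
Lemma obs_near f B l (k : nat) s : bounded_lip f B l -> 0 <= l ->
  k%:R <= s <= k%:R + 2 ->
  `|obs f s - obs f k.+1%:R| <= (1 - q) ^+ k * (2 * B) + osc_cst * l.
Proof.
move=> bf l0 /andP[ks sk]; have B0 := bounded_lip_ge0 bf.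
have k1 : k.+1%:R = k%:R + 1 :> R by rewrite -natr1.
have [sk1|/ltW sk1] := leP s k.+1%:R.
  apply: (obs_osc bf l0); first by rewrite ks -k1.
  by rewrite -k1 lexx andbT ler_nat.
rewrite (le_trans (obs_osc (k := k.+1) bf l0 _ _))//.
- by rewrite sk1 k1; lra.
- by rewrite lexx/= lerDl ler01.
rewrite lerD2r ler_wpM2r ?mulr_ge0// exprS ler_piMl//.
by rewrite exprn_ge0// subr_ge0 ltW.
Qed.

(* The base point only has to lie below every [t + clamp th] with [-1 <= t]. *)
Let prim := @primitive R (-3).

(* A first integral of g'(t) = \int alpha_inf(theta) (g(t + theta) - g t) dQ, the
   limiting delay equation without jumps. *)
Definition avg (g : R -> R) t := g t +
  \int[Q]_(p in slab) (rate_inf p.1 * (prim g t - prim g (t + clamp p.1))).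

Definition Gamma := \int[Q]_(p in slab) (rate_inf p.1 * - clamp p.1).

Let clamp_norm th : `|clamp th| <= 1.
Proof. by have /andP[? ?] := clamp_itv th; rewrite ler_norml; apply/andP; split; lra. Qed.

Lemma integrable_Gamma : Q.-integrable slab (EFin \o (fun p => rate_inf p.1 * - clamp p.1)).
Proof.
apply: (slab_integrable hQ hQ2 (c := K)).
  apply: continuous_measurable_prod; apply: continuous_mul; first exact: continuous_rate_inf.
  by move=> p; apply: cvgN; exact: continuous_clamp1.
move=> p _; rewrite (le_trans _ (ler_weight _ K0))// normrM normrN.
by rewrite -[leRHS]mulr1 ler_pM// rate_inf_norm.
Qed.

Lemma Gamma_bd : 0 <= Gamma <= K.
Proof.
apply/andP; split.
  apply: Rintegral_ge0 => p _; have /andP[? ?] := clamp_itv p.1.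
  by have /andP[? ?] := rate_inf_bd p.1; rewrite mulr_ge0// oppr_ge0.
rewrite -[leRHS](slab_integral_cst hQ); apply: le_Rintegral => //.
- exact: integrable_Gamma.
- apply: (slab_integrable hQ hQ2 (c := K)); first exact: measurable_cst.
  by move=> p _; rewrite ger0_norm// ler_weight.
- move=> p _; have /andP[? ?] := clamp_itv p.1; have /andP[? ?] := rate_inf_bd p.1.
  by rewrite -[leRHS]mulr1 ler_pM// ?oppr_ge0// lerNl.
Qed.

Lemma continuous_prim_clamp g t : continuous g -> -1 <= t ->
  continuous (fun p : R * 'rV[R]_N => prim g (t + clamp p.1)).
Proof.
move=> cg t1 p; apply: (@continuous_comp _ _ _ (fun p : R * 'rV[R]_N => t + clamp p.1)).
  by apply: (continuous_add _ (@continuous_clamp1)); exact: cst_continuous.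
apply: differentiable_continuous; apply/derivable1_diffP.
have /andP[? ?] := clamp_itv p.1.
have h : -3 < t + clamp p.1 by lra.
exact: (@ex_derive _ _ _ _ _ _ _ (primitive_derive cg h)).
Qed.

Lemma prim_diff g t th c e : continuous g -> -1 <= t ->
  (forall s, t - 1 <= s <= t -> `|g s - c| <= e) ->
  `|prim g t - prim g (t + clamp th) - c * - clamp th| <= e.
Proof.
move=> cg t1 gc; have /andP[h1 h2] := clamp_itv th.
have e0 : 0 <= e by rewrite (le_trans _ (gc t _))//; apply/andP; split; lra.
have tt : t + clamp th <= t by lra.
have := @derive_near_const _ (prim g) g (t + clamp th) t c e tt.
have -> : t - (t + clamp th) = - clamp th by ring.
have hd (s : R) : t + clamp th <= s <= t -> is_derive s (1 : R) (prim g) (g s).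
  by move=> /andP[s1 s2]; apply: primitive_derive => //; lra.
have hs s : t + clamp th <= s <= t -> `|g s - c| <= e.
  by move=> /andP[s1 s2]; apply: gc; apply/andP; split; lra.
move=> /(_ hd hs) H; apply: (le_trans H).
by rewrite -[leRHS]mulr1; apply: ler_wpM2l => //; lra.
Qed.

Lemma integrable_avg g B t : continuous g -> (forall s, `|g s| <= B) -> -1 <= t ->
  Q.-integrable slab
    (EFin \o (fun p => rate_inf p.1 * (prim g t - prim g (t + clamp p.1)))).
Proof.
move=> cg gB t1; have B0 : 0 <= B := le_trans (normr_ge0 _) (gB 0).
apply: (slab_integrable hQ hQ2 (c := K * B)).
  apply: continuous_measurable_prod; apply: continuous_mul; first exact: continuous_rate_inf.
  by apply: continuous_sub; [exact: cst_continuous|exact: continuous_prim_clamp].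
move=> p _; rewrite (le_trans _ (ler_weight _ _)) ?mulr_ge0// normrM ler_pM// ?rate_inf_norm//.
have := @prim_diff g t p.1 0 B cg t1; rewrite mul0r subr0; apply.
by move=> s _; rewrite subr0.
Qed.

(** [avg] is linear and sends the constant [c] to [(1 + Gamma) * c]; it sees [g] only up to a factor
    [1 + K] of its size on [[t - 1, t]], apart from the base point of the primitive, which
    cancels. *)
Lemma avg_close g B t c e : continuous g -> (forall s, `|g s| <= B) -> 0 <= t ->
  (forall s, t - 1 <= s <= t -> `|g s - c| <= e) ->
  `|avg g t - (1 + Gamma) * c| <= (1 + K) * e.
Proof.
move=> cg gB t0 gc; have t1 : -1 <= t by lra.
have e0 : 0 <= e by rewrite (le_trans _ (gc t _))//; apply/andP; split; lra.
have iavg := integrable_avg cg gB t1.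
have -> : avg g t - (1 + Gamma) * c = (g t - c) +
  (\int[Q]_(p in slab) (rate_inf p.1 * (prim g t - prim g (t + clamp p.1))) - c * Gamma).
  by rewrite /avg; ring.
rewrite mulrDl mul1r (le_trans (ler_normD _ _))// lerD//.
  by apply: gc; apply/andP; split; lra.
have iK : Q.-integrable slab (EFin \o (cst (K * e) : R * 'rV[R]_N -> R)).
  apply: (slab_integrable hQ hQ2 (c := K * e)); first exact: measurable_cst.
  by move=> p _; rewrite /= ger0_norm ?ler_weight ?mulr_ge0.
rewrite /Gamma -RintegralZl//; last exact: integrable_Gamma.
have icG : Q.-integrable slab (EFin \o (fun p => c * (rate_inf p.1 * - clamp p.1))).
  exact: (integrableZl ms c integrable_Gamma).
rewrite -RintegralB// -[leRHS](slab_integral_cst hQ).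
apply: Rintegral_dominated => //; first exact: integrable_sub.
move=> p _; have -> : rate_inf p.1 * (prim g t - prim g (t + clamp p.1)) -
    c * (rate_inf p.1 * - clamp p.1) =
    rate_inf p.1 * (prim g t - prim g (t + clamp p.1) - c * - clamp p.1) by ring.
by rewrite normrM ler_pM// ?rate_inf_norm// prim_diff.
Qed.

Lemma avg_sub g g' B t : continuous g -> (forall s, `|g s| <= B) ->
  continuous g' -> (forall s, `|g' s| <= B) -> 0 <= t ->
  avg g t - avg g' t = avg (fun s => g s - g' s) t.
Proof.
move=> cg gB cg' g'B t0; have t1 : -1 <= t by lra.
have pE s : -3 <= s -> prim (fun s => g s - g' s) s = prim g s - prim g' s.
  move=> s3; rewrite /prim /primitive RintegralB//.
    apply: continuous_compact_integrable; first exact: segment_compact.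
    exact: continuous_subspaceT.
  apply: continuous_compact_integrable; first exact: segment_compact.
  exact: continuous_subspaceT.
rewrite /avg opprD addrACA; congr (_ + _).
rewrite -RintegralB//; [|exact: integrable_avg gB t1|exact: integrable_avg g'B t1].
apply: eq_Rintegral => p _; have /andP[? ?] := clamp_itv p.1.
rewrite !pE; [ring|lra|lra].
Qed.

(** Since [avg] contains primitives, the integral differentiates to values of [g]: at the delayed
    times continuity of [g] is enough. The interchange is dominated by the constant
    [K * (2 * B)]. *)
Lemma avg_derive g dg B t : continuous g -> (forall s, `|g s| <= B) -> 0 < t ->
  is_derive t (1 : R) g dg ->
  is_derive t (1 : R) (avg g)
    (dg + \int[Q]_(p in slab) (rate_inf p.1 * (g t - g (t + clamp p.1)))).
Proof.
move=> cg gB t0 dgP; have B0 : 0 <= B := le_trans (normr_ge0 _) (gB 0).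
pose f (x : R) (p : R * 'rV[R]_N) := rate_inf p.1 * (prim g x - prim g (x + clamp p.1)).
have It : [set` `]0, t + 1[] t by rewrite /= in_itv/= t0/=; lra.
have df (x : R) p : 0 < x ->
    is_derive x (1 : R) (f ^~ p) (rate_inf p.1 * (g x - g (x + clamp p.1))).
  move=> x0; have /andP[h1 h2] := clamp_itv p.1.
  have d1 : is_derive x (1 : R) (prim g) (g x) by apply: primitive_derive => //; lra.
  have d2 : is_derive (x + clamp p.1) (1 : R) (prim g) (g (x + clamp p.1)).
    by apply: primitive_derive => //; lra.
  have d3 : is_derive x (1 : R) (+%R^~ (clamp p.1)) 1.
    rewrite -[X in is_derive _ _ _ X](addr0 (1 : R)).
    exact: (@is_deriveD R R R (@id R) (cst (clamp p.1)) x 1 1 0).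
  have d4 := @is_derive1_comp _ (prim g) (+%R^~ (clamp p.1)) x _ _ d2 d3.
  rewrite /f; apply: is_derive_eq; rewrite /GRing.scale/=; ring.
have intf x : [set` `]0, t + 1[] x -> Q.-integrable slab (EFin \o f x).
  by rewrite /= in_itv/= => /andP[x0 _]; apply: integrable_avg gB _ => //; lra.
have derf x p : [set` `]0, t + 1[] x -> (slab : set (R * 'rV[R]_N)) p -> derivable (f ^~ p) x 1.
  rewrite /= in_itv/= => /andP[x0 _] _.
  exact: (@ex_derive _ _ _ _ _ _ _ (df x p x0)).
have G0 p : 0 <= (cst (K * (2 * B)) : R * 'rV[R]_N -> R) p by rewrite /= !mulr_ge0.
have intG : Q.-integrable slab (EFin \o (cst (K * (2 * B)) : R * 'rV[R]_N -> R)).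
  apply: (slab_integrable hQ hQ2 (c := K * (2 * B))); first exact: measurable_cst.
  by move=> p _; rewrite /= ger0_norm ?ler_weight ?mulr_ge0.
have Gub x p : [set` `]0, t + 1[] x -> (slab : set (R * 'rV[R]_N)) p ->
    `|partial1of2 f x p| <= (cst (K * (2 * B)) : R * 'rV[R]_N -> R) p.
  rewrite /= in_itv/= => /andP[x0 _] _; rewrite partial1of2E.
  rewrite (@derive_val _ _ _ _ _ _ _ (df x p x0)) normrM ler_pM// ?rate_inf_norm//.
  by rewrite (le_trans (ler_normB _ _))// mulr_natl mulr2n lerD.
have D1 := derivable_under_integral ms It intf derf G0 intG Gub.
have D2 := differentiation_under_integral ms It intf derf G0 intG Gub.
have D3 : is_derive t (1 : R) (fun x => \int[Q]_(p in slab) f x p)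
    (\int[Q]_(p in slab) (rate_inf p.1 * (g t - g (t + clamp p.1)))).
  split; first exact: D1.
  rewrite -derive1E D2; apply: eq_Rintegral => p _ /=; rewrite partial1of2E.
  exact: (@derive_val _ _ _ _ _ _ _ (df t p t0)).
exact: is_deriveD.
Qed.

Lemma mean_taylor (P : probability 'rV[R]_N R) (f1 f2 : 'rV[R]_N -> R)
    (g : 'I_N -> 'rV[R]_N -> R) (c : 'I_N -> R) (e : R) :
  Cb f1 -> Cb f2 -> (forall i, Cb (g i)) ->
  (forall x, `|f1 x - f2 x - \sum_i c i * g i x| <= e) ->
  `|\int[P]_x f1 x - \int[P]_x f2 x - \sum_i c i * \int[P]_x g i x| <= e.
Proof.
move=> C1 C2 Cg fe.
have i1 := Cb_integrable P C1; have i2 := Cb_integrable P C2.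
have ig i : P.-integrable setT (EFin \o (fun x => c i * g i x)).
  exact: integrable_scale (Cb_integrable P (Cg i)).
have is_ : P.-integrable setT (EFin \o (fun x => \sum_i c i * g i x)).
  exact: integrable_sumr.
have -> : \sum_i c i * \int[P]_x g i x = \int[P]_x \sum_i c i * g i x.
  rewrite Rintegral_sumr//; apply: eq_bigr => i _; rewrite RintegralZl//.
  exact: Cb_integrable.
rewrite -RintegralB// -RintegralB//; last exact: integrable_sub.
rewrite -[leRHS](mean_cst P); apply: Rintegral_dominated => //.
  by apply: integrable_sub => //; exact: integrable_sub.
by apply: Cb_integrable; split; [exact: cst_continuous|exists `|e| => x /=; exact: lexx].
Qed.

(** * Rescaled test functions and the drift *)

Section scaled.
Variables (phi : 'rV[R]_N -> R) (phi_ : 'I_N -> 'rV[R]_N -> R) (L lam : R).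
Hypothesis L_ge0 : 0 <= L.
Hypothesis phi_lip : bounded_lip phi L L.
Hypothesis dphi_lip : forall i, bounded_lip (phi_ i) L L.
Hypothesis phi_taylor : forall x h,
  `|phi (x + h) - phi x - \sum_i h ord0 i * phi_ i x| <= L * `|h| ^+ 2.
Hypothesis lam_ge1 : 1 <= lam.

Let lam_gt0 : 0 < lam. Proof. exact: lt_le_trans ltr01 lam_ge1. Qed.
Let li0 : 0 <= lam^-1. Proof. by rewrite invr_ge0 ltW. Qed.
Let li1 : lam^-1 <= 1. Proof. by rewrite invf_le1. Qed.

Definition zoom f (h x : 'rV[R]_N) := f (lam^-1 *: (x + h)).

Lemma zoom_shift f h w x : zoom f (h + w) x = zoom f h (x + w).
Proof. by rewrite /zoom addrA [x + h + w]addrAC. Qed.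

Lemma zoom_lip f h B l : bounded_lip f B l -> bounded_lip (zoom f h) B (l / lam).
Proof.
move=> [fB fl]; split=> [x|x y]; first exact: fB.
rewrite (le_trans (fl _ _))// -scalerBr normrZ (ger0_norm li0) mulrA.
by rewrite opprD addrACA subrr addr0.
Qed.

Lemma zoom_Cb f h B l : bounded_lip f B l -> Cb (zoom f h).
Proof. by move=> bf; exact: bounded_lip_Cb (zoom_lip h bf). Qed.

Lemma zoom_taylor h x z :
  `|zoom phi h (x + z) - zoom phi h x - \sum_i (lam^-1 * z ord0 i) * zoom (phi_ i) h x| <=
  L * lam ^- 2 * `|z| ^+ 2.
Proof.
have := phi_taylor (lam^-1 *: (x + h)) (lam^-1 *: z).
rewrite -scalerDr -[x + h + z]addrAC normrZ (ger0_norm li0) exprMn mulrA exprVn.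
congr (`|_ - _| <= _).
by apply: eq_bigr => i _; rewrite !mxE.
Qed.

Let rho := 1 - q.
Let rho0 : 0 <= rho. Proof. by rewrite subr_ge0 ltW. Qed.

(** The three sources of error at step [k]: the second order in space, the memory of the initial
    datum, and the distance of the rates to their limit. *)
Definition err (k : nat) := lam ^- 2 + (1 - q) ^+ k + expR (- (beta * k%:R)).

Let lam2 : 0 <= lam ^- 2. Proof. by rewrite invr_ge0 exprn_ge0// ltW. Qed.

Lemma err_ge0 k : 0 <= err k.
Proof. by rewrite /err !addr_ge0// ?expR_ge0 ?exprn_ge0. Qed.

Lemma err_ge_lam k : lam ^- 2 <= err k.
Proof. by rewrite /err -addrA lerDl addr_ge0 ?expR_ge0 ?exprn_ge0. Qed.

Lemma err_ge_rho k : (1 - q) ^+ k <= err k.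
Proof. by rewrite /err -addrA addrCA lerDl addr_ge0 ?expR_ge0. Qed.

Lemma err_ge_exp k : expR (- (beta * k%:R)) <= err k.
Proof. by rewrite /err lerDr addr_ge0 ?exprn_ge0. Qed.

Definition grad_cst := 2 * L + osc_cst * L.

Lemma grad_cst_ge0 : 0 <= grad_cst.
Proof. by rewrite addr_ge0 ?mulr_ge0// osc_cst_ge0. Qed.

(** The factor [lam^-1] comes from a gradient. It meets an oscillation of order [lam^-1] and so
    gives [lam ^- 2]; on the transient part, which has no power of [lam] to offer, it is merely
    bounded by 1. *)
Lemma zoom_osc f h k s : bounded_lip f L L -> k%:R <= s <= k%:R + 2 ->
  lam^-1 * `|obs (zoom f h) s - obs (zoom f h) k.+1%:R| <= grad_cst * err k.
Proof.
move=> bf ks; have Ll : 0 <= L / lam by rewrite divr_ge0// ltW.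
have H := obs_near (zoom_lip h bf) Ll ks.
have rk : 0 <= (1 - q) ^+ k by rewrite exprn_ge0.
apply: (le_trans (ler_wpM2l li0 H)); rewrite mulrDr /grad_cst [leRHS]mulrDl; apply: lerD.
  apply: (@le_trans _ _ (1 * ((1 - q) ^+ k * (2 * L)))).
    by rewrite ler_wpM2r// !mulr_ge0.
  by rewrite mul1r mulrC ler_wpM2l ?mulr_ge0// err_ge_rho.
have -> : lam^-1 * (osc_cst * (L / lam)) = osc_cst * L * lam ^- 2.
  by field; rewrite gt_eqF.
by rewrite ler_wpM2l ?err_ge_lam// mulr_ge0// osc_cst_ge0.
Qed.

Definition drift_rate (i : 'I_N) := \int[Q]_(p in slab) (rate_inf p.1 * p.2 ord0 i).

Let integrable_drift_rate i :
  Q.-integrable slab (EFin \o (fun p => rate_inf p.1 * p.2 ord0 i)).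
Proof.
apply: (slab_integrable hQ hQ2 (c := K)).
  apply: continuous_measurable_prod; apply: continuous_mul; first exact: continuous_rate_inf.
  exact: continuous_fcomp (@continuous_coord R N i) (@continuous_snd _ _).
move=> p _; rewrite normrM ler_pM// ?rate_inf_norm//.
exact: le_trans (coord_le_norm _ _) (weight_ge_norm _).
Qed.

Definition time_cst := 2 * L * M + K * L + K * (N%:R * grad_cst).

(** After the cancellation built into [avg], the shifted and unshifted test functions are compared
    at the same time [t + clamp p.1]. The three terms of [time_cst] are, in order, the replacement
    of the rate by its limit, the Taylor remainder of the jump, and the freezing of the first order
    coefficients at time [k.+1%:R]. *)
Lemma time_step_pointwise h k t p : k.+1%:R <= t <= k.+1%:R + 1 ->
  `|rate t p.1 * (delayed (zoom phi h) t p - obs (zoom phi h) t)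
    + rate_inf p.1 * (obs (zoom phi h) t - obs (zoom phi h) (t + clamp p.1))
    - \sum_i (lam^-1 * obs (zoom (phi_ i) h) k.+1%:R) * (rate_inf p.1 * p.2 ord0 i)|
  <= time_cst * err k * weight p.
Proof.
move=> /andP[kt tk]; set g := obs (zoom phi h).
have k1 : k.+1%:R = k%:R + 1 :> R by rewrite -natr1.
have k0 : 0 <= k%:R :> R by [].
have t0 : 0 <= t by lra.
have /andP[c1 c2] := clamp_itv p.1.
have W1 := weight_ge1 p; have W0 : 0 <= weight p := le_trans ler01 W1.
set s := t + clamp p.1.
pose D i := obs (zoom (phi_ i) h) k.+1%:R.
pose g_ i := obs (zoom (phi_ i) h) s.
pose T := delayed (zoom phi h) t p.
have -> : rate t p.1 * (delayed (zoom phi h) t p - g t) + rate_inf p.1 * (g t - g s) -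
    \sum_i (lam^-1 * obs (zoom (phi_ i) h) k.+1%:R) * (rate_inf p.1 * p.2 ord0 i) =
  (rate t p.1 - rate_inf p.1) * (T - g t) +
  rate_inf p.1 * (T - g s - \sum_i (lam^-1 * p.2 ord0 i) * g_ i) +
  rate_inf p.1 * (\sum_i (lam^-1 * p.2 ord0 i) * (g_ i - D i)).
  have -> : \sum_i (lam^-1 * p.2 ord0 i) * (g_ i - D i) =
     \sum_i (lam^-1 * p.2 ord0 i) * g_ i - \sum_i (lam^-1 * p.2 ord0 i) * D i.
    by rewrite -sumrB; apply: eq_bigr => i _; rewrite mulrBr.
  have -> : \sum_i (lam^-1 * obs (zoom (phi_ i) h) k.+1%:R) * (rate_inf p.1 * p.2 ord0 i) =
     rate_inf p.1 * \sum_i (lam^-1 * p.2 ord0 i) * D i.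
    by rewrite mulr_sumr; apply: eq_bigr => i _; rewrite /D; ring.
  by rewrite -/T; ring.
have b1 : `|(rate t p.1 - rate_inf p.1) * (T - g t)| <= 2 * L * M * err k * weight p.
  apply: (@le_trans _ _ (2 * L * M * err k)); last first.
    by rewrite ler_weight// !mulr_ge0 ?err_ge0// ltW.
  rewrite normrM mulrC -[2 * L * M * err k]mulrA; apply: ler_pM => //.
    rewrite (le_trans (ler_normB _ _))// mulr_natl mulr2n lerD//.
      exact: delayed_bound (zoom_lip h phi_lip).
    exact: obs_bound (zoom_lip h phi_lip).
  rewrite (le_trans (rate_close p.1 t0))// ler_wpM2l ?(ltW M_gt0)//.
  rewrite (le_trans _ (err_ge_exp k))// ler_expR lerN2 ler_pM2l//; lra.
have b2 : `|rate_inf p.1 * (T - g s - \sum_i (lam^-1 * p.2 ord0 i) * g_ i)| <=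
    K * L * err k * weight p.
  rewrite normrM -!mulrA; apply: ler_pM => //; first exact: rate_inf_norm.
  apply: (@le_trans _ _ (L * lam ^- 2 * `|p.2| ^+ 2)).
    apply: mean_taylor => [|||x].
    - exact: bounded_lip_Cb (bounded_lip_shift _ (zoom_lip h phi_lip)).
    - exact: zoom_Cb phi_lip.
    - by move=> i; exact: zoom_Cb (dphi_lip i).
    - exact: zoom_taylor.
  rewrite -mulrA ler_wpM2l// ler_pM// ?sqr_ge0//; first exact: err_ge_lam.
  exact: weight_ge_sqr.
have b3 : `|rate_inf p.1 * (\sum_i (lam^-1 * p.2 ord0 i) * (g_ i - D i))| <=
    K * (N%:R * grad_cst) * err k * weight p.
  rewrite normrM -!mulrA; apply: ler_pM => //; first exact: rate_inf_norm.
  rewrite (le_trans (ler_norm_sum _ _ _))//.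
  have -> : N%:R * (grad_cst * (err k * weight p)) = \sum_(i < N) grad_cst * err k * weight p.
    by rewrite sumr_const card_ord -mulr_natl; ring.
  apply: ler_sum => i _; rewrite !normrM (ger0_norm li0) mulrAC.
  apply: ler_pM => //; first by rewrite mulr_ge0.
    apply: zoom_osc; first exact: dphi_lip.
    by rewrite /s; apply/andP; split; lra.
  exact: le_trans (coord_le_norm _ _) (weight_ge_norm _).
have -> : time_cst * err k * weight p = 2 * L * M * err k * weight p +
    K * L * err k * weight p + K * (N%:R * grad_cst) * err k * weight p by rewrite /time_cst; ring.
apply: (le_trans (ler_normD _ _)); apply: lerD => //.
by apply: (le_trans (ler_normD _ _)); apply: lerD.
Qed.

Let integrable_rate_inf_mul g B t : continuous g -> (forall s, `|g s| <= B) ->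
  Q.-integrable slab (EFin \o (fun p => rate_inf p.1 * (g t - g (t + clamp p.1)))).
Proof.
move=> cg gB; have B0 : 0 <= B := le_trans (normr_ge0 _) (gB 0).
apply: (slab_integrable hQ hQ2 (c := K * (2 * B))).
  apply: continuous_measurable_prod; apply: continuous_mul; first exact: continuous_rate_inf.
  apply: continuous_sub; first exact: cst_continuous.
  apply: continuous_fcomp; first exact: cg.
  by apply: continuous_add; [exact: cst_continuous|exact: continuous_clamp1].
move=> p _; rewrite (le_trans _ (ler_weight _ _)) ?mulr_ge0// normrM ler_pM// ?rate_inf_norm//.
by rewrite (le_trans (ler_normB _ _))// mulr_natl mulr2n lerD.
Qed.

Lemma avg_time_step h k :
  `|avg (obs (zoom phi h)) k.+2%:R - avg (obs (zoom phi h)) k.+1%:R -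
    \sum_i lam^-1 * obs (zoom (phi_ i) h) k.+1%:R * drift_rate i| <= time_cst * m * err k.
Proof.
set g := obs (zoom phi h); pose D i := lam^-1 * obs (zoom (phi_ i) h) k.+1%:R.
have cg : continuous g by apply: continuous_obs; exact: zoom_Cb phi_lip.
have gL s : `|g s| <= L by exact: obs_bound (zoom_lip h phi_lip).
pose dg t := jump_rate (zoom phi h) t +
    \int[Q]_(p in slab) (rate_inf p.1 * (g t - g (t + clamp p.1))).
have k0 : 0 <= k%:R :> R by [].
have k1 : k.+1%:R = k%:R + 1 :> R by rewrite -natr1.
have k2 : k.+2%:R = k%:R + 2 :> R by rewrite -!natr1; ring.
have hd (t : R) : k.+1%:R <= t <= k.+2%:R -> is_derive t (1 : R) (avg g) (dg t).
  move=> /andP[kt tk]; have t0 : 0 < t by lra.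
  exact: (avg_derive cg gL t0 (delay_derive (zoom_lip h phi_lip) t0)).
have hs t : k.+1%:R <= t <= k.+2%:R -> `|dg t - \sum_i D i * drift_rate i| <= time_cst * m * err k.
  move=> /andP[kt tk].
  have i1 : Q.-integrable slab (EFin \o (fun p => rate t p.1 * (delayed (zoom phi h) t p - g t))).
    have := integrable_sub ms (integrable_rate_delayed t (zoom_lip h phi_lip))
      (integrableZl ms (g t) (integrable_rate t)).
    apply: eq_integrable => // p _ /=; congr EFin.
    by rewrite mulrBr [g t * _]mulrC.
  have i2 := integrable_rate_inf_mul t cg gL.
  have i3 i : Q.-integrable slab (EFin \o (fun p => D i * (rate_inf p.1 * p.2 ord0 i))).
    exact: (integrableZl ms (D i) (integrable_drift_rate i)).
  have -> : \sum_i D i * drift_rate i =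
      \int[Q]_(p in slab) (\sum_i D i * (rate_inf p.1 * p.2 ord0 i)).
    rewrite Rintegral_sumr//; apply: eq_bigr => i _.
    by rewrite RintegralZl//; exact: integrable_drift_rate.
  have i4 := integrable_sumr ms (index_enum 'I_N) i3.
  have i12 := integrable_add ms i1 i2.
  rewrite /dg /jump_rate -RintegralD// -RintegralB//.
  rewrite -mulrA [m * _]mulrC mulrA /moment -RintegralZl//; last exact: integrable_weight.
  apply: Rintegral_dominated => //.
  - exact: integrable_sub.
  - exact: (integrableZl ms (time_cst * err k) (integrable_weight hQ hQ2)).
  - by move=> p _; apply: time_step_pointwise; rewrite kt; lra.
have kk : k.+1%:R <= k.+2%:R :> R by rewrite ler_nat.
have := derive_near_const kk hd hs.
have -> : k.+2%:R - k.+1%:R = 1 :> R by rewrite k1 k2; ring.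
by rewrite !mulr1.
Qed.

Definition shift_cst (W : R) := L * W ^+ 2 + N%:R * (W * grad_cst) + N%:R * (W * L).

(** By additivity of [avg] it suffices to study the difference of the two observables. On the last
    unit of time it is nearly the constant given by the first order term in [v], and [avg_close]
    contributes the factor [1 + Gamma]. *)
Lemma avg_shift_step (h w : 'rV[R]_N) (v : 'I_N -> R) (W : R) k : 0 <= W -> `|w| <= W ->
  (forall i, `|w ord0 i - v i| <= W * expR (- (beta * k%:R))) ->
  `|avg (obs (zoom phi (h + w))) k.+2%:R - avg (obs (zoom phi h)) k.+2%:R -
    (1 + Gamma) * \sum_i lam^-1 * obs (zoom (phi_ i) h) k.+1%:R * v i| <=
  (1 + K) * (shift_cst W * err k).
Proof.
move=> CH0 wC wv.
have cg h' : continuous (obs (zoom phi h')) by apply: continuous_obs; exact: zoom_Cb phi_lip.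
have gL h' s : `|obs (zoom phi h') s| <= L by exact: obs_bound (zoom_lip h' phi_lip).
have k0 : 0 <= k%:R :> R by [].
have k2 : k.+2%:R = k%:R + 2 :> R by rewrite -!natr1; ring.
have k20 : 0 <= k.+2%:R :> R by [].
rewrite (avg_sub (cg _) (gL _) (cg _) (gL _) k20).
have cd : continuous (fun s => obs (zoom phi (h + w)) s - obs (zoom phi h) s).
  exact: continuous_sub.
have dL s : `|obs (zoom phi (h + w)) s - obs (zoom phi h) s| <= 2 * L.
  by rewrite (le_trans (ler_normB _ _))// mulr_natl mulr2n lerD.
apply: (avg_close cd dL k20) => s /andP[ks sk].
pose g_ i := obs (zoom (phi_ i) h) s; pose D i := obs (zoom (phi_ i) h) k.+1%:R.
have -> : obs (zoom phi (h + w)) s - obs (zoom phi h) s - \sum_i lam^-1 * D i * v i =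
   (obs (zoom phi (h + w)) s - obs (zoom phi h) s - \sum_i (lam^-1 * w ord0 i) * g_ i) +
   (\sum_i (lam^-1 * w ord0 i) * (g_ i - D i) + \sum_i lam^-1 * (w ord0 i - v i) * D i).
  have -> : \sum_i (lam^-1 * w ord0 i) * (g_ i - D i) + \sum_i lam^-1 * (w ord0 i - v i) * D i
    = \sum_i (lam^-1 * w ord0 i) * g_ i - \sum_i lam^-1 * D i * v i.
    by rewrite -sumrB -big_split/=; apply: eq_bigr => i _; ring.
  by ring.
have E0 := err_ge0 k.
have b1 : `|obs (zoom phi (h + w)) s - obs (zoom phi h) s - \sum_i (lam^-1 * w ord0 i) * g_ i| <=
    L * W ^+ 2 * err k.
  apply: (@le_trans _ _ (L * lam ^- 2 * `|w| ^+ 2)).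
    apply: mean_taylor => [|||x].
    - exact: zoom_Cb phi_lip.
    - exact: zoom_Cb phi_lip.
    - by move=> i; exact: zoom_Cb (dphi_lip i).
    - by rewrite zoom_shift; exact: zoom_taylor.
  rewrite mulrAC; apply: ler_pM => //.
  - by rewrite mulr_ge0// sqr_ge0.
  - by rewrite ler_wpM2l// lerXn2r ?nnegrE.
  - exact: err_ge_lam.
have b2 : `|\sum_i (lam^-1 * w ord0 i) * (g_ i - D i)| <= N%:R * (W * grad_cst) * err k.
  rewrite (le_trans (ler_norm_sum _ _ _))//.
  have -> : N%:R * (W * grad_cst) * err k = \sum_(i < N) W * (grad_cst * err k).
    by rewrite sumr_const card_ord -mulr_natl; ring.
  apply: ler_sum => i _; rewrite !normrM (ger0_norm li0) [lam^-1 * _]mulrC -mulrA.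
  apply: ler_pM => //; first by rewrite mulr_ge0.
    exact: le_trans (coord_le_norm _ _) wC.
  apply: zoom_osc; first exact: dphi_lip.
  by apply/andP; split; lra.
have b3 : `|\sum_i lam^-1 * (w ord0 i - v i) * D i| <= N%:R * (W * L) * err k.
  rewrite (le_trans (ler_norm_sum _ _ _))//.
  have -> : N%:R * (W * L) * err k = \sum_(i < N) W * err k * L.
    by rewrite sumr_const card_ord -mulr_natl; ring.
  apply: ler_sum => i _; rewrite !normrM (ger0_norm li0).
  apply: ler_pM => //; first by rewrite mulr_ge0.
    rewrite -[leRHS]mul1r; apply: ler_pM => //.
    by rewrite (le_trans (wv i))// ler_wpM2l// err_ge_exp.
  exact: obs_bound (zoom_lip h (dphi_lip i)).
have -> : shift_cst W * err k = L * W ^+ 2 * err k +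
    (N%:R * (W * grad_cst) * err k + N%:R * (W * L) * err k) by rewrite /shift_cst; ring.
apply: (le_trans (ler_normD _ _)); apply: lerD => //.
by apply: (le_trans (ler_normD _ _)); apply: lerD.
Qed.

Local Notation H := (drift alpha alpha_inf Q).

Lemma Gamma_constE : Gamma_const alpha_inf Q = Gamma.
Proof.
apply: eq_Rintegral => p; rewrite inE => sp.
by rewrite /rate_inf slab_clamp// mulrC.
Qed.

Definition mean_jump i t := \int[Q]_(p in slab) (rate t p.1 * p.2 ord0 i).

Let integrable_mean_jump i t :
  Q.-integrable slab (EFin \o (fun p => rate t p.1 * p.2 ord0 i)).
Proof.
apply: (slab_integrable hQ hQ2 (c := K)).
  apply: continuous_measurable_prod; apply: continuous_mul; first exact: continuous_rate.
  exact: continuous_fcomp (@continuous_coord R N i) (@continuous_snd _ _).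
move=> p _; rewrite normrM ler_pM// ?rate_norm//.
exact: le_trans (coord_le_norm _ _) (weight_ge_norm _).
Qed.

(** Makes the drift, a primitive of this function up to a factor, differentiable. *)
Lemma continuous_mean_jump i : continuous (mean_jump i).
Proof.
move=> t.
have intf x : [set` `]t - 1, t + 1[] x ->
    Q.-integrable slab (EFin \o (fun p => rate x p.1 * p.2 ord0 i)).
  by move=> _; exact: integrable_mean_jump.
have cf : {ae Q, forall p : R * 'rV[R]_N, slab p ->
    {in [set` `]t - 1, t + 1[], continuous (fun x => rate x p.1 * p.2 ord0 i)}}.
  apply: aeW => p _ x _; apply: (@cvgMr_tmp _ _ (nbhs x)).
  exact: continuous_ratel.
have iw : Q.-integrable slab (EFin \o (fun p => K * weight p)).
  exact: (integrableZl ms K (integrable_weight hQ hQ2)).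
have ub x : [set` `]t - 1, t + 1[] x -> {ae Q, forall p : R * 'rV[R]_N, slab p ->
    `|rate x p.1 * p.2 ord0 i| <= K * weight p}.
  move=> _; apply: aeW => p _; rewrite normrM ler_pM// ?rate_norm//.
  exact: le_trans (coord_le_norm _ _) (weight_ge_norm _).
apply: (continuity_under_integral ms intf cf iw ub).
by rewrite inE/= in_itv/=; apply/andP; split; lra.
Qed.

Lemma mean_jump_bound i t : `|mean_jump i t| <= K * m.
Proof.
apply: (slab_integral_le hQ hQ2).
  apply: continuous_measurable_prod; apply: continuous_mul; first exact: continuous_rate.
  exact: continuous_fcomp (@continuous_coord R N i) (@continuous_snd _ _).
move=> p _; rewrite normrM ler_pM// ?rate_norm//.
exact: le_trans (coord_le_norm _ _) (weight_ge_norm _).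
Qed.

Lemma mean_jump_close i t : 0 <= t ->
  `|mean_jump i t - drift_rate i| <= M * expR (- (beta * t)) * m.
Proof.
move=> t0; have i1 := integrable_mean_jump i t; have i2 := integrable_drift_rate i.
rewrite /mean_jump /drift_rate -RintegralB//.
apply: (slab_integral_le hQ hQ2).
  have cz := continuous_fcomp (@continuous_coord R N i) (@continuous_snd R _).
  apply: continuous_measurable_prod; apply: continuous_sub; apply: continuous_mul => //.
    exact: continuous_rate.
  exact: continuous_rate_inf.
move=> p _; rewrite -mulrBl normrM ler_pM// ?rate_close//.
exact: le_trans (coord_le_norm _ _) (weight_ge_norm _).
Qed.

Lemma row_subE (a b : 'rV[R]_N) i : (a - b) ord0 i = a ord0 i - b ord0 i.
Proof. by rewrite !mxE. Qed.

Lemma driftE t i : H t ord0 i = - (1 + Gamma)^-1 * primitive 0 (mean_jump i) t.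
Proof.
have E : \int[lebesgue_measure]_(s in `[0, t])
      (\int[Q]_(p in slab) (alpha s p.1 * p.2 ord0 i)) = primitive 0 (mean_jump i) t.
  apply: eq_Rintegral => s; rewrite inE/= in_itv/= => /andP[s0 _].
  have sm : Num.max s 0 = s by apply/max_idPl.
  apply: eq_Rintegral => p; rewrite inE => sp.
  by rewrite /rate sm slab_clamp.
by rewrite mxE Gamma_constE E.
Qed.

(** The limit of the derivative of the drift at large times. *)
Definition velocity i := - (1 + Gamma)^-1 * drift_rate i.

Let Gi : 0 <= (1 + Gamma)^-1 <= 1.
Proof.
have /andP[G0 _] := Gamma_bd; have G1 : 0 < 1 + Gamma by rewrite ltr_wpDr.
by rewrite invr_ge0 (ltW G1) invf_le1// lerDl.
Qed.

Lemma drift_increment s t i : 0 < s -> s <= t ->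
  `|H t ord0 i - H s ord0 i - velocity i * (t - s)| <= M * m * expR (- (beta * s)) * (t - s).
Proof.
move=> s0 st; have /andP[G0 G1] := Gi.
have hd (x : R) : s <= x <= t ->
    is_derive x (1 : R) (primitive 0 (mean_jump i)) (mean_jump i x).
  move=> /andP[sx _]; apply: primitive_derive; first exact: continuous_mean_jump.
  exact: lt_le_trans sx.
have hs x : s <= x <= t -> `|mean_jump i x - drift_rate i| <= M * m * expR (- (beta * s)).
  move=> /andP[sx _]; have x0 : 0 <= x by rewrite (le_trans (ltW s0)).
  rewrite (le_trans (mean_jump_close i x0))// mulrAC ler_wpM2l//.
    by rewrite mulr_ge0// ltW.
  by rewrite ler_expR lerN2 ler_pM2l.
have D := derive_near_const st hd hs.
rewrite !driftE /velocity.
have -> : - (1 + Gamma)^-1 * primitive 0 (mean_jump i) t -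
    - (1 + Gamma)^-1 * primitive 0 (mean_jump i) s - - (1 + Gamma)^-1 * drift_rate i * (t - s) =
  - ((1 + Gamma)^-1 * (primitive 0 (mean_jump i) t - primitive 0 (mean_jump i) s -
       drift_rate i * (t - s))) by ring.
rewrite normrN normrM (ger0_norm G0) -[leRHS]mul1r; exact: ler_pM.
Qed.

Lemma drift_lip s t : 0 < s -> s <= t -> `|H t - H s| <= K * m * (t - s).
Proof.
move=> s0 st; have /andP[G0 G1] := Gi.
apply: row_norm_le => [|i]; first by rewrite !mulr_ge0// subr_ge0.
have hd (x : R) : s <= x <= t ->
    is_derive x (1 : R) (primitive 0 (mean_jump i)) (mean_jump i x).
  move=> /andP[sx _]; apply: primitive_derive; first exact: continuous_mean_jump.
  exact: lt_le_trans sx.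
have hs x : s <= x <= t -> `|mean_jump i x - 0| <= K * m.
  by move=> _; rewrite subr0; exact: mean_jump_bound.
have := derive_near_const st hd hs; rewrite mul0r subr0 => D.
have -> : (H t - H s) ord0 i =
  - ((1 + Gamma)^-1 * (primitive 0 (mean_jump i) t - primitive 0 (mean_jump i) s)).
  by rewrite row_subE !driftE; ring.
rewrite normrN normrM (ger0_norm G0) -[leRHS]mul1r; exact: ler_pM.
Qed.

Definition drift_cst := K * m + M * m.
Definition step_cst := time_cst * m + (1 + K) * shift_cst drift_cst.

(** The drift is constant during each unit of time and changed between two steps, so that the delay
    equation is only used with a fixed test function. Starting from [k.+1%:R] leaves room for the
    delays: the times involved stay above [k%:R], where [obs_near] applies. *)
Definition frozen_avg k := avg (obs (zoom phi (H k.+1%:R))) k.+1%:R.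

Lemma frozen_avg_step k : `|frozen_avg k.+1 - frozen_avg k| <= step_cst * err k.
Proof.
have k0 : 0 <= k%:R :> R by [].
have k1 : k.+1%:R = k%:R + 1 :> R by rewrite -natr1.
have k2 : k.+2%:R = k%:R + 2 :> R by rewrite -!natr1; ring.
have k10 : 0 < k.+1%:R :> R by [].
have k12 : k.+1%:R <= k.+2%:R :> R by rewrite ler_nat.
have d1 : k.+2%:R - k.+1%:R = 1 :> R by rewrite k1 k2; ring.
pose h := H k.+1%:R; pose w := H k.+2%:R - H k.+1%:R.
have CH0 : 0 <= drift_cst by rewrite addr_ge0// mulr_ge0// ltW.
have wC : `|w| <= drift_cst.
  rewrite (le_trans (drift_lip k10 k12))// d1 mulr1 lerDl mulr_ge0// ltW//.
have wv i : `|w ord0 i - velocity i| <= drift_cst * expR (- (beta * k%:R)).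
  have := drift_increment i k10 k12; rewrite d1 !mulr1.
  have -> : H k.+2%:R ord0 i - H k.+1%:R ord0 i - velocity i = w ord0 i - velocity i.
    by rewrite /w row_subE.
  move=> D; rewrite (le_trans D)// ler_pM ?expR_ge0//.
  - by rewrite mulr_ge0// ltW.
  - by rewrite lerDr mulr_ge0.
  - by rewrite ler_expR lerN2 ler_pM2l// ler_nat.
have /andP[G0 _] := Gamma_bd.
have G1 : 1 + Gamma != 0 by rewrite gt_eqF// ltr_wpDr.
have l1 : lam != 0 by rewrite gt_eqF.
(* [S] is the first order effect of a unit of time with the drift frozen, [(1 + Gamma) * S'] that of
   the subsequent change of drift. *)
pose S := \sum_i lam^-1 * obs (zoom (phi_ i) h) k.+1%:R * drift_rate i.
pose S' := \sum_i lam^-1 * obs (zoom (phi_ i) h) k.+1%:R * velocity i.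
have S0 : (1 + Gamma) * S' = - S.
  rewrite /S /S' mulr_sumr -sumrN; apply: eq_bigr => i _; rewrite /velocity; field.
  by rewrite l1 G1.
have A : `|avg (obs (zoom phi h)) k.+2%:R - avg (obs (zoom phi h)) k.+1%:R - S| <=
   time_cst * m * err k := avg_time_step h k.
have B : `|avg (obs (zoom phi (h + w))) k.+2%:R - avg (obs (zoom phi h)) k.+2%:R - (1 + Gamma) * S'| <=
   (1 + K) * (shift_cst drift_cst * err k) := avg_shift_step h CH0 wC wv.
have hw : h + w = H k.+2%:R by rewrite /w addrC subrK.
rewrite S0 hw in B.
have split_id (a b c d : R) : a - c = (a - b - - d) + (b - c - d) by ring.
rewrite (split_id _ (avg (obs (zoom phi h)) k.+2%:R) _ S).
have -> : step_cst * err k = (1 + K) * (shift_cst drift_cst * err k) + time_cst * m * err k.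
  by rewrite /step_cst; ring.
by rewrite (le_trans (ler_normD _ _))// lerD.
Qed.

(** At [t = lam ^+ 2 * tau] this is the integral of [phi] against [p lam tau]. *)
Definition position t := obs (zoom phi (H t)) t.

Definition near_cst := (1 + K) * (2 * grad_cst + L * (K * m)).

(** This comparison is made only at the two ends of the sum over the steps, so an error of order
    [lam^-1] is affordable here. *)
Lemma frozen_avg_near k t : k.+1%:R <= t <= k.+2%:R ->
  `|frozen_avg k - (1 + Gamma) * position t| <= near_cst * (lam^-1 + (1 - q) ^+ k).
Proof.
move=> /andP[kt tk]; have /andP[G0 GK] := Gamma_bd.
have k0 : 0 <= k%:R :> R by [].
have k1 : k.+1%:R = k%:R + 1 :> R by rewrite -natr1.
have k2 : k.+2%:R = k%:R + 2 :> R by rewrite -!natr1; ring.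
have k10 : 0 < k.+1%:R :> R by [].
pose h := H k.+1%:R; pose e := lam^-1 + (1 - q) ^+ k.
have rk : 0 <= (1 - q) ^+ k by rewrite exprn_ge0.
have Ll : 0 <= L / lam by rewrite divr_ge0// ltW.
have osc s : k%:R <= s <= k%:R + 2 ->
    `|obs (zoom phi h) s - obs (zoom phi h) k.+1%:R| <= grad_cst * e.
  move=> ks; rewrite (le_trans (obs_near (zoom_lip h phi_lip) Ll ks))//.
  have := osc_cst_ge0; rewrite /grad_cst /e => o0.
  have h1 : 0 <= 2 * L * lam^-1 by rewrite !mulr_ge0.
  have h2 : 0 <= osc_cst * L * (1 - q) ^+ k by rewrite !mulr_ge0.
  rewrite -subr_ge0.
  have -> : (2 * L + osc_cst * L) * (lam^-1 + (1 - q) ^+ k) -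
     ((1 - q) ^+ k * (2 * L) + osc_cst * (L / lam)) =
     2 * L * lam^-1 + osc_cst * L * (1 - q) ^+ k by ring.
  exact: addr_ge0.
have cg : continuous (obs (zoom phi h)) by apply: continuous_obs; exact: zoom_Cb phi_lip.
have gL s : `|obs (zoom phi h) s| <= L by exact: obs_bound (zoom_lip h phi_lip).
have h1 : `|frozen_avg k - (1 + Gamma) * obs (zoom phi h) k.+1%:R| <= (1 + K) * (grad_cst * e).
  apply: (avg_close cg gL (ltW k10)) => s /andP[s1 s2]; apply: osc.
  by apply/andP; split; lra.
have h2 : `|obs (zoom phi h) t - obs (zoom phi h) k.+1%:R| <= grad_cst * e.
  by apply: osc; apply/andP; split; lra.
have h3 : `|position t - obs (zoom phi h) t| <= L * (K * m) * e.
  have -> : L * (K * m) * e = L / lam * (K * m) + L * (K * m) * (1 - q) ^+ k.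
    by rewrite /e; ring.
  rewrite ler_wpDr ?mulr_ge0//.
  apply: obs_close => [||x]; [exact: zoom_Cb phi_lip|exact: zoom_Cb phi_lip|].
  have -> : H t = h + (H t - h) by rewrite addrC subrK.
  rewrite zoom_shift (le_trans ((zoom_lip h phi_lip).2 _ _))// ler_wpM2l//.
  rewrite addrAC subrr add0r (le_trans (drift_lip k10 kt))//.
  by rewrite -[leRHS]mulr1 ler_wpM2l ?mulr_ge0//; lra.
have -> : frozen_avg k - (1 + Gamma) * position t =
    (frozen_avg k - (1 + Gamma) * obs (zoom phi h) k.+1%:R) -
    (1 + Gamma) * ((position t - obs (zoom phi h) t) +
                   (obs (zoom phi h) t - obs (zoom phi h) k.+1%:R)) by ring.
rewrite (le_trans (ler_normB _ _))//.
have -> : near_cst * (lam^-1 + (1 - q) ^+ k) =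
    (1 + K) * (grad_cst * e) + (1 + K) * (L * (K * m) * e + grad_cst * e) by rewrite /near_cst -/e; ring.
apply: lerD => //; rewrite normrM; apply: ler_pM => //.
  by rewrite ger0_norm ?addr_ge0// lerD2l.
by rewrite (le_trans (ler_normD _ _))// lerD.
Qed.

Lemma frozen_avg_telescope k j :
  `|frozen_avg (k + j)%N - frozen_avg k| <= \sum_(i < j) step_cst * err (k + i)%N.
Proof.
elim: j => [|j IH]; first by rewrite addn0 subrr normr0 big_ord0.
rewrite big_ord_recr/= addnS -[frozen_avg _ - _](subrKA (frozen_avg (k + j)%N)) addrC.
by rewrite (le_trans (ler_normD _ _))// lerD// frozen_avg_step.
Qed.

(** A bound without any cancellation: the observable changes at most at speed [K * (2 * B)] and the
    drift at speed [K * m]. After rescaling of time it degenerates like [lam ^+ 2], so it is meant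
    for bounded [lam]. *)
Lemma position_lip f B l s t : bounded_lip f B l -> 0 <= l -> 0 < s -> s <= t ->
  `|obs (zoom f (H t)) t - obs (zoom f (H s)) s| <= (K * (2 * B) + l * (K * m)) * (t - s).
Proof.
move=> bf l0 s0 st; have B0 := bounded_lip_ge0 bf.
have bs h := zoom_lip h bf.
have h1 : `|obs (zoom f (H t)) t - obs (zoom f (H s)) t| <= l * (K * m) * (t - s).
  apply: obs_close => [||x]; [exact: zoom_Cb bf|exact: zoom_Cb bf|].
  have -> : H t = H s + (H t - H s) by rewrite addrC subrK.
  rewrite zoom_shift (le_trans ((bs (H s)).2 _ _))// addrAC subrr add0r -!mulrA.
  rewrite ler_wpM2l//.
  apply: (@le_trans _ _ (1 * `|H t - H s|)); first by rewrite ler_wpM2r.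
  by rewrite mul1r mulrA drift_lip.
have h2 : `|obs (zoom f (H s)) t - obs (zoom f (H s)) s| <= K * (2 * B) * (t - s).
  have hd (x : R) : s <= x <= t ->
      is_derive x (1 : R) (obs (zoom f (H s))) (jump_rate (zoom f (H s)) x).
    by move=> /andP[sx _]; apply: delay_derive (bs _) _; exact: lt_le_trans sx.
  have hs x : s <= x <= t -> `|jump_rate (zoom f (H s)) x - 0| <= K * (2 * B).
    move=> _; rewrite subr0 -[leRHS](slab_integral_cst hQ).
    apply: Rintegral_dominated => //.
    - have := integrable_sub ms (integrable_rate_delayed x (bs (H s)))
        (integrableZl ms (obs (zoom f (H s)) x) (integrable_rate x)).
      apply: eq_integrable => // p _ /=; congr EFin.
      by rewrite mulrBr [obs _ _ * _]mulrC.
    - apply: (slab_integrable hQ hQ2 (c := K * (2 * B))); first exact: measurable_cst.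
      by move=> p _; rewrite ger0_norm ?ler_weight ?mulr_ge0.
    - move=> p _; rewrite normrM ler_pM// ?rate_norm//.
      rewrite (le_trans (ler_normB _ _))// mulr_natl mulr2n lerD//.
        exact: delayed_bound (bs _).
      exact: obs_bound (bs _).
  by have := derive_near_const st hd hs; rewrite mul0r subr0.
rewrite -[X in `|X|](subrKA (obs (zoom f (H s)) t)) mulrDl addrC.
by rewrite (le_trans (ler_normD _ _))// lerD// addrC.
Qed.

End scaled.

(** Of the exponential decay only the rate [1 / k] is retained: [k] will be of order [lam ^+ 2], and
    [lam ^- 2] is what a step may cost. *)
Lemma geometric_decay : exists2 D : R, 0 <= D & forall k : nat,
  (1 - q) ^+ k + expR (- (beta * k%:R)) <= D / k.+1%:R.
Proof.
have r0 : 0 <= 1 - q by rewrite subr_ge0 ltW.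
have qi0 : 0 <= q^-1 by rewrite invr_ge0 ltW.
have bi0 : 0 <= beta^-1 by rewrite invr_ge0 ltW.
exists (q^-1 + (1 + beta^-1)); first by rewrite !addr_ge0.
move=> k; have k0 : 0 <= k%:R :> R by [].
have k1 : k.+1%:R = 1 + k%:R :> R by rewrite -natr1 addrC.
have k10 : 0 < k.+1%:R :> R by [].
rewrite [leRHS]mulrDl; apply: lerD.
  (* Bernoulli's inequality, in the form [1 + k * q <= (1 - q) ^- k]. *)
  have h : (1 - q) ^+ k * (1 + k%:R * q) <= 1.
    elim: {k0 k1 k10} k => [|k IH]; first by rewrite expr0 mul0r addr0 mulr1.
    apply: le_trans IH; rewrite exprS -mulrA mulrCA.
    apply: ler_wpM2l; first exact: exprn_ge0.
    have k0 : 0 <= k%:R :> R by [].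
    have kq : 0 <= (k%:R + 1) * (q * q) by rewrite !mulr_ge0 ?addr_ge0// ltW.
    rewrite -natr1 -subr_ge0.
    by have -> : 1 + k%:R * q - (1 - q) * (1 + (k%:R + 1) * q) = (k%:R + 1) * (q * q) by ring.
  rewrite ler_pdivlMr// -[leRHS]mul1r ler_pdivlMr// -mulrA.
  apply: le_trans h; apply: ler_wpM2l; first exact: exprn_ge0.
  by rewrite k1 mulrDl mul1r lerD2r ltW.
rewrite expRN ler_pdivlMr// mulrC ler_pdivrMr ?expR_gt0//.
have h : 1 + beta * k%:R <= expR (beta * k%:R) by exact: expR_ge1Dx.
rewrite (le_trans _ (ler_wpM2l _ h))// ?addr_ge0// k1.
have -> : (1 + beta^-1) * (1 + beta * k%:R) =
   1 + k%:R + (beta^-1 + beta * k%:R) by field; rewrite gt_eqF.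
by rewrite lerDl addr_ge0// mulr_ge0// ltW.
Qed.

Lemma nat_window (x : R) : 1 <= x -> exists k : nat, k.+1%:R <= x < k.+2%:R.
Proof.
move=> x1; have x0 : 0 <= x by rewrite (le_trans ler01).
have := truncn_itv x0; case: (Num.truncn x) => [|k] /andP[h1 h2].
  by move: h2; rewrite ltNge x1.
by exists k; rewrite h1.
Qed.

Lemma test_equicontinuous (phi : 'rV[R]_N -> R) (phi_ : 'I_N -> 'rV[R]_N -> R) (L eps : R) :
  0 <= L -> bounded_lip phi L L -> (forall i, bounded_lip (phi_ i) L L) ->
  (forall x h, `|phi (x + h) - phi x - \sum_i h ord0 i * phi_ i x| <= L * `|h| ^+ 2) ->
  0 < eps ->
  exists C Lam : R, [/\ 0 <= C, 1 <= Lam & forall lam t1 t2, Lam <= lam -> eps <= t1 ->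
    t1 <= t2 -> `|position phi lam (lam ^+ 2 * t2) - position phi lam (lam ^+ 2 * t1)| <=
      C * (lam^-1 + (t2 - t1))].
Proof.
move=> L0 bphi bphi_ tphi e0; have [D D0 Dk] := geometric_decay.
have ei0 : 0 <= eps^-1 by rewrite invr_ge0 ltW.
(* Steps are numbered from [lam ^+ 2 * eps / 2 - 1] on, so [D / k.+1%:R] is at most
   [Ce * lam ^- 2]. *)
pose Ce := 2 * D / eps; have Ce0 : 0 <= Ce by rewrite divr_ge0 ?mulr_ge0// ltW.
have C20 := grad_cst_ge0 L0; have M0 := ltW M_gt0; have CH0 : 0 <= drift_cst by rewrite addr_ge0// mulr_ge0.
have Cs0 : 0 <= step_cst L.
  by rewrite /step_cst /time_cst /shift_cst;
    do ?[apply: addr_ge0 | apply: mulr_ge0 | exact: exprn_ge0 | by []].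
have Cf0 : 0 <= near_cst L by rewrite /near_cst; do ?[apply: addr_ge0 | apply: mulr_ge0 | by []].
(* [1 + 2 / eps <= lam] forces [2 <= lam ^+ 2 * eps], which absorbs the rounding of times to
   integers in the estimate of the step numbers. [near_cst] counts once for each end. *)
exists ((step_cst L + 2 * near_cst L) * (1 + Ce)), (1 + 2 / eps); split.
- by do ?[apply: addr_ge0 | apply: mulr_ge0 | by []].
- by rewrite lerDl divr_ge0// ltW.
move=> lam t1 t2 Ll et1 t12.
have lam1 : 1 <= lam by rewrite (le_trans _ Ll)// lerDl divr_ge0// ltW.
have lam0 : 0 < lam := lt_le_trans ltr01 lam1.
have lame : 2 <= lam ^+ 2 * eps.
  rewrite -ler_pdivrMr// (@le_trans _ _ lam)//; last by rewrite expr2 ler_peMl// ltW.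
  by rewrite (le_trans _ Ll)// lerDr.
have l20 : 0 < lam ^+ 2 by rewrite exprn_gt0.
have et : lam ^+ 2 * eps <= lam ^+ 2 * t1 by rewrite ler_pM2l.
have tt : lam ^+ 2 * t1 <= lam ^+ 2 * t2 by rewrite ler_pM2l.
have T1 : 1 <= lam ^+ 2 * t1 by lra.
have T2 : 1 <= lam ^+ 2 * t2 by lra.
have [k1 /andP[a1 a2]] := nat_window T1.
have [k2 /andP[b1 b2]] := nat_window T2.
have k12 : (k1 <= k2)%N.
  have : k1.+1%:R < k2.+2%:R :> R by exact: le_lt_trans (le_trans a1 tt) b2.
  by rewrite ltr_nat ltnS.
have li2 : 0 <= lam ^- 2 by rewrite invr_ge0 ltW.
have errk k : (k1 <= k)%N -> (1 - q) ^+ k + expR (- (beta * k%:R)) <= Ce * lam ^- 2.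
  move=> kk; rewrite (le_trans (Dk k))// /Ce.
  have kR : lam ^+ 2 * eps / 2 <= k.+1%:R.
    have : k1%:R <= k%:R :> R by rewrite ler_nat.
    have : k1.+2%:R = k1%:R + 2 :> R by rewrite -!natr1; ring.
    have : k.+1%:R = k%:R + 1 :> R by rewrite -natr1.
    lra.
  have -> : 2 * D / eps * lam ^- 2 = D / (lam ^+ 2 * eps / 2).
    by field; rewrite !gt_eqF.
  by rewrite ler_wpM2l// lef_pV2// posrE// divr_gt0// mulr_gt0.
have err1 k : (k1 <= k)%N -> err lam k <= (1 + Ce) * lam ^- 2.
  by move=> kk; rewrite /err -addrA mulrDl mul1r lerD2l errk.
have rho1 k : (k1 <= k)%N -> (1 - q) ^+ k <= Ce * lam ^- 2.
  by move=> kk; rewrite (le_trans _ (errk k kk))// lerDl expR_ge0.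
have lil : lam ^- 2 <= lam^-1.
  by rewrite lef_pV2 ?posrE// expr2 ler_peMl// ltW.
have W1 : k1.+1%:R <= lam ^+ 2 * t1 <= k1.+2%:R by rewrite a1 ltW.
have W2 : k2.+1%:R <= lam ^+ 2 * t2 <= k2.+2%:R by rewrite b1 ltW.
have P1 := frozen_avg_near L0 bphi lam1 W1.
have P2 := frozen_avg_near L0 bphi lam1 W2.
have Q1 : near_cst L * (lam^-1 + (1 - q) ^+ k1) <= near_cst L * ((1 + Ce) * lam^-1).
  rewrite ler_wpM2l// mulrDl mul1r lerD2l (le_trans (rho1 _ _))//.
  by rewrite ler_wpM2l.
have Q2 : near_cst L * (lam^-1 + (1 - q) ^+ k2) <= near_cst L * ((1 + Ce) * lam^-1).
  rewrite ler_wpM2l// mulrDl mul1r lerD2l (le_trans (rho1 _ k12))//.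
  by rewrite ler_wpM2l.
have S1 : `|frozen_avg phi lam k2 - frozen_avg phi lam k1| <= step_cst L * (1 + Ce) * (lam^-1 + (t2 - t1)).
  have := frozen_avg_telescope L0 bphi bphi_ tphi lam1 k1 (k2 - k1).
  rewrite subnKC// => H; rewrite (le_trans H)//.
  apply: (@le_trans _ _ (\sum_(i < k2 - k1) step_cst L * ((1 + Ce) * lam ^- 2))).
    by apply: ler_sum => i _; rewrite ler_wpM2l// err1// leq_addr.
  rewrite sumr_const card_ord -mulr_natl.
  (* The extra step comes from rounding both times; at cost [lam ^- 2] it is absorbed by
     [lam^-1]. *)
  have jR : (k2 - k1)%:R <= lam ^+ 2 * (t2 - t1) + 1.
    rewrite natrB//.
    have : k1.+2%:R = k1%:R + 2 :> R by rewrite -!natr1; ring.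
    have : k2.+1%:R = k2%:R + 1 :> R by rewrite -natr1.
    lra.
  have X0 : 0 <= step_cst L * ((1 + Ce) * lam ^- 2).
    by do ?[apply: addr_ge0 | apply: mulr_ge0 | by []].
  rewrite (le_trans (ler_wpM2r X0 jR))//.
  have -> : (lam ^+ 2 * (t2 - t1) + 1) * (step_cst L * ((1 + Ce) * lam ^- 2)) =
    step_cst L * (1 + Ce) * (lam ^- 2 + (t2 - t1)) by field; rewrite gt_eqF.
  have X1 : 0 <= step_cst L * (1 + Ce) by rewrite mulr_ge0// addr_ge0.
  by rewrite ler_wpM2l// lerD2r.
have /andP[G0 _] := Gamma_bd.
set F1 := position phi lam (lam ^+ 2 * t1) in P1 *.
set F2 := position phi lam (lam ^+ 2 * t2) in P2 *.
apply: (@le_trans _ _ (`|(1 + Gamma) * F2 - (1 + Gamma) * F1|)).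
  by rewrite -mulrBr normrM ler_peMl// ger0_norm ?addr_ge0// lerDl.
(* Both positions are exchanged for frozen averages, whose difference is the telescoped sum. *)
have split_id (a b c d : R) : a - b = (d - c) + ((c - b) - (d - a)) by ring.
rewrite (split_id ((1 + Gamma) * F2) ((1 + Gamma) * F1) (frozen_avg phi lam k1) (frozen_avg phi lam k2)).
rewrite (le_trans (ler_normD _ _))//.
have h := le_trans (ler_normB (frozen_avg phi lam k1 - (1 + Gamma) * F1)
  (frozen_avg phi lam k2 - (1 + Gamma) * F2))
  (lerD (le_trans P1 Q1) (le_trans P2 Q2)).
rewrite (le_trans (lerD S1 h))//.
have t0 : 0 <= t2 - t1 by rewrite subr_ge0.
rewrite -subr_ge0.
have -> : (step_cst L + 2 * near_cst L) * (1 + Ce) * (lam^-1 + (t2 - t1)) -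
   (step_cst L * (1 + Ce) * (lam^-1 + (t2 - t1)) +
    (near_cst L * ((1 + Ce) * lam^-1) + near_cst L * ((1 + Ce) * lam^-1))) =
   2 * near_cst L * (1 + Ce) * (t2 - t1) by ring.
by do ?[exact: t0 | apply: addr_ge0 | apply: mulr_ge0 | by []].
Qed.

End delay.

(** * Compactness *)

Section sobolev_space.
Context {R : realType} {n : nat}.
Local Notation row := (@lebesgue_row R n).
Local Notation e_ i := (delta_mx ord0 i : 'rV[R]_n).
Implicit Types (u v : 'rV[R]_n -> R) (a s r : R).

Definition comb a u v (x : 'rV[R]_n) := a * u x + v x.

Lemma continuous_comb a u v : continuous u -> continuous v -> continuous (comb a u v).
Proof. by move=> cu cv; apply: continuous_add => //; exact: continuous_scale. Qed.

Lemma Ck_comb k a u v : Ck k u -> Ck k v -> Ck k (comb a u v).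
Proof.
elim: k u v => [|k IH] u v [cu hu] [cv hv]; split; try exact: continuous_comb; first by [].
move=> i; have [du Cu] := hu i; have [dv Cv] := hv i.
have dc x : derivable (comb a u v) x (e_ i).
  have -> : comb a u v = (fun x => a *: u x) + v by apply/funext.
  by apply: derivableD (dv x); exact: derivableZ (du x).
split=> //.
have -> : (fun x => 'D_(e_ i) (comb a u v) x) =
    comb a (fun x => 'D_(e_ i) u x) (fun x => 'D_(e_ i) v x).
  apply/funext => x; rewrite /comb -/(comb a u v).
  have -> : comb a u v = (fun x => a *: u x) + v by apply/funext.
  have -> := deriveD (derivableZ (k := a) (du x)) (dv x).
  by have -> := deriveZ a (du x).
exact: IH.
Qed.

Lemma test_fun_comb r a u v : test_fun r u -> test_fun r v -> test_fun r (comb a u v).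
Proof.
move=> [Cu [ku su]] [Cv [kv sv]]; split; first by move=> k; exact: Ck_comb.
have sub : closure [set x | comb a u v x != 0] `<=`
    closure [set x | u x != 0] `|` closure [set x | v x != 0].
  rewrite -closureU; apply: closureS => x /=.
  have [ux|ux] := eqVneq (u x) 0; last by left.
  by rewrite /comb ux mulr0 add0r; right.
split.
  by apply: subclosed_compact sub; [exact: closed_closure|exact: compactU].
by move=> x /sub[/su|/sv].
Qed.

Lemma fourier_comb a u v xi : row.-integrable setT (EFin \o u) ->
  row.-integrable setT (EFin \o v) ->
  fourier_cos (comb a u v) xi = a * fourier_cos u xi + fourier_cos v xi /\
  fourier_sin (comb a u v) xi = a * fourier_sin u xi + fourier_sin v xi.
Proof.
move=> iu iv.
have mc : measurable_fun setT (fun y : 'rV[R]_n => cos (dotp y xi)).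
  by apply: measurableT_comp measurable_cosR _; exact: measurable_dotp2.
have ms : measurable_fun setT (fun y : 'rV[R]_n => sin (dotp y xi)).
  by apply: measurableT_comp measurable_sinR _; exact: measurable_dotp2.
have lin (t : 'rV[R]_n -> R) : measurable_fun setT t -> (forall y, `|t y| <= 1) ->
    \int[row]_x (comb a u v x * t x) = a * \int[row]_x (u x * t x) + \int[row]_x (v x * t x).
  move=> mt t1; have iut := integrable_bounded_mul iu mt t1.
  have ivt := integrable_bounded_mul iv mt t1.
  rewrite -RintegralZl// -RintegralD//; last exact: integrable_scale.
  by apply: eq_Rintegral => x _; rewrite /comb mulrDl mulrA.
by split; apply: lin => // y; [exact: cos_norm_le1|exact: sin_norm_le1].
Qed.

(** From [(x + y) ^ 2 <= 2 * x ^ 2 + 2 * y ^ 2] under the integral. The lost factor 2 is harmless,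
    as only finiteness and convergence to 0 are derived from it. *)
Lemma sobolev_sqnorm_comb s a u v : row.-integrable setT (EFin \o u) ->
  row.-integrable setT (EFin \o v) ->
  (sobolev_sqnorm s (comb a u v) <=
   (2 * a ^+ 2)%:E * sobolev_sqnorm s u + 2%:E * sobolev_sqnorm s v)%E.
Proof.
move=> iu iv.
have mu := measurable_energy s iu; have mv := measurable_energy s iv.
have iuv : row.-integrable setT (EFin \o comb a u v).
  by apply: integrable_add => //; exact: integrable_scale.
have a0 : 0 <= 2 * a ^+ 2 by rewrite mulr_ge0// sqr_ge0.
have -> : ((2 * a ^+ 2)%:E * sobolev_sqnorm s u + 2%:E * sobolev_sqnorm s v =
    \int[row]_xi (2 * a ^+ 2 * energy s u xi + 2 * energy s v xi)%:E)%E.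
  have pos (c : R) w xi : 0 <= c -> (0 <= c%:E * (energy s w xi)%:E)%E.
    by move=> c0; rewrite -EFinM lee_fin mulr_ge0// energy_ge0.
  have mea (c : R) w : measurable_fun setT (energy s w) ->
      measurable_fun setT (fun xi => (c%:E * (energy s w xi)%:E)%E).
    by move=> mw; apply: measurable_funeM; exact/measurable_EFinP.
  have scl (c : R) w : 0 <= c -> measurable_fun setT (energy s w) ->
      (\int[row]_xi (c%:E * (energy s w xi)%:E) = c%:E * sobolev_sqnorm s w)%E.
    move=> c0 mw; rewrite ge0_integralZl//; first exact/measurable_EFinP.
    by move=> xi _; rewrite lee_fin energy_ge0.
  transitivity (\int[row]_xi ((2 * a ^+ 2)%:E * (energy s u xi)%:E +
      2%:E * (energy s v xi)%:E))%E; last by apply: eq_integral => xi _.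
  rewrite ge0_integralD//.
  - by rewrite !scl.
  - by move=> xi _; exact: pos.
  - exact: mea.
  - by move=> xi _; exact: pos.
  - exact: mea.
apply: ge0_le_integral => //.
- by move=> xi _; rewrite lee_fin energy_ge0.
- by apply/measurable_EFinP; exact: measurable_energy.
- apply/measurable_EFinP; apply: measurable_funD; apply: measurable_funM => //.
- move=> xi _; rewrite lee_fin; have [-> ->] := fourier_comb a xi iu iv.
  rewrite /energy !mulrA ![_ * japanese xi `^ s]mulrC -!mulrA -mulrDr.
  apply: ler_wpM2l; first exact: powR_ge0.
  set p := fourier_cos u xi; set p' := fourier_cos v xi.
  set t := fourier_sin u xi; set t' := fourier_sin v xi.
  have := sqr_ge0 (a * p - p'); have := sqr_ge0 (a * t - t').
  nra.
Qed.

Lemma sobolev_sqnorm_ge0 s u : (0 <= sobolev_sqnorm s u)%E.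
Proof. by apply: integral_ge0 => xi _; rewrite lee_fin energy_ge0. Qed.

Lemma test_fun_support r (phi : 'rV[R]_n -> R) : test_fun r phi -> continuous phi /\
  (forall x, ~ eball r x -> phi x = 0).
Proof.
move=> [Ck_ [_ sr]]; split; first exact: (Ck_continuous (Ck_ 0%N)).
exact: off_eball0 sr.
Qed.

(** Functionals are defined by cases on membership in H^s_0, so their linearity needs the
    combination to fall in the same case as its terms. *)
Lemma sobolev0_comb s r a u v : sobolev0 s r u -> sobolev0 s r v ->
  sobolev0 s r (comb a u v).
Proof.
move=> [cu u0 su [phi [tphi phiu]]] [cv v0 sv [psi [tpsi psiv]]].
have iu := compact_support_integrable cu u0.
have iv := compact_support_integrable cv v0.
have idiff w (chi : nat -> 'rV[R]_n -> R) k : continuous w ->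
    (forall x, ~ eball r x -> w x = 0) -> (forall k, test_fun r (chi k)) ->
    row.-integrable setT (EFin \o (fun x => w x - chi k x)).
  move=> cw w0 tchi; have [cc c0] := test_fun_support (tchi k).
  apply: (@compact_support_integrable _ _ _ r); first exact: continuous_sub.
  by move=> x nx; rewrite w0// c0// subrr.
split.
- exact: continuous_comb.
- by move=> x nx; rewrite /comb u0// v0// mulr0 addr0.
- apply: (le_lt_trans (sobolev_sqnorm_comb s a iu iv)).
  apply: lte_add_pinfty; apply: lte_mul_pinfty; [|by []|exact: su|by []|by []|exact: sv].
  by rewrite lee_fin mulr_ge0// sqr_ge0.
- exists (fun k => comb a (phi k) (psi k)); split.
    by move=> k; exact: test_fun_comb.
  pose p k := sobolev_sqnorm s (fun x => u x - phi k x).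
  pose q k := sobolev_sqnorm s (fun x => v x - psi k x).
  have lim0 : ((2 * a ^+ 2)%:E * p k + 2%:E * q k)%E @[k --> \oo] --> 0%E.
    rewrite -[X in _ --> X]adde0 -[X in _ --> (X + _)%E](mule0 (2 * a ^+ 2)%:E).
    rewrite -[X in _ --> (_ + X)%E](mule0 2%:E).
    by apply: cvgeD; [rewrite !mule0|exact: cvgeZl phiu|exact: cvgeZl psiv].
  apply: squeeze_cvge lim0; last exact: cvg_cst.
  apply: nearW => k; rewrite sobolev_sqnorm_ge0/=.
  have -> : (fun x => comb a u v x - comb a (phi k) (psi k) x) =
     comb a (fun x => u x - phi k x) (fun x => v x - psi k x).
    by apply/funext => x; rewrite /comb; ring.
  by apply: sobolev_sqnorm_comb; exact: idiff.
Qed.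

End sobolev_space.

(** * Finite nets for the sup norm *)

Lemma compact_net {R : realType} (V : normedModType R) (A : set V) (d : R) :
  compact A -> 0 < d -> exists (I : finType) (p : I -> V),
    (forall i, A (p i)) /\ forall x, A x -> exists i, `|x - p i| < d.
Proof.
move=> cA d0; move: cA; rewrite compact_cover => cA.
have [|x Ax|D sD AD] := cA V A (fun c => ball c d).
- by move=> c _; exact: ball_open.
- by exists x => //; exact: ballxx.
exists (D : finType), val; split; first by move=> i; exact/set_mem/sD/(valP i).
move=> x /AD[c /= cD]; rewrite -ball_normE/= distrC => xc.
by exists [` cD]%fset.
Qed.

Section nets.
Context {R : realType} {n : nat}.
Implicit Types (u : 'rV[R]_n -> R).

(* The members of the net are told apart by the integer parts of their values
   at finitely many points, in units of [d]. *)
Lemma lipschitz_net (U : set ('rV[R]_n -> R)) (r C e : R) : 0 < e -> U !=set0 ->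
  (forall u, U u -> bounded_lip u C C) ->
  (forall u, U u -> forall x, ~ eball r x -> u x = 0) ->
  exists (I : finType) (v : I -> 'rV[R]_n -> R), (forall i, U (v i)) /\
    forall u, U u -> exists i, forall x, `|u x - v i x| <= e.
Proof.
move=> e0 [w Uw] UC U0; have C0 : 0 <= C := bounded_lip_ge0 (UC w Uw).
(* The budget is [e / 4] for each of the two functions between [x] and the nearest [p i], and
   [e / 2] for the gap between their values at [p i]. *)
pose d := e / (4 * (C + 1)).
have d0 : 0 < d by rewrite divr_gt0// mulr_gt0// ltr_wpDl.
have [I [p [_ Ip]]] := compact_net (@compact_box R n r) d0.
pose d' := e / 2; have d'0 : 0 < d' by rewrite divr_gt0.
pose M := Num.truncn ((C + C) / d').
pose sig u : {ffun I -> 'I_M.+1} := [ffun i => inord (Num.truncn ((u (p i) + C) / d'))].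
(* For a signature that no member of [U] has, [xget] returns [w], which keeps the net inside [U]. *)
exists {ffun I -> 'I_M.+1}, (fun g => xget w [set u | U u /\ sig u = g]).
split=> [g|u Uu].
  by case: xgetP => [v _ []|].
exists (sig u) => x; case: xgetP => [v _ [Uv vu]|/(_ u)]; last by case.
have [bx|nx] := pselect (eball r x); last first.
  by rewrite (U0 u)// (U0 v)// subrr normr0 ltW.
have [|i xi] := Ip x.
  move=> i /=; rewrite in_itv/= -ler_norml.
  by rewrite (le_trans (coord_le_enorm _ _))// ltW.
have near0 y : U y -> `|y x - y (p i)| <= e / 4.
  move=> Uy; rewrite (le_trans ((UC y Uy).2 _ _))//.
  rewrite (le_trans (ler_wpM2l C0 (ltW xi)))// /d invfM !mulrA.
  by rewrite ler_pdivrMr ?ltr_wpDl// -[leRHS]mulrA mulrC mulrA; nra.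
have rng y : U y -> 0 <= (y (p i) + C) / d' /\ (Num.truncn ((y (p i) + C) / d') < M.+1)%N.
  move=> Uy; have := (UC y Uy).1 (p i); rewrite ler_norml => /andP[y1 y2]; split.
    by rewrite divr_ge0 ?(ltW d'0)//; lra.
  by rewrite ltnS /M; apply: le_truncn; rewrite ler_pM2r ?invr_gt0// lerD2r.
have close : `|u (p i) - v (p i)| <= d'.
  move/ffunP: vu => /(_ i); rewrite !ffunE => /(congr1 val); rewrite /= !inordK; last 2 first.
    exact: (rng u Uu).2.
    exact: (rng v Uv).2.
  have [u1 _] := rng u Uu; have [v1 _] := rng v Uv.
  have := truncn_itv u1; have := truncn_itv v1.
  move=> /andP[a1 a2] /andP[b1 b2] E; rewrite E in a1 a2.
  have : `|(u (p i) + C) / d' - (v (p i) + C) / d'| <= 1.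
    by move: a1 a2 b1 b2; rewrite -!natr1 ler_distl => *; lra.
  by rewrite -mulrBl normrM (gtr0_norm (x := d'^-1)) ?invr_gt0// ler_pdivrMr// mul1r
    opprD addrACA subrr addr0.
rewrite (_ : u x - v x = (u x - u (p i)) + (u (p i) - v (p i)) - (v x - v (p i))); last by ring.
rewrite (le_trans (ler_normB _ _))// (le_trans (lerD (ler_normD _ _) (lexx _)))//.
move: close (near0 u Uu) (near0 v Uv); rewrite /d'; lra.
Qed.

End nets.

Section unit_net.
Context {R : realType} {n : nat}.
Variables (s r C : R).
Hypothesis sob_lip : forall u : 'rV[R]_n -> R, sobolev0 s r u ->
  bounded_lip u (C * sobolev_norm s u) (C * sobolev_norm s u).

Definition unit_fun (u : 'rV[R]_n -> R) x := (sobolev_norm s u)^-1 * u x.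

(** The net is written [unit_fun (w i)] so that functionals are evaluated at the members [w i] of
    the space themselves. Functions of norm 0 cannot be normalised; bounded functionals vanish on
    them and they are treated apart. *)
Lemma sobolev_unit_net (e : R) : 0 < e ->
  exists (I : finType) (w : I -> 'rV[R]_n -> R),
    (forall i, sobolev0 s r (w i) /\ sobolev_norm s (w i) != 0) /\
    forall u, sobolev0 s r u -> sobolev_norm s u != 0 ->
      exists i, forall x, `|unit_fun u x - unit_fun (w i) x| <= e.
Proof.
move=> e0; pose U := unit_fun @` [set u | sobolev0 s r u /\ sobolev_norm s u != 0].
have [[u1 Uu1]|U0] := pselect (U !=set0); last first.
  exists void, (fun=> cst 0); split; first by case.
  by move=> u su nu; exfalso; apply: U0; exists (unit_fun u), u.
have UC u : U u -> bounded_lip u C C.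
  move=> [w [sw nw] <-]; have [wB wl] := sob_lip sw.
  have n0 : 0 < sobolev_norm s w by rewrite lt_neqAle eq_sym nw sobolev_norm_ge0.
  split=> [x|x y]; rewrite /unit_fun -?mulrBr normrM gtr0_norm ?invr_gt0//.
    by rewrite ler_pdivrMl// mulrC.
  by rewrite ler_pdivrMl// mulrA [_ * C]mulrC.
have Uz u : U u -> forall x, ~ eball r x -> u x = 0.
  by move=> [w [[_ w0 _ _] _] <-] x nx; rewrite /unit_fun w0// mulr0.
have [I [v [vU Iv]]] := lipschitz_net e0 (ex_intro _ u1 Uu1) UC Uz.
have /choice[w wE] : forall i, exists w,
    (sobolev0 s r w /\ sobolev_norm s w != 0) /\ unit_fun w = v i.
  by move=> i; have [w sw <-] := vU i; exists w.
exists I, w; split=> [i|u su nu]; first by have [] := wE i.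
have [|i ui] := Iv (unit_fun u); first by exists u.
by exists i => x; have [_ ->] := wE i.
Qed.

End unit_net.

(** * Uniform neighbourhoods of curves and limits along ultrafilters *)

Lemma Cseg_nbhsP {R : realType} (a b : R) (E : normedModType R) (f : Cseg a b E)
    (A : set (Cseg a b E)) :
  nbhs f A <-> exists2 e, 0 < e & forall g : Cseg a b E, (forall t, `|f t - g t| < e) -> A g.
Proof.
split.
- rewrite -nbhs_entourageE => -[V [W entW WV] VA].
  move: entW; rewrite uniform_entourage => -[B]; rewrite -entourage_ballE => -[e e0 eB] BW.
  exists e => // g fg; apply: VA; apply/xsectionP; apply: WV; apply: BW => t _ /=.
  by apply: eB => /=; rewrite -ball_normE/=; exact: fg.
- move=> [e e0 eA]; rewrite -nbhs_entourageE.
  pose V := [set fg : Cseg a b E * Cseg a b E | forall t, `|fg.1 t - fg.2 t| < e].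
  exists V; last by move=> g /xsectionP; exact: eA.
  pose V' := [set fg : (`[a, b]%classic -> E) * (`[a, b]%classic -> E) |
    forall t, `|fg.1 t - fg.2 t| < e].
  exists V'; last by [].
  rewrite uniform_entourage; exists [set xy | `|xy.1 - xy.2| < e].
    by rewrite -entourage_ballE; exists e => //= -[x y]; rewrite /= -ball_normE.
  by move=> fg /= H t; exact: H.
Qed.

(** Stands in for the extraction of subsequences: the image of an ultrafilter is an ultrafilter,
    here concentrated on a compact interval. *)
Lemma ultra_bounded_cvg {R : realType} (T : Type) (F : set_system T) (g : T -> R) (B : R) :
  UltraFilter F -> F [set x | `|g x| <= B] -> exists y : R, g @ F --> y.
Proof.
move=> UF FB; have PF : ProperFilter F by exact: ultra_proper.
have PG : ProperFilter (g @ F) by exact: fmap_proper_filter.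
have UG : UltraFilter (g @ F).
  split=> // G PG' FG; apply/seteqP; split=> // A GA.
  have [//|FA] := in_ultra_setVsetC (g @^-1` A) UF.
  have GA' : G (~` A) by apply: FG.
  by have [x []] := filter_ex (filterI GA GA').
have cB : compact `[- B, B]%classic by exact: segment_compact.
move: cB; rewrite compact_ultra => /(_ (g @ F) UG).
case=> [|y [_ Fy]]; last by exists y.
by apply: (@filterS _ F _ _ _ _ FB) => x xB; rewrite /preimage/= in_itv/= -ler_norml.
Qed.

Lemma cvg_norm_le {R : realType} (T : Type) (F : set_system T) (g : T -> R) (y c : R) :
  ProperFilter F -> g @ F --> y -> F [set x | `|g x| <= c] -> `|y| <= c.
Proof.
move=> PF gy Fc; have : (fun x => `|g x|) @ F --> `|y| by exact: cvg_norm gy.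
by move/cvgr_to_le; apply; exact: Fc.
Qed.

(** The triangle inequality for [ultra_limit_cvg]: move to a time of the net, then to a function of
    the net, cross from the limit to a nearby curve there, and return. *)
Lemma chain_le {R : realFieldType} (c k x y x' y' v w h : R) : 0 < c ->
  `|c^-1 * x - c^-1 * x'| <= h -> `|c^-1 * x' - k * v| <= h ->
  `|k * v - k * w| <= h -> `|c^-1 * y' - k * w| <= h ->
  `|c^-1 * y - c^-1 * y'| <= h -> `|x - y| <= 5 * h * c.
Proof.
move=> c0 d1 d2 d3 d4 d5; have -> : x - y = c * (c^-1 * x - c^-1 * y).
  by rewrite -mulrBr mulrA divff ?gt_eqF// mul1r.
rewrite normrM gtr0_norm// mulrC ler_pM2r//.
move: (c^-1 * x) (c^-1 * y) (c^-1 * x') (c^-1 * y') (k * v) (k * w) d1 d2 d3 d4 d5.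
move=> a1 a2 a3 a4 a5 a6; rewrite !ler_norml.
move=> /andP[? ?] /andP[? ?] /andP[? ?] /andP[? ?] /andP[? ?].
by apply/andP; split; lra.
Qed.

(** Used to pass the defining inequalities of the family to uniform limits. The denominator is
    chosen so that the perturbation costs at most [h], with [+ 1] to keep it positive. *)
Lemma perturb_le {R : realFieldType} (c d x y x' y' p q e h : R) : 0 <= h -> 0 <= p -> 0 <= q ->
  `|x - x'| <= h / (`|c| * p + `|d| * q + 1) * p ->
  `|y - y'| <= h / (`|c| * p + `|d| * q + 1) * q ->
  `|c * x' - d * y'| <= e -> `|c * x - d * y| <= e + h.
Proof.
move=> h0 p0 q0; set k := _ + 1 => xx yy xy.
have k0 : 0 < k by rewrite ltr_wpDl// addr_ge0// mulr_ge0.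
have -> : c * x - d * y = (c * x' - d * y') + (c * (x - x') - d * (y - y')) by ring.
rewrite (le_trans (ler_normD _ _))// lerD// (le_trans (ler_normB _ _))// !normrM.
rewrite (le_trans (lerD (ler_wpM2l (normr_ge0 c) xx) (ler_wpM2l (normr_ge0 d) yy)))//.
rewrite (_ : _ + _ = h * ((`|c| * p + `|d| * q) / k)); last by ring.
by rewrite -[leRHS]mulr1 ler_wpM2l// ler_pdivrMr// mul1r /k lerDl.
Qed.

(** * Compactness of equicontinuous families of functionals *)

Section compactness.
Context {R : realType} {n : nat}.
Variables (s r C a b : R) (delta : R -> R).
Local Notation D := (Hdual n s r).
Local Notation sob := (@sobolev0 R n s r).
Local Notation "'N u" := (sobolev_norm s u) (at level 10, u at level 8).
Hypothesis sob_lip : forall u, sob u -> bounded_lip u (C * 'N u) (C * 'N u).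
Hypothesis delta_gt0 : forall e, 0 < e -> 0 < delta e.

(* Shared by the functionals of probability measures and preserved by pointwise
   limits; it lets finite nets for the sup norm control the operator norm. *)
Definition sup_contraction (l : D) := forall u w (c d e : R), sob u -> sob w ->
  (forall x, `|c * u x - d * w x| <= e) -> `|c * l u - d * l w| <= e.

(** The modulus [delta] is fixed in advance, which makes equicontinuity a closed condition. *)
Definition equicontinuous_contractions : set (Cseg a b D) :=
  [set f | (forall t, sup_contraction (f t)) /\
    forall e, 0 < e -> forall t t', `|set_val t - set_val t'| <= delta e ->
    forall u, sob u -> `|f t u - f t' u| <= e * 'N u].

Lemma Hdual_subE (l l' : D) u : (l - l') u = l u - l' u.
Proof. by rewrite /= mul1r addr0 mulN1r. Qed.

Lemma sup_contraction_bound (l : D) u : sup_contraction l -> sob u -> `|l u| <= C * 'N u.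
Proof.
move=> ml su; have := ml u u 1 0 (C * 'N u) su su.
rewrite !mul1r mul0r subr0; apply=> x; rewrite mul1r mul0r subr0.
exact: (sob_lip su).1.
Qed.

Section limit.
Variable F : set_system (Cseg a b D).
Hypothesis UF : UltraFilter F.
Hypothesis FW : F equicontinuous_contractions.

Let PF : ProperFilter F. Proof. exact: ultra_proper. Qed.

Let lim_ t u : R := lim ((fun f : Cseg a b D => f t u) @ F).

Let lim_cvg t u : sob u -> (fun f : Cseg a b D => f t u) @ F --> lim_ t u.
Proof.
move=> su.
have FB : F [set f : Cseg a b D | `|f t u| <= C * 'N u].
  by apply: filterS FW => f [Wf _] /=; exact: sup_contraction_bound.
have [y Fy] := ultra_bounded_cvg UF FB.
by rewrite /lim_ (cvg_lim _ Fy).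
Qed.

Let lim_comb t u w (c d : R) : sob u -> sob w ->
  (fun f : Cseg a b D => c * f t u - d * f t w) @ F --> c * lim_ t u - d * lim_ t w.
Proof.
by move=> su sw; apply: cvgB; apply: cvgM; [exact: cvg_cst|exact: lim_cvg|exact: cvg_cst|exact: lim_cvg].
Qed.

Let lim_bound t u : sob u -> `|lim_ t u| <= C * 'N u.
Proof.
move=> su; refine (cvg_norm_le PF (lim_cvg su) _).
by apply: filterS FW => f [Wf _] /=; exact: sup_contraction_bound.
Qed.

Let limD t u := if pselect (sob u) then lim_ t u else 0.

Let limDE t u : sob u -> limD t u = lim_ t u.
Proof. by rewrite /limD; case: pselect. Qed.

Let limD_lin t c u v : sob u -> sob v ->
  limD t (fun x => c * u x + v x) = c * limD t u + limD t v.
Proof.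
move=> su sv; have sc := sobolev0_comb c su sv.
rewrite !limDE//; have L1 := @lim_cvg t _ sc.
have L2 : (fun f : Cseg a b D => c * f t u + f t v) @ F --> c * lim_ t u + lim_ t v.
  by apply: cvgD; [apply: cvgM; [exact: cvg_cst|exact: lim_cvg]|exact: lim_cvg].
have E : (fun f : Cseg a b D => f t (comb c u v)) = (fun f => c * f t u + f t v).
  by apply/funext => f; exact: hfun_lin.
by rewrite E in L1; exact: cvg_unique L1 L2.
Qed.

Let limD_bnd t : exists C' : R, forall u, sob u -> `|limD t u| <= C' * 'N u.
Proof. by exists C => u su; rewrite limDE// lim_bound. Qed.

Let limD_out t u : ~ sob u -> limD t u = 0.
Proof. by rewrite /limD; case: pselect. Qed.

Let L t : D := MkHdual (@limD_lin t) (limD_bnd t) (@limD_out t).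

Let LE t u : sob u -> L t u = lim_ t u. Proof. exact: limDE. Qed.

Let L_contraction t : sup_contraction (L t).
Proof.
move=> u w c d e su sw uw; rewrite !LE//.
refine (cvg_norm_le PF (@lim_comb t u w c d su sw) _).
by apply: filterS FW => f [Wf _] /=; exact: Wf.
Qed.

Let L_equi e : 0 < e -> forall t t', `|set_val t - set_val t'| <= delta e ->
  forall u, sob u -> `|L t u - L t' u| <= e * 'N u.
Proof.
move=> e0 t t' tt u su; rewrite !LE//.
have tu : (fun f : Cseg a b D => f t u - f t' u) @ F --> lim_ t u - lim_ t' u.
  by apply: cvgB; exact: lim_cvg.
refine (cvg_norm_le PF tu _).
by apply: filterS FW => f [_ Wf] /=; exact: Wf.
Qed.

Let L_continuous : continuous L.
Proof.
move=> t; apply/(@cvgrPdist_le _ _ _ (nbhs t) (nbhs_filter t)) => e e0.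
have vt : set_val t' @[t' --> t] --> set_val t by exact: initial_continuous.
move/cvgrPdist_le : vt => /(_ _ (delta_gt0 e0)); apply: filterS => t' tt.
apply: op_norm_le; first exact: ltW.
by move=> u su; rewrite [X in `|X|]Hdual_subE; exact: L_equi.
Qed.

Definition ultra_limit : Cseg a b D := mkcts L_continuous.

Lemma ultra_limit_in : equicontinuous_contractions ultra_limit.
Proof. by split; [exact: L_contraction|exact: L_equi]. Qed.

Let pos_norm (u : 'rV[R]_n -> R) : 'N u != 0 -> 0 < 'N u.
Proof. by move=> nu; rewrite lt_neqAle eq_sym nu sobolev_norm_ge0. Qed.

Let unit_le (u : 'rV[R]_n -> R) (l l' : D) e : 0 < 'N u -> `|l u - l' u| <= e * 'N u ->
  `|('N u)^-1 * l u - ('N u)^-1 * l' u| <= e.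
Proof.
by move=> u0; rewrite -mulrBr normrM gtr0_norm ?invr_gt0// ler_pdivrMl// mulrC.
Qed.

(** The limit is built from pointwise convergence only. Equicontinuity reduces to finitely many
    times and [sup_contraction] to finitely many functions, so a finite intersection of members of
    [F] gives uniform closeness in operator norm. *)
Lemma ultra_limit_cvg : F --> (ultra_limit : Cseg a b D).
Proof.
move=> A /Cseg_nbhsP[e e0 eA].
(* Five approximations of size [h] make [e / 2], which leaves the strict inequality. *)
pose h := e / 10; have h0 : 0 < h by rewrite divr_gt0.
have [I [p [pI Ip]]] := compact_net (@segment_compact R a b) (delta_gt0 h0).
have [J [w [sw Jw]]] := sobolev_unit_net sob_lip h0.
pose q i : `[a, b]%classic := SigSub (mem_set (pI i)).
have near_net : F [set f : Cseg a b D | forall ij : I * J,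
    `|L (q ij.1) (w ij.2) - f (q ij.1) (w ij.2)| <= h * 'N (w ij.2)].
  apply: filter_forall => -[i j] /=; have [swj nw] := sw j.
  have hw : 0 < h * 'N (w j) by rewrite mulr_gt0// pos_norm.
  move/cvgrPdist_le : (@lim_cvg (q i) _ swj) => /(_ _ hw).
  by apply: filterS => f; rewrite -(LE _ swj).
refine (@filterS _ F _ _ _ _ (filterI FW near_net)) => f [[fc fe] fn]; apply: eA => t.
apply: (@le_lt_trans _ _ (5 * h)); last by rewrite /h; lra.
apply: op_norm_le => [|u su]; first by rewrite mulr_ge0// ltW.
rewrite [X in `|X|]Hdual_subE.
have [u0|nu] := eqVneq ('N u) 0.
  by have := op_normP (L t - f t) su; rewrite Hdual_subE u0 !mulr0.
have nu0 := pos_norm nu.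
have [|i ti] := Ip (set_val t); first exact: (set_valP t).
have [j uj] := Jw u su nu.
have [swj /pos_norm nw] := sw j.
have d1 := unit_le nu0 (@L_equi h h0 t (q i) (ltW ti) u su).
have d2 := L_contraction (q i) su swj uj.
have d3 := unit_le nw (fn (i, j)).
have d4 := fc (q i) u (w j) _ _ _ su swj uj.
have d5 := unit_le nu0 (fe h h0 t (q i) (ltW ti) u su).
exact: chain_le nu0 d1 d2 d3 d4 d5.
Qed.

End limit.

Lemma compact_equicontinuous_contractions : compact equicontinuous_contractions.
Proof.
rewrite compact_ultra => F UF FW.
by exists (ultra_limit UF FW); split; [exact: ultra_limit_in|exact: ultra_limit_cvg].
Qed.

(** Together with compactness this makes the family precompact, a property that passes to its
    subsets. *)
Lemma closed_equicontinuous_contractions : closed equicontinuous_contractions.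
Proof.
move=> f cf.
have approx e : 0 < e -> exists2 g, equicontinuous_contractions g &
    forall t u, sob u -> `|f t u - g t u| <= e * 'N u.
  move=> e0; have /cf[g [Wg fg]] : nbhs f [set g | forall t, `|f t - g t| < e].
    by apply/Cseg_nbhsP; exists e.
  exists g => // t u su; rewrite -Hdual_subE (le_trans (op_normP _ su))//.
  by rewrite ler_wpM2r ?sobolev_norm_ge0// ltW// fg.
split=> [t u w c d e su sw uw|e e0 t t' tt u su].
- apply/ler_addgt0Pr => h h0.
  have k0 : 0 < `|c| * 'N u + `|d| * 'N w + 1.
    by rewrite ltr_wpDl// addr_ge0// mulr_ge0// sobolev_norm_ge0.
  have [g [gc _] fg] := approx _ (divr_gt0 h0 k0).
  have gt := gc t u w c d e su sw uw.
  exact: perturb_le (ltW h0) (sobolev_norm_ge0 _ _) (sobolev_norm_ge0 _ _) (fg t u su)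
    (fg t w sw) gt.
- apply/ler_addgt0Pr => h h0.
  have k0 : 0 < `|1| * 'N u + `|1| * 'N u + 1.
    by rewrite ltr_wpDl// addr_ge0// mulr_ge0// sobolev_norm_ge0.
  have [g [_ ge] fg] := approx _ (divr_gt0 h0 k0).
  have gt := ge e e0 t t' tt u su.
  rewrite -[f t u]mul1r -[f t' u]mul1r.
  apply: perturb_le (ltW h0) (sobolev_norm_ge0 _ _) (sobolev_norm_ge0 _ _) (fg t u su)
    (fg t' u su) _.
  by rewrite !mul1r.
Qed.

Lemma precompact_contractions (S : set (Cseg a b D)) :
  S `<=` equicontinuous_contractions -> compact (closure S).
Proof.
move=> SW; rewrite -precompactE; apply: (precompact_subset SW).
rewrite precompact_closed; first exact: compact_equicontinuous_contractions.
exact: closed_equicontinuous_contractions.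
Qed.

End compactness.

(** Carries an increment in time from a function [w i] of the net, with norm [c] and values [y1],
    [y2], to a function with norm [a] and values [x1], [x2]. *)
Lemma transfer_le {R : realFieldType} (a c x1 x2 y1 y2 b h : R) : 0 < h -> 0 < a -> 0 < c ->
  `|a^-1 * x1 - c^-1 * y1| <= h -> `|a^-1 * x2 - c^-1 * y2| <= h ->
  `|y2 - y1| <= (h + b) * c -> b <= h + h -> `|x2 - x1| <= 8 * h * a.
Proof.
move=> h0 a0 c0 d1 d2 d3 bh.
have {}d3 : `|c^-1 * y2 - c^-1 * y1| <= h + b.
  by rewrite -mulrBr normrM gtr0_norm ?invr_gt0// ler_pdivrMl// mulrC.
have -> : x2 - x1 = a * (a^-1 * x2 - a^-1 * x1).
  by rewrite -mulrBr mulrA divff ?gt_eqF// mul1r.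
rewrite normrM gtr0_norm// mulrC ler_pM2r//.
move: (a^-1 * x1) (a^-1 * x2) (c^-1 * y1) (c^-1 * y2) d1 d2 d3 => z1 z2 z3 z4.
rewrite !ler_norml => /andP[? ?] /andP[? ?] /andP[? ?].
by apply/andP; split; lra.
Qed.

(** * Functionals given by probability measures *)

Section sobolev_functionals.
Context {R : realType} {n : nat}.
Variables (s r C : R).
Local Notation sob := (@sobolev0 R n s r).
Local Notation "'N u" := (sobolev_norm s u) (at level 10, u at level 8).
Hypothesis sob_bd : forall u : 'rV[R]_n -> R, continuous u ->
  (forall x, ~ eball r x -> u x = 0) -> (sobolev_sqnorm s u < +oo)%E ->
  bounded_lip u (C * 'N u) (C * 'N u).

Lemma sobolev0_lip u : sob u -> bounded_lip u (C * 'N u) (C * 'N u).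
Proof. by move=> [cu u0 su _]; exact: sob_bd. Qed.

Lemma sobolev0_Cb u : sob u -> Cb u.
Proof. by move=> /sobolev0_lip; exact: bounded_lip_Cb. Qed.

(** Density of test functions in the Sobolev norm becomes density in the sup norm by the embedding,
    applied to [u - phi j]. For this [sob_bd] is stated for continuous functions of finite norm
    vanishing off the ball, without reference to approximating sequences. *)
Lemma sobolev0_approx u (e : R) : sob u -> 0 < e ->
  exists2 phi, test_fun r phi & forall x, `|u x - phi x| <= e.
Proof.
move=> [cu u0 su [phi [tphi phiu]]] e0.
pose k := e / (`|C| + 1); have k0 : 0 < k by rewrite divr_gt0// ltr_wpDl.
pose q j := sobolev_sqnorm s (fun x => u x - phi j x).
have : \forall j \near \oo, (q j < (k ^+ 2)%:E)%E.
  have small0 : nbhs (0%E : \bar R) [set x | (x < (k ^+ 2)%:E)%E].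
    by apply: open_ereal_lt'; rewrite lte_fin exprn_gt0.
  exact: phiu small0.
move=> [j _ /(_ j (leqnn j))] /= small; exists (phi j); first exact: tphi.
have [cp p0] := test_fun_support (tphi j).
have [||| ub _] := sob_bd (u := fun x => u x - phi j x).
- exact: continuous_sub.
- by move=> x nx; rewrite u0// p0// subrr.
- exact: lt_trans small (ltry _).
move=> x; rewrite (le_trans (ub x))//.
have nk : 'N (fun x => u x - phi j x) <= k.
  rewrite /sobolev_norm -[leRHS]gtr0_norm// -sqrtr_sqr ler_wsqrtr//.
  rewrite -lee_fin fineK ?ltW//.
  by rewrite ge0_fin_numE; [exact: lt_trans small (ltry _)|exact: sobolev_sqnorm_ge0].
rewrite (le_trans (ler_wpM2r (sobolev_norm_ge0 _ _) (ler_norm C)))//.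
rewrite (le_trans (ler_wpM2l (normr_ge0 C) nk))//.
by rewrite /k mulrA ler_pdivrMr ?ltr_wpDl// mulrC mulrDr mulr1 lerDl ltW.
Qed.

Section measure.
Variable m : probability 'rV[R]_n R.

Let mint u := if pselect (sob u) then \int[m]_x u x else 0.

Let mintE u : sob u -> mint u = \int[m]_x u x.
Proof. by rewrite /mint; case: pselect. Qed.

Let mint_lin c u v : sob u -> sob v ->
  mint (fun x => c * u x + v x) = c * mint u + mint v.
Proof.
move=> su sv; have sc := sobolev0_comb c su sv; rewrite !mintE//.
have iu := Cb_integrable m (sobolev0_Cb su); have iv := Cb_integrable m (sobolev0_Cb sv).
by rewrite RintegralD//; [rewrite RintegralZl|exact: integrable_scale].
Qed.

Let mint_bnd : exists C' : R, forall u, sob u -> `|mint u| <= C' * 'N u.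
Proof.
exists C => u su; rewrite mintE//; apply: mean_bound; first exact: sobolev0_Cb.
by have [] := sobolev0_lip su.
Qed.

Let mint_out u : ~ sob u -> mint u = 0.
Proof. by rewrite /mint; case: pselect. Qed.

Definition measure_elt : Hdual n s r := MkHdual mint_lin mint_bnd mint_out.

Lemma measure_eltE u : sob u -> measure_elt u = \int[m]_x u x.
Proof. exact: mintE. Qed.

Lemma measure_elt_contraction : sup_contraction measure_elt.
Proof.
move=> u w c d e su sw uw; rewrite !measure_eltE//.
have [cu [B uB]] := sobolev0_Cb su; have [cw [B' wB]] := sobolev0_Cb sw.
have iu := Cb_integrable m (sobolev0_Cb su); have iw := Cb_integrable m (sobolev0_Cb sw).
rewrite -!RintegralZl//; apply: mean_close => //; split; try exact: continuous_scale.
  by exists (`|c| * B) => x; rewrite normrM ler_wpM2l.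
by exists (`|d| * B') => x; rewrite normrM ler_wpM2l.
Qed.

End measure.

(** * Equicontinuity in time, uniform in the scale *)

Section modulus.
Variables (p : R -> R -> probability 'rV[R]_n R) (K K' t0 : R).
Local Notation E lam t u := (\int[p lam t]_x u x).
Hypothesis K_ge0 : 0 <= K.
Hypothesis K'_ge0 : 0 <= K'.
Hypothesis p_lip : forall u B l lam t1 t2, bounded_lip u B l -> 0 <= l -> 1 < lam ->
  t0 <= t1 -> t1 <= t2 -> `|E lam t2 u - E lam t1 u| <= (K * B + K' * l) * lam ^+ 2 * (t2 - t1).
Hypothesis p_test : forall phi, test_fun r phi -> exists B L : R,
  [/\ 0 <= B, 1 <= L & forall lam t1 t2, L <= lam -> t0 <= t1 -> t1 <= t2 ->
    `|E lam t2 phi - E lam t1 phi| <= B * (lam^-1 + (t2 - t1))].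
Hypothesis C_ge0 : 0 <= C.

(** [w] is replaced by a test function within [e / 2] in sup norm, at both times. [B] and [L] depend
    on [w], so the result is applied to the members of a finite net. *)
Lemma sobolev_asymptotic_modulus w (e : R) : sob w -> 0 < e -> exists B L : R,
  [/\ 0 <= B, 1 <= L & forall lam t1 t2, L <= lam -> t0 <= t1 -> t1 <= t2 ->
    `|E lam t2 w - E lam t1 w| <= e + B * (lam^-1 + (t2 - t1))].
Proof.
move=> sw e0; have e2 : 0 < e / 2 by rewrite divr_gt0.
have [phi tphi wphi] := sobolev0_approx sw e2.
have [B [L [B0 L1 BL]]] := p_test tphi; exists B, L; split=> // lam t1 t2 Ll t01 t12.
have Cw := sobolev0_Cb sw.
have Cphi : Cb phi.
  have [cphi p0] := test_fun_support tphi; split=> //.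
  by have [b _ pb] := compact_support_bounded cphi p0; exists b.
have a2 := mean_close (p lam t2) Cw Cphi wphi.
have a1 := mean_close (p lam t1) Cw Cphi wphi.
have a := BL lam t1 t2 Ll t01 t12.
move: (E lam t2 w) (E lam t1 w) (E lam t2 phi) (E lam t1 phi) a1 a2 a => x y z v.
move: (B * _) => b; rewrite !ler_norml => /andP[? ?] /andP[? ?] /andP[? ?].
by apply/andP; split; lra.
Qed.

Lemma sobolev_modulus (e : R) : 0 < e -> exists2 d, 0 < d &
  forall lam t1 t2, 1 < lam -> t0 <= t1 -> t1 <= t2 -> t2 - t1 <= d ->
  forall u, sob u -> `|E lam t2 u - E lam t1 u| <= e * 'N u.
Proof.
move=> e0; pose h := e / 8; have h0 : 0 < h by rewrite divr_gt0.
have [I [w [sw Iw]]] := sobolev_unit_net sobolev0_lip h0.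
have wpos i : 0 < 'N (w i).
  by have [_ nw] := sw i; rewrite lt_neqAle eq_sym nw sobolev_norm_ge0.
have wmod i : exists BL : R * R, [/\ 0 <= BL.1, 1 <= BL.2 &
    forall lam t1 t2, BL.2 <= lam -> t0 <= t1 -> t1 <= t2 ->
    `|E lam t2 (w i) - E lam t1 (w i)| <= (h + BL.1 * (lam^-1 + (t2 - t1))) * 'N (w i)].
  have [B [L [B0 L1 BL]]] := sobolev_asymptotic_modulus (sw i).1 (mulr_gt0 h0 (wpos i)).
  exists (B / 'N (w i), L); split=> //=; first by rewrite divr_ge0// ltW.
  move=> lam t1 t2 Ll t01 t12; rewrite (le_trans (BL _ _ _ Ll t01 t12))//.
  by rewrite mulrDl lerD// mulrAC divfK// gt_eqF.
have [BL BLP] := choice wmod.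
(* Sums bound all constants of the net at once. The term [B / h] in [L] ensures [B / lam <= h] as
   soon as [L <= lam]. *)
pose B := \sum_i (BL i).1; pose L := 1 + \sum_i (BL i).2 + B / h.
have BL1 i : 0 <= (BL i).1 by have [] := BLP i.
have BL2 i : 0 <= (BL i).2 by have [_ /(le_trans ler01)] := BLP i.
have B0 : 0 <= B by rewrite sumr_ge0.
have iB i : (BL i).1 <= B by rewrite /B (bigD1 i)//= lerDl sumr_ge0.
have Bh : 0 <= B / h by rewrite divr_ge0// ltW.
have iL i : (BL i).2 <= \sum_j (BL j).2 by rewrite (bigD1 i)//= lerDl sumr_ge0.
have S0 : 0 <= \sum_j (BL j).2 by rewrite sumr_ge0.
have L1 : 1 <= L by rewrite /L -addrA lerDl addr_ge0.
have L0 : 0 < L := lt_le_trans ltr01 L1.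
(* The Lipschitz constant in time, per unit of norm, valid for all [lam] below [L]. *)
pose G := (K * C + K' * C) * L ^+ 2.
have G0 : 0 <= G by rewrite mulr_ge0 ?sqr_ge0// addr_ge0// mulr_ge0.
have B1 : 0 < B + 1 by rewrite ltr_wpDl.
have G1 : 0 < G + 1 by rewrite ltr_wpDl.
exists (Num.min (h / (B + 1)) (e / (G + 1))).
  by rewrite lt_min !divr_gt0.
move=> lam t1 t2 lam1 t01 t12; rewrite le_min => /andP[d1 d2] u su.
have [uB ul] := sobolev0_lip su.
have Nu0 : 0 <= 'N u := sobolev_norm_ge0 s u.
(* Below [L] the Lipschitz bound in time is uniform in [lam]; above [L] the
   estimate on test functions takes over. *)
have [lamL|Llam] := ltP lam L.
  have CN : 0 <= C * 'N u by rewrite mulr_ge0.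
  rewrite (le_trans (p_lip (conj uB ul) CN lam1 t01 t12))//.
  have -> : (K * (C * 'N u) + K' * (C * 'N u)) * lam ^+ 2 * (t2 - t1) =
     ((K * C + K' * C) * lam ^+ 2 * (t2 - t1)) * 'N u by ring.
  apply: ler_wpM2r => //.
  have t210 : 0 <= t2 - t1 by rewrite subr_ge0.
  apply: (@le_trans _ _ (G * (t2 - t1))).
    apply: ler_wpM2r => //; apply: ler_wpM2l; first by rewrite addr_ge0// mulr_ge0.
    by rewrite ler_pXn2r ?nnegrE// ltW// (lt_trans ltr01).
  rewrite (le_trans (ler_wpM2l G0 d2))// mulrCA -[leRHS]mulr1 ler_wpM2l ?ltW//.
  by rewrite ltr_pdivrMr// mul1r ltrDl.
have [u0|nu] := eqVneq ('N u) 0.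
  have u00 x : `|u x| <= 0 by rewrite (le_trans (uB x))// u0 mulr0.
  have m0 t := mean_bound (p lam t) (sobolev0_Cb su) u00.
  by rewrite (le_trans (ler_normB _ _))// u0 mulr0 -[leRHS]addr0 lerD.
have nu0 : 0 < 'N u by rewrite lt_neqAle eq_sym nu.
have [i ui] := Iw u su nu; have [_ _ /(_ lam t1 t2)] := BLP i.
have lami : (BL i).2 <= lam.
  by rewrite (le_trans _ Llam)// (le_trans (iL i))// /L; lra.
move=> /(_ lami t01 t12) wi.
have c1 := measure_elt_contraction (p lam t1) su (sw i).1 ui.
have c2 := measure_elt_contraction (p lam t2) su (sw i).1 ui.
rewrite (measure_eltE _ su) (measure_eltE _ (sw i).1) in c1.
rewrite (measure_eltE _ su) (measure_eltE _ (sw i).1) in c2.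
have small : (BL i).1 * (lam^-1 + (t2 - t1)) <= h + h.
  have lamB : B * lam^-1 <= h.
    rewrite ler_pdivrMr ?(lt_le_trans L0)// mulrC -ler_pdivrMr// (le_trans _ Llam)//.
    by rewrite /L lerDr addr_ge0.
  have tB : B * (t2 - t1) <= h.
    rewrite (le_trans (ler_wpM2l B0 d1))// mulrCA -[leRHS]mulr1 ler_wpM2l ?ltW//.
    by rewrite ltr_pdivrMr// mul1r ltrDl.
  have lt0 : 0 <= lam^-1 + (t2 - t1).
    by rewrite addr_ge0 ?subr_ge0// invr_ge0 (le_trans _ Llam)// ltW.
  rewrite (le_trans (ler_wpM2r lt0 (iB i)))// mulrDr; exact: lerD.
have e8 : 8 * h = e by rewrite /h mulrC divfK.
have := transfer_le h0 nu0 (wpos i) c1 c2 wi small; rewrite e8; exact.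
Qed.

Lemma rescaled_precompact (T : R) : exists P : R -> Cseg t0 T (Hdual n s r),
  (forall lam, 1 < lam -> forall t : set_type `[t0, T],
     is_measure_elt (P lam t) (p lam (set_val t))) /\
  compact (closure (P @` [set lam | 1 < lam])).
Proof.
(* The implication from [0 < e] makes [delta] a total function; its value at other [e] is
   arbitrary. *)
have /choice[delta dP] : forall e : R, exists d : R, 0 < e -> 0 < d /\
    forall lam t1 t2, 1 < lam -> t0 <= t1 -> t0 <= t2 -> `|t1 - t2| <= d ->
    forall u, sob u -> `|measure_elt (p lam t1) u - measure_elt (p lam t2) u| <= e * 'N u.
  move=> e; have [e0|e0] := ltP 0 e; last by exists 0.
  have [d d0 dm] := sobolev_modulus e0.
  exists d => _; split=> // lam t1 t2 lam1 t01 t02 t12 u su.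
  rewrite (measure_eltE _ su) (measure_eltE _ su).
  move: t12; have [t12|/ltW t12] := leP t1 t2; rewrite ?[ `|t1 - t2|]distrC => td.
    by rewrite distrC; apply: dm => //; rewrite (le_trans (ler_norm _)).
  by apply: dm => //; rewrite (le_trans (ler_norm _))// distrC.
have delta_gt0 e : 0 < e -> 0 < delta e by move=> /dP[].
have valP' (t : `[t0, T]%classic) : t0 <= set_val t.
  by have := set_valP t; rewrite /= in_itv/= => /andP[].
have cts lam : 1 < lam ->
    continuous (fun t : `[t0, T]%classic => measure_elt (p lam (set_val t))).
  move=> lam1 t; apply/(@cvgrPdist_le _ _ _ (nbhs t) (nbhs_filter t)) => e e0.
  have vt : set_val t' @[t' --> t] --> set_val t by exact: initial_continuous.
  move/cvgrPdist_le : vt => /(_ _ (delta_gt0 e e0)); apply: filterS => t' tt.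
  apply: op_norm_le; first exact: ltW.
  move=> u su; rewrite [X in `|X|]Hdual_subE.
  exact: ((dP e e0).2 lam _ _ lam1 (valP' t) (valP' t') tt u su).
(* For [lam <= 1] no continuity is available, and the curve of index 2 serves as a default value. *)
have /choice[P PE] : forall lam, exists f : Cseg t0 T (Hdual n s r), 1 < lam ->
    forall t, f t = measure_elt (p lam (set_val t)).
  move=> lam; have [lam1|lam1] := ltP 1 lam; first by exists (mkcts (cts lam lam1)).
  by exists (mkcts (cts 2 (ltr1n _ 2))).
exists P; split=> [lam lam1 t u su|]; first by rewrite PE// measure_eltE.
apply: (precompact_contractions sobolev0_lip delta_gt0) => _ [lam /= lam1 <-].
split=> [t|e e0 t t' tt u su]; first by rewrite PE//; exact: measure_elt_contraction.
rewrite !PE//.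
exact: ((dP e e0).2 lam _ _ lam1 (valP' t) (valP' t') tt u su).
Qed.

End modulus.

End sobolev_functionals.

Theorem theorem16 (R : realType) (N : nat) (hN : (1 <= N)%N)
  (Q : probability (R * 'rV[R]_N)%type R) (hQ : Q slab = 1%E)
  (hQ2 : (\int[Q]_(p in slab) (enorm p.2 ^+ 2)%:E < +oo)%E)
  (alpha : R -> R -> R) (alpha_inf : R -> R) (M beta : R)
  (hM : 0 < M) (hbeta : 0 < beta)
  (halpha : rate_assumption alpha alpha_inf M beta)
  (u0 : R -> probability 'rV[R]_N R)
  (hu0 : {within `[-1, 0], continuous (u0 : R -> narrow R N)})
  (mu : R -> probability 'rV[R]_N R)
  (hmu : delay_solution alpha Q u0 mu)
  (p : R -> R -> probability 'rV[R]_N R)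
  (hp : rescaled_family alpha alpha_inf Q mu p)
  (r epsilon T sigma : R) (hr : 0 < r)
  (hepsilon : 0 < epsilon) (hT : epsilon < T)
  (hsigma : N%:R / 2 + 2 < sigma) :
  exists2 lambda0 : R, 0 < lambda0 &
  exists P : R -> Cseg epsilon T (Hdual N (sigma + 1) r),
    (forall lambda, lambda0 < lambda ->
       forall t : set_type `[epsilon, T],
         is_measure_elt (P lambda t) (p lambda (set_val t))) /\
    compact (closure (P @` [set lambda | lambda0 < lambda])).
Proof.
have [[a_gt0 [K0 a_le] a_cont] [ai_gt0 ai_cont a_close]] := halpha.
have [mu_cont _ mu_delay] := hmu.
have N0 : (0 < N)%N by [].
(* One bound for both rates: at time 0 the limit rate differs from [alpha] by at most [M]. The
   summand 1 provides [1 <= K], which [relaxation] uses. *)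
pose K := `|K0| + M + 1.
have K1 : 1 <= K by rewrite /K lerDr addr_ge0// ltW.
have K_ge0 : 0 <= K := le_trans ler01 K1.
have inI (th : R) : -1 <= th <= 0 -> th \in `[-1, 0] by rewrite in_itv.
have aK t th : 0 <= t -> -1 <= th <= 0 -> 0 <= alpha t th <= K.
  move=> t0 /inI hth; rewrite ltW ?a_gt0//= (le_trans (a_le _ _ t0 hth))//.
  by rewrite (le_trans (ler_norm K0))// /K -addrA lerDl addr_ge0// ltW.
have aiK th : -1 <= th <= 0 -> 0 <= alpha_inf th <= K.
  move=> /inI hth; rewrite ltW ?ai_gt0//=.
  have := a_close 0 th (lexx 0) hth; have := a_le 0 th (lexx 0) hth.
  rewrite mulr0 oppr0 expR0 mulr1 ler_norml => aK0 /andP[+ _].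
  by have := ler_norm K0; rewrite /K; lra.
have ac t th : 0 <= t -> -1 <= th <= 0 -> `|alpha t th - alpha_inf th| <= M * expR (- (beta * t)).
  by move=> t0 /inI; exact: a_close.
have mu_d (f : 'rV[R]_N -> R) : Cb f -> forall t : R, 0 < t ->
    is_derive t (1 : R) (fun t : R => \int[mu t]_x f x) (delay_rhs alpha Q mu f t).
  by move=> /mu_delay[].
(* With [s = sigma + 1] this is the condition [s - 1 > N / 2] of the embedding. *)
have s1 : 1 < 2 * ((sigma + 1 - 1) / N%:R).
  rewrite addrK mulrA ltr_pdivlMr ?ltr0n// mul1r.
  by have : 0 < N%:R :> R; [rewrite ltr0n|lra].
have [C C0 HC] := @sobolev_lipschitz R N r (sigma + 1) N0 s1.
have sob_bd (u : 'rV[R]_N -> R) : continuous u -> (forall x, ~ eball r x -> u x = 0) ->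
    (sobolev_sqnorm (sigma + 1) u < +oo)%E ->
    bounded_lip u (C * sobolev_norm (sigma + 1) u) (C * sobolev_norm (sigma + 1) u).
  move=> cu uz su; have [uB ul] := HC u cu uz su; split=> // x y.
  by rewrite mulrAC; exact: ul.
have pE lam t u : 1 <= lam -> epsilon <= t -> Cb u ->
    \int[p lam t]_x u x = position Q alpha alpha_inf mu u lam (lam ^+ 2 * t).
  move=> lam1 et Cu; have lam0 : 0 < lam := lt_le_trans ltr01 lam1.
  have t0 : 0 <= t := le_trans (ltW hepsilon) et.
  have lt0 : 0 <= lam ^+ 2 * t by rewrite mulr_ge0// sqr_ge0.
  by rewrite hp// /position /obs max_l// (le_trans _ lt0)// oppr_le0.
have m0 : 0 <= moment Q by rewrite (le_trans ler01)// moment_ge1.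
(* [1 <= lambda] is used to bound inverse powers of [lambda]; the larger thresholds that depend on
   the accuracy or on the test function are handled in [sobolev_modulus]. *)
exists 1; first exact: ltr01.
apply: (@rescaled_precompact R N (sigma + 1) r C sob_bd p (K * 2) (K * moment Q) epsilon) => //.
- by rewrite mulr_ge0.
- by rewrite mulr_ge0.
- move=> u B l lam t1 t2 ul l0 lam1 et1 t12; have Cu := bounded_lip_Cb ul.
  have lam0 : 0 < lam := lt_trans ltr01 lam1.
  rewrite !pE ?(ltW lam1) ?(le_trans et1)//.
  have s0 : 0 < lam ^+ 2 * t1 by rewrite mulr_gt0 ?exprn_gt0// (lt_le_trans hepsilon).
  have st : lam ^+ 2 * t1 <= lam ^+ 2 * t2 by rewrite ler_wpM2l ?sqr_ge0.
  have := position_lip hQ hQ2 K1 aK aiK a_cont ai_cont mu_cont mu_d (ltW lam1) ul l0 s0 st.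
  have E k m : (k * (2 * B) + l * (k * m)) * (lam ^+ 2 * t2 - lam ^+ 2 * t1) =
    (k * 2 * B + k * m * l) * lam ^+ 2 * (t2 - t1) by ring.
  by rewrite E.
- move=> phi tphi; have [L L0 [cphi cphi_ [phiL phi_L] [lphi lphi_] tay]] := test_fun_regular tphi.
  have bphi : bounded_lip phi L L.
    by split=> // x y; have := lphi y (x - y); rewrite [y + _]addrC subrK.
  have bphi_ i : bounded_lip ('D_(delta_mx ord0 i) phi) L L.
    by split=> [x|x y]; [exact: phi_L|have := lphi_ i y (x - y); rewrite [y + _]addrC subrK].
  have [B [Lam [B0 Lam1 BL]]] := test_equicontinuous hQ hQ2 K1 hM hbeta aK aiK a_cont ai_cont
    ac mu_cont mu_d L0 bphi bphi_ tay hepsilon.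
  exists B, Lam; split=> // lam t1 t2 Ll et1 t12; have Cphi := bounded_lip_Cb bphi.
  have lam1 : 1 <= lam := le_trans Lam1 Ll.
  rewrite !pE ?(le_trans et1)//; exact: BL.
Qed.
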